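(* Let $\Theta=(\theta_m)_{m\ge1}$ be a sequence of non-negative real numbers. (i) For each $w\in\mathbb{C}$, as formal power series in $t$, $$\sum_{n=0}^\infty h_n\,\mathbb{E}_\Theta\big[\exp(wK_{0n})\big]t^n=\sum_{n=0}^\infty h_n\,\mathbb{E}_\Theta\Big[\exp\Big(w\sum_{m=1}^nC_m^{(n)}\Big)\Big]t^n=\exp\big(e^w g_\Theta(t)\big).$$ (ii) If $g_\Theta$ is of class $\mathcal{F}(r,\theta)$, then, as $n\to\infty$, $$\mathbb{E}_\Theta\big[\exp(isK_{0n})\big]=n^{\theta(e^{is}-1)}e^{K(e^{is}-1)}\Big(\frac{\Gamma(\theta)}{\Gamma(\theta e^{is})}+O\Big(\frac1n\Big)\Big),$$ with $O(\cdot)$ uniform for bounded $s$. (iii) If $g_\Theta$ is of class $e\mathcal{F}(r,\theta,\gamma)$, then, as $n\to\infty$, $$\mathbb{E}_\Theta\big[\exp(isK_{0n})\big]=n^{\theta(e^{is}-1)}e^{K(e^{is}-1)}\frac{\Gamma(\theta)}{\Gamma(\theta e^{is})}+O\Big(\frac{\log n}{n^\gamma}\Big),$$ with $O(\cdot)$ uniform for bounded $s$. Here $s$ is real and $K$ is the constant attached to the class of $g_\Theta$.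
   Context: For $\sigma$ in the symmetric group $S_n$, $C_m^{(n)}(\sigma)$ is the number of cycles of length $m$ in the disjoint cycle decomposition of $\sigma$, and $K_{0n}=\sum_{m=1}^nC_m^{(n)}$ is the total number of cycles. The weighted measure on $S_n$ is $\mathbb{P}_\Theta[\sigma]=\frac{1}{h_n n!}\prod_{m=1}^n\theta_m^{C_m^{(n)}(\sigma)}$, with normalization $h_n=\frac1{n!}\sum_{\sigma\in S_n}\prod_{m=1}^n\theta_m^{C_m^{(n)}(\sigma)}$ and $h_0=1$; $\mathbb{E}_\Theta$ is expectation under $\mathbb{P}_\Theta$ (when $h_n=0$, the product $h_n\mathbb{E}_\Theta[u]$ is read as $\frac1{n!}\sum_\sigma u(\sigma)\prod_m\theta_m^{C_m^{(n)}(\sigma)}=0$; for $n=0$ the expectation is $1$). Put $g_\Theta(t)=\sum_{k\ge1}\frac{\theta_k}{k}t^k$. The function $1/\Gamma$ is entire, equal to $0$ at the poles of $\Gamma$. For $0<r<R$ and $0<\phi<\pi/2$ let $\Delta_0(r,R,\phi)=\{z\in\mathbb{C}: |z|<R,\ z\ne r,\ |\arg(z-r)|>\phi\}$. For $r>0$ and $\theta\ge0$, a function $g$ is of class $\mathcal{F}(r,\theta)$ if there are $R>r$ and $0<\phi<\pi/2$ such that $g$ is holomorphic in $\Delta_0(r,R,\phi)$, and there is a constant $K$ with $g(t)=\theta\log\frac{1}{1-t/r}+K+O(t-r)$ as $t\to r$. For $r>0$, $\theta\ge0$ and $0<\gamma\le1$, a function $g$ is of class $e\mathcal{F}(r,\theta,\gamma)$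 if $g(t)=\theta\log\frac{1}{1-t/r}+g_0(t)$ with $g_0$ analytic in $\{|t|<r\}$ and $[t^n]g_0=O(r^{-n}n^{-1-\gamma})$, where $[t^n]g_0$ is the coefficient of $t^n$; in this case one puts $K=g_0(r)=\sum_n([t^n]g_0)\,r^n$. For the formal power series $g_\Theta$, being of such a class means that it converges near $0$ and its sum (analytically continued if necessary) has the stated properties.
   Formalization: In (ii) and (iii) θ > 0 is assumed, although the classes allow θ = 0: there Γ(θ) is undefined, and for g_Θ(t) = t the expectation is e^{isn}, which no value of the quotient of Gammas can match. *)

(* Defs.v *)
(* World: MathComp + MathComp-Analysis; the complex numbers are R[i] for an
   arbitrary R : realType. *)
From HB Require Import structures.
From mathcomp Require Import all_boot all_order all_algebra all_fingroup.
From mathcomp Require Import complex.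
From mathcomp Require Import all_classical all_reals all_analysis.

Set Implicit Arguments.
Unset Strict Implicit.
Unset Printing Implicit Defensive.
Import Order.TTheory GRing.Theory Num.Theory numFieldNormedType.Exports.
Import ComplexField.Normc.

Local Open Scope classical_set_scope.
Local Open Scope ring_scope.
Local Open Scope complex_scope.

Section ComplexFunctions.
Context {R : realType}.
Implicit Types (z : R[i]) (n : nat).

Definition cexp z : R[i] :=
  (expR (complex.Re z))%:C * (cos (complex.Im z) +i* sin (complex.Im z)).

(* Principal value, in ]-pi, pi] for z != 0. *)
Definition carg z : R :=
  let a := acos (complex.Re z / normc z) in
  if 0 <= complex.Im z then a else - a.

Definition clog z : R[i] := ln (normc z) +i* carg z.

Definition natcpow n z : R[i] := cexp (z * (ln (n%:R : R))%:C).

(* Gauss' product formula 1/Gamma(z) = lim z(z+1)...(z+n) / (n! n^z), whose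
   limit exists for every complex z and vanishes at 0, -1, -2, ... *)
Definition rGamma z : R[i] :=
  lim ((fun n => (\prod_(0 <= k < n.+1) (z + k%:R)) /
                 (n`!%:R * natcpow n z) : R[i]^o) @ \oo).

(* The default value at the poles is 0^-1 = 0, so (Gamma z)^-1 = rGamma z for
   every z, the poles included. *)
Definition Gamma z : R[i] := (rGamma z)^-1.

(* The library puts the complex topology on the regular module R[i]^o. *)
Definition holomorphic_on (U : set R[i]) (f : R[i] -> R[i]) : Prop :=
  forall z, U z -> derivable (f : R[i]^o -> R[i]^o) z 1.

Definition is_sum_near0 (c : nat -> R[i]) (g : R[i] -> R[i]) : Prop :=
  \forall t \near (0 : R[i]^o),
    series (fun k => c k * t ^+ k : R[i]^o) @ \oo --> (g t : R[i]^o).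

Definition Delta0 (r rho phi : R) : set R[i] :=
  [set z | [/\ normc z < rho, z != r%:C & phi < `|carg (z - r%:C)| ]].

Definition log_sing (r theta : R) (t : R[i]) : R[i] :=
  theta%:C * clog ((1 - t / r%:C)^-1).

Definition class_F (r theta : R) (K : R[i]) (g : R[i] -> R[i]) : Prop :=
  [/\ 0 < r, 0 <= theta &
   exists rho phi : R,
     [/\ r < rho, 0 < phi < pi / 2, holomorphic_on (Delta0 r rho phi) g &
      exists M : R, \forall t \near (r%:C : R[i]^o), Delta0 r rho phi t ->
        normc (g t - (log_sing r theta t + K)) <= M * normc (t - r%:C)]].

Definition class_eF (r theta gamma : R) (K : R[i]) (g : R[i] -> R[i]) : Prop :=
  [/\ 0 < r, 0 <= theta, 0 < gamma <= 1 &
   exists (g0 : R[i] -> R[i]) (c : nat -> R[i]),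
     [/\ holomorphic_on [set t | normc t < r] g0,
         forall t, normc t < r -> g t = log_sing r theta t + g0 t,
         is_sum_near0 c g0,
         exists M : R, \forall n \near \oo,
           normc (c n) <= M * (r ^- n * n%:R `^ (- 1 - gamma)) &
         series (fun n => c n * r%:C ^+ n : R[i]^o) @ \oo --> (K : R[i]^o)]].

End ComplexFunctions.

(* Formal power series are represented by their coefficient sequences. *)
Section FormalPowerSeries.
Context {A : fieldType}.
Implicit Types a b : nat -> A.

Definition fps_one : nat -> A := fun n => (n == 0)%:R.

Definition fps_mul a b : nat -> A :=
  fun n => \sum_(i < n.+1) a i * b (n - i)%N.

Definition fps_pow a (j : nat) : nat -> A := iter j (fps_mul a) fps_one.

(* Meant for a 0 = 0: then t^n does not occur in a^j for j > n, so the sum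
   over all j >= 0 of [t^n] a^j / j! stops at j = n. *)
Definition fps_exp a : nat -> A :=
  fun n => \sum_(j < n.+1) fps_pow a j n / j`!%:R.

End FormalPowerSeries.

Definition ncycles n (m : nat) (sigma : 'S_n) : nat :=
  #|[set c in porbits sigma | #|c| == m]|.

Definition K0 n (sigma : 'S_n) : nat := \sum_(1 <= m < n.+1) ncycles m sigma.

Section WeightedMeasure.
Context {R : realType}.
Variable Theta : nat -> R. (* only the values at m >= 1 are used *)

Definition weight n (sigma : 'S_n) : R :=
  \prod_(1 <= m < n.+1) Theta m ^+ ncycles m sigma.

Definition h n : R := (n`!%:R)^-1 * \sum_(sigma : 'S_n) weight sigma.

(* Equal to 0 if h n = 0, so that h n times an expectation is then 0. *)
Definition PTheta n (sigma : 'S_n) : R := (h n * n`!%:R)^-1 * weight sigma.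

Definition ETheta n (u : 'S_n -> R[i]) : R[i] :=
  \sum_(sigma : 'S_n) (PTheta sigma)%:C * u sigma.

Definition gTheta (k : nat) : R[i] :=
  if k is 0 then 0 else (Theta k / k%:R)%:C.

Definition gTheta_class (P : (R[i] -> R[i]) -> Prop) : Prop :=
  exists g, is_sum_near0 gTheta g /\ P g.

End WeightedMeasure.

(* Main.v *)
(* Splitting off the cycle of one point shows that the numbers
   h_n E[exp(w K_0n)] satisfy the recursion of the coefficients of
   exp(e^w g(t)). With alpha = e^{is}, this reduces (ii) and (iii) to estimates,
   uniform in s, of the coefficients of exp(alpha g): both compare them with the
   coefficients of e^{alpha K} (1 - t/r)^{-alpha theta}, which are known from
   Gauss' product for 1/Gamma, and the expectation is the quotient by the case
   alpha = 1.

   In case (ii) the coefficients of the difference are integrals along a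
   contour which passes the singularity at distance of order 1/n; in the
   coordinate w = log (t/r) the contour is polygonal, and Goursat's theorem for
   triangles suffices. In case (iii) the sequences which are O(n^(-1-gamma)) form
   an algebra under convolution, so the coefficients of exp(alpha g0) are again
   of this order, and their convolution with the coefficients of
   (1 - t)^{-alpha theta} is estimated separately for indices below and above
   n/2. *)
Require Import Defs.
From mathcomp Require Import all_boot all_order all_algebra all_fingroup.
From mathcomp Require Import complex.
From mathcomp Require Import all_classical all_reals all_analysis.
From mathcomp Require Import zify ring lra.
Set Implicit Arguments.
Unset Strict Implicit.
Unset Printing Implicit Defensive.
Import Order.TTheory GRing.Theory Num.Theory numFieldNormedType.Exports.
Import ComplexField.Normc.
Local Open Scope classical_set_scope.
Local Open Scope ring_scope.
Local Open Scope complex_scope.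

(** * Moduli, limits and complex derivatives *)

Section Modulus.
Context {R : realType}.
Implicit Types (z w : R[i]) (x y : R).

Lemma normc_ge0 z : 0 <= normc z.
Proof. by case: z => a b; rewrite /normc sqrtr_ge0. Qed.

Lemma normc_norm z : `|z| = (normc z)%:C.
Proof. by case: z. Qed.

Lemma ler_normcD z w : normc (z + w) <= normc z + normc w.
Proof. exact: le_normcD. Qed.

Lemma normcB z w : normc (z - w) = normc (w - z).
Proof. by rewrite -opprB; exact: normcN. Qed.

Lemma normcNE z : normc (- z) = normc z.
Proof. exact: normcN. Qed.

Lemma ler_normcB z w : normc (z - w) <= normc z + normc w.
Proof. by rewrite -(normcNE w); exact: ler_normcD. Qed.

Lemma ler_normc_dist z w : `|normc z - normc w| <= normc (z - w).
Proof.
have h1 : normc z <= normc (z - w) + normc w by have := ler_normcD (z - w) w; rewrite subrK.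
have h2 : normc w <= normc (w - z) + normc z by have := ler_normcD (w - z) z; rewrite subrK.
rewrite normcB in h2; rewrite ler_norml; apply/andP; split; lra.
Qed.

Lemma normc_real x : normc x%:C = `|x|.
Proof. by rewrite /= expr0n addr0 sqrtr_sqr. Qed.

Lemma normc_nat n : normc (n%:R : R[i]) = n%:R.
Proof.
by rewrite -(rmorph_nat (real_complex R)) normc_real ger0_norm.
Qed.

Lemma normc0E : normc (0 : R[i]) = 0. Proof. exact: normc0. Qed.
Lemma normc1E : normc (1 : R[i]) = 1. Proof. exact: normc1. Qed.

Lemma normc_eq0 z : (normc z == 0) = (z == 0).
Proof.
by apply/eqP/eqP => [/eq0_normc //|->]; rewrite normc0E.
Qed.

Lemma normc_gt0 z : (0 < normc z) = (z != 0).
Proof. by rewrite lt_neqAle normc_ge0 andbT eq_sym normc_eq0. Qed.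

Lemma normcX z n : normc (z ^+ n) = normc z ^+ n.
Proof. by elim: n => [|n ih]; rewrite ?expr0 ?normc1E // !exprS normcM ih. Qed.

Lemma ler_normc_sum (I : Type) (r : seq I) (P : pred I) (F : I -> R[i]) :
  normc (\sum_(i <- r | P i) F i) <= \sum_(i <- r | P i) normc (F i).
Proof.
elim/big_rec2 : _ => [|i y x _ h]; first by rewrite normc0E.
by apply: le_trans (ler_normcD _ _) _; rewrite lerD2l.
Qed.

Lemma normc_prod (I : Type) (r : seq I) (P : pred I) (F : I -> R[i]) :
  normc (\prod_(i <- r | P i) F i) = \prod_(i <- r | P i) normc (F i).
Proof.
by elim/big_rec2 : _ => [|i y x _ h]; rewrite ?normc1E // normcM h.
Qed.

Lemma ReD z w : complex.Re (z + w) = complex.Re z + complex.Re w.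
Proof. by case: z; case: w. Qed.
Lemma ImD z w : complex.Im (z + w) = complex.Im z + complex.Im w.
Proof. by case: z; case: w. Qed.
Lemma ReN z : complex.Re (- z) = - complex.Re z.
Proof. by case: z. Qed.
Lemma ImN z : complex.Im (- z) = - complex.Im z.
Proof. by case: z. Qed.
Lemma ReM z w : complex.Re (z * w) =
  complex.Re z * complex.Re w - complex.Im z * complex.Im w.
Proof. by case: z; case: w. Qed.
Lemma ImM z w : complex.Im (z * w) =
  complex.Re z * complex.Im w + complex.Im z * complex.Re w.
Proof. by case: z => a b; case: w => c d /=; rewrite addrC addrC. Qed.

Lemma ler_normRe z : `|complex.Re z| <= normc z.
Proof.
case: z => a b /=; rewrite -sqrtr_sqr ler_sqrt ?lerDl ?sqr_ge0 //.
by rewrite addr_ge0 ?sqr_ge0.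
Qed.

Lemma ler_normIm z : `|complex.Im z| <= normc z.
Proof.
case: z => a b /=; rewrite -sqrtr_sqr ler_sqrt ?lerDr ?sqr_ge0 //.
by rewrite addr_ge0 ?sqr_ge0.
Qed.

Lemma ler_Re z : complex.Re z <= normc z.
Proof. exact: le_trans (ler_norm _) (ler_normRe z). Qed.

Lemma ler_normc_ReIm z : normc z <= `|complex.Re z| + `|complex.Im z|.
Proof.
case: z => a b /=; rewrite -(ger0_norm (x := `|a| + `|b|)) ?addr_ge0//.
rewrite -sqrtr_sqr ler_sqrt ?sqr_ge0 // sqrrD !real_normK ?num_real //.
by rewrite -addrA lerD2l lerDr mulrn_wge0 // mulr_ge0.
Qed.

Lemma normc_sqr z : normc z ^+ 2 = complex.Re z ^+ 2 + complex.Im z ^+ 2.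
Proof. by case: z => a b /=; rewrite sqr_sqrtr // addr_ge0 ?sqr_ge0. Qed.

Lemma complex_eqP z w :
  complex.Re z = complex.Re w -> complex.Im z = complex.Im w -> z = w.
Proof. by case: z => a b; case: w => c d /= -> ->. Qed.

End Modulus.

Section ComplexLimits.
Context {R : realType}.
Implicit Types (z w : R[i]) (x y : R).

Lemma cvg_normcP {T : Type} {F : set_system T} {FF : Filter F} (f : T -> R[i]) (l : R[i]) :
  (f : T -> R[i]^o) @ F --> (l : R[i]^o) <->
  (forall e : R, 0 < e -> \forall x \near F, normc (l - f x) < e).
Proof.
split=> [/cvgrPdist_lt h e e0|h].
  have /h : 0 < (e%:C : R[i]) by rewrite ltcR.
  by apply: filterS => x; rewrite normc_norm ltcR.
apply/cvgrPdist_lt => e e0.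
have ee : e = (complex.Re e)%:C.
  by move: e0; case: (e) => a b; rewrite ltcE /= => /andP[/eqP -> _].
have e0' : 0 < complex.Re e by rewrite -ltcR -ee.
by apply: filterS (h _ e0') => x hx; rewrite normc_norm ee ltcR.
Qed.

Lemma near_normcP z (P : R[i] -> Prop) :
  (\forall t \near (z : R[i]^o), P t) <->
  (exists2 d : R, 0 < d & forall t, normc (t - z) < d -> P t).
Proof.
split.
  move=> /nbhs_ballP [e /= e0 he].
  have ee : e = (complex.Re e)%:C.
    by move: e0; case: (e) => a b; rewrite ltcE /= => /andP[/eqP -> _].
  exists (complex.Re e); first by rewrite -ltcR -ee.
  move=> t ht; apply: he.
  by rewrite -ball_normE /ball_ /= normc_norm ee ltcR normcB.
move=> [d d0 h]; apply/nbhs_ballP; exists d%:C => /=; first by rewrite ltcR.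
move=> t; rewrite -ball_normE /ball_ /= normc_norm ltcR normcB; exact: h.
Qed.

Lemma lim_normc (u : nat -> R[i]) l :
  (forall e : R, 0 < e -> \forall n \near \oo, normc (l - u n) < e) ->
  lim ((u : nat -> R[i]^o) @ \oo) = l :> R[i]^o.
Proof. by move=> /cvg_normcP h; apply/cvg_lim. Qed.

Lemma cvg_normc_unique (u : nat -> R[i]) (k l : R[i]) :
  (u : nat -> R[i]^o) @ \oo --> (l : R[i]^o) -> (u : nat -> R[i]^o) @ \oo --> (k : R[i]^o) ->
  k = l.
Proof.
by move=> /cvg_lim <- // /cvg_lim <-.
Qed.

Definition ccont (f : R[i] -> R[i]) z :=
  forall e : R, 0 < e ->
  exists2 d : R, 0 < d & forall w, normc (w - z) < d -> normc (f w - f z) < e.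

Lemma ccont_cst c z : ccont (fun=> c) z.
Proof. by move=> e e0; exists 1 => // w _; rewrite subrr normc0E. Qed.

Lemma ccont_id z : ccont id z.
Proof. by move=> e e0; exists e. Qed.

Lemma ccontD f g z : ccont f z -> ccont g z -> ccont (fun w => f w + g w) z.
Proof.
move=> hf hg e e0.
have e20 : 0 < e / 2 by rewrite divr_gt0.
have [d d0 hd] := hf _ e20; have [d' d'0 hd'] := hg _ e20.
exists (Num.min d d'); first by rewrite lt_min d0.
move=> w; rewrite lt_min => /andP[/hd h1 /hd' h2].
have -> : f w + g w - (f z + g z) = (f w - f z) + (g w - g z) by ring.
by apply: le_lt_trans (ler_normcD _ _) _; lra.
Qed.

Lemma ccontM f g z : ccont f z -> ccont g z -> ccont (fun w => f w * g w) z.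
Proof.
move=> hf hg e e0.
set M := normc (f z) + normc (g z) + 1.
have M0 : 0 < M by have := normc_ge0 (f z); have := normc_ge0 (g z); rewrite /M; lra.
have e20 : 0 < Num.min (e / (2 * M)) 1 by rewrite lt_min ltr01 andbT divr_gt0 // mulr_gt0.
have [d d0 hd] := hf _ e20; have [d' d'0 hd'] := hg _ e20.
exists (Num.min d d'); first by rewrite lt_min d0.
move=> w; rewrite lt_min => /andP[/hd h1 /hd' h2].
move: h1 h2; rewrite !lt_min => /andP[h1 h1'] /andP[h2 h2'].
have -> : f w * g w - f z * g z =
   (f w - f z) * (g w - g z) + (f w - f z) * g z + f z * (g w - g z) by ring.
have k1 := normc_ge0 (f z); have k2 := normc_ge0 (g z).
have k3 := normc_ge0 (f w - f z); have k4 := normc_ge0 (g w - g z).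
apply: le_lt_trans (ler_normcD _ _) _.
apply: le_lt_trans (lerD (ler_normcD _ _) (lexx _)) _.
rewrite !normcM.
have heM : e / (2 * M) * M = e / 2 by field; lra.
set A := normc (f w - f z) in h1 h1' k3 *; set B := normc (g w - g z) in h2 h2' k4 *.
have : A * B + A * normc (g z) <= e / (2 * M) * (1 + normc (g z)).
  by rewrite -mulrDr ler_pM ?addr_ge0 // ?lerD2r // ltW.
have : normc (f z) * B <= normc (f z) * (e / (2 * M)) by rewrite ler_wpM2l // ltW.
have : 0 < e / (2 * M) by rewrite divr_gt0 // mulr_gt0.
move: heM; rewrite /M; set E := e / (2 * _) => heM E0 h3 h4; lra.
Qed.

Lemma ccont_comp f g z : ccont g z -> ccont f (g z) -> ccont (fun w => f (g w)) z.
Proof.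
move=> hg hf e e0; have [d d0 hd] := hf _ e0; have [d' d'0 hd'] := hg _ d0.
by exists d' => // w /hd' /hd.
Qed.

Lemma ccont_near f g z (d : R) : 0 < d ->
  (forall w, normc (w - z) < d -> f w = g w) -> ccont f z -> ccont g z.
Proof.
move=> d0 fg hf e e0; have [d' d'0 hd'] := hf _ e0.
exists (Num.min d d'); first by rewrite lt_min d0.
move=> w; rewrite lt_min => /andP[h1 /hd' h2].
by rewrite -!fg ?subrr ?normc0E.
Qed.

(* Caratheodory's form of complex differentiability. *)
Definition cdiff (f : R[i] -> R[i]) z d :=
  exists q : R[i] -> R[i],
    [/\ forall w, f w - f z = q w * (w - z), q z = d & ccont q z].

Lemma cdiff_cst c z : cdiff (fun=> c) z 0.
Proof.
exists (fun=> 0); split=> //; last exact: ccont_cst.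
by move=> w; rewrite subrr mul0r.
Qed.

Lemma cdiff_id z : cdiff id z 1.
Proof. by exists (fun=> 1); split=> [w||]; rewrite ?mul1r //; exact: ccont_cst. Qed.

Lemma cdiff_cont f z d : cdiff f z d -> ccont f z.
Proof.
move=> [q [hq _ qc]].
apply: (@ccont_near (fun w => f z + q w * (w - z)) _ _ 1) => //.
  by move=> w _; rewrite -hq addrC subrK.
apply: ccontD; first exact: ccont_cst.
apply: ccontM => //; apply: ccontD; [exact: ccont_id|exact: ccont_cst].
Qed.

Lemma cdiffD f g z a b : cdiff f z a -> cdiff g z b ->
  cdiff (fun w => f w + g w) z (a + b).
Proof.
move=> [q [hq qz qc]] [q' [hq' qz' qc']].
exists (fun w => q w + q' w); split; last exact: ccontD.
  by move=> w; rewrite mulrDl -hq -hq'; ring.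
by rewrite qz qz'.
Qed.

Lemma cdiffM f g z a b : cdiff f z a -> cdiff g z b ->
  cdiff (fun w => f w * g w) z (a * g z + f z * b).
Proof.
move=> df dg; have fc := cdiff_cont df.
case: df dg => [q [hq qz qc]] [q' [hq' qz' qc']].
exists (fun w => q w * g z + f w * q' w); split.
- move=> w; rewrite mulrDl.
  have -> : q w * g z * (w - z) = (f w - f z) * g z by rewrite hq; ring.
  have -> : f w * q' w * (w - z) = f w * (g w - g z) by rewrite hq'; ring.
  ring.
- by rewrite qz qz'.
- apply: ccontD; first by apply: ccontM => //; exact: ccont_cst.
  exact: ccontM.
Qed.

Lemma cdiffZ f z a c : cdiff f z a -> cdiff (fun w => c * f w) z (c * a).
Proof.
by move=> df; have := cdiffM (cdiff_cst c z) df; rewrite mul0r add0r.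
Qed.

Lemma cdiffN f z a : cdiff f z a -> cdiff (fun w => - f w) z (- a).
Proof.
move=> [q [hq qz qc]]; exists (fun w => - q w); split.
- by move=> w; rewrite mulNr -hq; ring.
- by rewrite qz.
- apply: (@ccont_near (fun w => -1 * q w) _ _ 1) => // [w _|]; first by ring.
  by apply: ccontM => //; exact: ccont_cst.
Qed.

Lemma cdiffB f g z a b : cdiff f z a -> cdiff g z b ->
  cdiff (fun w => f w - g w) z (a - b).
Proof. by move=> df dg; apply: cdiffD => //; exact: cdiffN. Qed.

Lemma cdiff_comp f g z a b : cdiff g z b -> cdiff f (g z) a ->
  cdiff (fun w => f (g w)) z (a * b).
Proof.
move=> dg; have gc := cdiff_cont dg.
case: dg => [q [hq qz qc]] [p [hp pz pc]].
exists (fun w => p (g w) * q w); split.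
- by move=> w; rewrite hp hq mulrA.
- by rewrite /= pz qz.
- apply: ccontM => //; exact: ccont_comp.
Qed.

Lemma cdiff_near f g z d (e : R) : 0 < e ->
  (forall w, normc (w - z) < e -> f w = g w) -> cdiff f z d -> cdiff g z d.
Proof.
move=> e0 fg [q [hq qz qc]].
exists (fun w => if w == z then d else (g w - g z) / (w - z)); split.
- move=> w; case: eqP => [->|/eqP wz]; first by rewrite !subrr mulr0.
  by rewrite divfK // subr_eq0.
- by rewrite eqxx.
- apply: (@ccont_near q _ _ e) => // w hw.
  case: eqP => [->//|/eqP wz].
  by rewrite -!fg // ?subrr ?normc0E // hq mulfK // subr_eq0.
Qed.

Lemma cdiffP (f : R[i] -> R[i]) z (d : R[i]) :
  (forall e : R, 0 < e -> exists2 r : R, 0 < r &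
     forall w, normc (w - z) < r -> normc (f w - f z - d * (w - z)) <= e * normc (w - z)) ->
  cdiff f z d.
Proof.
move=> h.
exists (fun w => if w == z then d else (f w - f z) / (w - z)); split.
- move=> w; case: eqP => [->|/eqP wz]; first by rewrite !subrr mulr0.
  by rewrite divfK // subr_eq0.
- by rewrite eqxx.
- move=> e e0; have e20 : 0 < e / 2 by rewrite divr_gt0.
  have [r r0 hr] := h _ e20.
  exists r => // w /hr {}hr /=; rewrite eqxx.
  have [_|wz] := eqVneq w z; first by rewrite subrr normc0E.
  have wz0 : w - z != 0 by rewrite subr_eq0.
  have -> : (f w - f z) / (w - z) - d = (f w - f z - d * (w - z)) / (w - z) by field.
  rewrite normcM normcV ltr_pdivrMr ?normc_gt0 //.
  apply: le_lt_trans hr _; rewrite ltr_pM2r ?normc_gt0 //; lra.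
Qed.

Lemma derivable_cdiff (f : R[i] -> R[i]) z :
  derivable (f : R[i]^o -> R[i]^o) z 1 -> exists d, cdiff f z d.
Proof.
move=> h; exists ('D_1 (f : R[i]^o -> R[i]^o) z).
apply: cdiffP => e e0.
move: h; rewrite /derivable => /cvg_normcP /(_ e e0).
rewrite near_withinE => /near_normcP [d d0 hd]; exists d => // w hw.
have [->|wz] := eqVneq w z; first by rewrite !subrr mulr0 subr0 normc0E mulr0.
have wz0 : w - z != 0 by rewrite subr_eq0.
have := hd (w - z); rewrite subr0 => /(_ hw wz0).
rewrite /derive; set D := lim _.
rewrite /= /GRing.scale /= mulr1 subrK => /ltW h.
have -> : f w - f z - D * (w - z) = - (D - (w - z)^-1 * (f w - f z)) * (w - z).
  by rewrite opprB mulrBl mulrAC mulVf // mul1r.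
by rewrite normcM normcNE ler_wpM2r // normc_ge0.
Qed.

End ComplexLimits.

(** * Complex series *)

Section ComplexSums.
Context {R : realType}.
Implicit Types (z w : R[i]) (a b u : nat -> R[i]).

Definition clim u (l : R[i]) :=
  forall e : R, 0 < e ->
  exists N, forall n, (N <= n)%N -> normc (u n - l) < e.

Lemma climP u (l : R[i]) : clim u l <-> (u : nat -> R[i]^o) @ \oo --> (l : R[i]^o).
Proof.
split=> [h|/cvg_normcP h e e0].
  apply/cvg_normcP => e /h [N hN]; exists N => // n /= Nn; rewrite normcB; exact: hN.
by have [N _ hN] := h e e0; exists N => n /hN; rewrite normcB.
Qed.

Lemma clim_unique u (k l : R[i]) : clim u l -> clim u k -> k = l.
Proof. by move=> /climP h1 /climP h2; exact: cvg_normc_unique h1 h2. Qed.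

Lemma eq_clim u v (l : R[i]) : u =1 v -> clim u l -> clim v l.
Proof. by move=> uv h e /h [N hN]; exists N => n /hN; rewrite uv. Qed.

Lemma clim_cst (c : R[i]) : clim (fun=> c) c.
Proof. by move=> e e0; exists 0%N => n _; rewrite subrr normc0E. Qed.

Lemma climD u v (k l : R[i]) : clim u k -> clim v l -> clim (fun n => u n + v n) (k + l).
Proof.
move=> hu hv e e0; have e20 : 0 < e / 2 by rewrite divr_gt0.
have [N hN] := hu _ e20; have [M hM] := hv _ e20; exists (maxn N M) => n.
rewrite geq_max => /andP[/hN h1 /hM h2].
have -> : u n + v n - (k + l) = (u n - k) + (v n - l) by ring.
by apply: le_lt_trans (ler_normcD _ _) _; lra.
Qed.

Lemma climZ u (c k : R[i]) : clim u k -> clim (fun n => c * u n) (c * k).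
Proof.
move=> hu e e0; have c0 := normc_ge0 c.
have [|N hN] := hu (e / (normc c + 1)); first by rewrite divr_gt0 // ltr_wpDl.
exists N => n /hN h; rewrite -mulrBr normcM.
have : normc c * normc (u n - k) <= normc c * (e / (normc c + 1)).
  by rewrite ler_wpM2l // ltW.
move=> /le_lt_trans; apply; rewrite mulrCA gtr_pMr // ltr_pdivrMr; lra.
Qed.

Lemma clim_normc_le u (l : R[i]) (M : R) : (forall n, normc (u n) <= M) -> clim u l ->
  normc l <= M.
Proof.
move=> h hl; apply/ler_addgt0Pr => e e0.
have [N /(_ N (leqnn _)) hN] := hl _ e0.
have := ler_normc_dist l (u N); rewrite normcB ler_norml => /andP[_].
have := h N; lra.
Qed.

Lemma clim_bounded u (l : R[i]) : clim u l -> exists M, forall n, normc (u n) <= M.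
Proof.
move=> /(_ 1 ltr01) [N hN].
exists (\sum_(k < N) normc (u k) + normc l + 1) => n.
have s0 : 0 <= \sum_(k < N) normc (u k) by apply: sumr_ge0 => i _; exact: normc_ge0.
have l0 := normc_ge0 l.
have [/hN h|nN] := leqP N n.
  have := ler_normc_dist (u n) l; rewrite ler_norml => /andP[_]; lra.
have : normc (u n) <= \sum_(k < N) normc (u k).
  rewrite (bigD1 (Ordinal nN)) //= lerDl; apply: sumr_ge0 => i _; exact: normc_ge0.
lra.
Qed.

Lemma climM u v (k l : R[i]) : clim u k -> clim v l -> clim (fun n => u n * v n) (k * l).
Proof.
move=> hu hv; have [M hM] := clim_bounded hu => e e0.
have M0 : 0 <= M by apply: le_trans (hM 0%N); exact: normc_ge0.
have [N1 h1] := climZ l hu (divr_gt0 e0 (ltr0n _ 2)).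
have [|N2 h2] := hv (e / 2 / (M + 1)); first by rewrite !divr_gt0 // ltr_wpDl.
exists (maxn N1 N2) => n; rewrite geq_max => /andP[/h1 k1 /h2 k2].
have -> : u n * v n - k * l = u n * (v n - l) + (l * u n - l * k) by ring.
apply: le_lt_trans (ler_normcD _ _) _; rewrite normcM.
have : normc (u n) * normc (v n - l) <= M * (e / 2 / (M + 1)).
  by apply: ler_pM; rewrite ?normc_ge0 ?hM // ltW.
have : M * (e / 2 / (M + 1)) <= e / 2.
  have -> : M * (e / 2 / (M + 1)) = e / 2 * (M / (M + 1)) by ring.
  apply: ler_piMr; first by rewrite ltW // divr_gt0.
  by rewrite ler_pdivrMr; lra.
lra.
Qed.

Lemma clim_shift u (l : R[i]) : clim (fun n => u n.+1) l -> clim u l.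
Proof.
by move=> h e /h [N hN]; exists N.+1 => -[//|n] /hN.
Qed.

Lemma cauchy_clim u :
  (forall e : R, 0 < e -> exists N, forall n, (N <= n)%N -> normc (u n - u N) < e) ->
  exists l, clim u l.
Proof.
move=> h.
have key (p : R[i] -> R) : (forall z w, p (z - w) = p z - p w) ->
   (forall z, `|p z| <= normc z) -> cvg ((fun n => p (u n)) @ \oo).
  move=> pB pn; apply: cauchy_cvg; apply: cauchy_exP => e e0.
  have [N hN] := h e e0; exists (p (u N)); exists N => // n /= Nn.
  rewrite /ball /= distrC -pB; exact: le_lt_trans (pn _) (hN _ Nn).
have /cvg_ex [x /= /cvgrPdist_lt hx] : cvg ((fun n => complex.Re (u n)) @ \oo).
  by apply: key => [z w|]; [rewrite ReD ReN|exact: ler_normRe].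
have /cvg_ex [y /= /cvgrPdist_lt hy] : cvg ((fun n => complex.Im (u n)) @ \oo).
  by apply: key => [z w|]; [rewrite ImD ImN|exact: ler_normIm].
exists (x +i* y) => e e0; have e20 : 0 < e / 2 by rewrite divr_gt0.
have [N _ hN] := hx _ e20; have [M _ hM] := hy _ e20; exists (maxn N M) => n.
rewrite geq_max => /andP[/hN /= h1 /hM /= h2].
apply: le_lt_trans (ler_normc_ReIm _) _.
rewrite ReD ReN ImD ImN /= distrC (distrC _ y); lra.
Qed.

Lemma bounded_nondecreasing_cauchy (s : nat -> R) (S : R) :
  (forall n, s n <= s n.+1) -> (forall n, s n <= S) ->
  forall e : R, 0 < e -> exists N, forall n, (N <= n)%N -> s n - s N < e.
Proof.
move=> si sS e e0; have si' : nondecreasing_seq s by apply/nondecreasing_seqP.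
have : cvgn s by apply: nondecreasing_is_cvgn => //; exists S => _ [n _ <-].
move=> cv; have := cv => /cvgrPdist_lt /(_ _ e0) [N _ hN]; exists N => n Nn.
have /= := hN N (leqnn _).
have /(_ n) := nondecreasing_cvgn_le si' cv.
have := ler_norm (lim (s @ \oo) - s N).
set l := lim _; lra.
Qed.

Definition csum a (l : R[i]) := clim (fun N => \sum_(k < N) a k) l.

Definition summable_by a (S : R) := forall N, \sum_(k < N) normc (a k) <= S.

Lemma eq_csum a b (l : R[i]) : a =1 b -> csum a l -> csum b l.
Proof. by move=> ab; apply: eq_clim => n; apply: eq_bigr => i _. Qed.

Lemma csumP a (l : R[i]) :
  csum a l <-> series (a : nat -> R[i]^o) @ \oo --> (l : R[i]^o).
Proof.
rewrite /csum climP.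
suff -> : series (a : nat -> R[i]^o) = (fun N => \sum_(k < N) a k) by [].
by apply/funext => n; rewrite /series /= big_mkord.
Qed.

Lemma summable_cauchy a S : summable_by a S ->
  forall e : R, 0 < e -> exists N, forall n, (N <= n)%N ->
   \sum_(k < n) normc (a k) - \sum_(k < N) normc (a k) < e.
Proof.
move=> aS; apply: bounded_nondecreasing_cauchy aS => n.
by rewrite big_ord_recr /= lerDl normc_ge0.
Qed.

Lemma sum_ord_split (V : zmodType) (F : nat -> V) N n : (N <= n)%N ->
  \sum_(k < n) F k - \sum_(k < N) F k = \sum_(N <= k < n) F k.
Proof.
move=> Nn; rewrite -(big_mkord xpredT F) -(big_mkord xpredT F).
by rewrite (big_cat_nat (leq0n N) Nn) /= addrAC subrr add0r.
Qed.

Lemma summable_csum a S : summable_by a S -> exists l, csum a l.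
Proof.
move=> aS; apply: cauchy_clim => e e0.
have [N hN] := summable_cauchy aS e0; exists N => n Nn.
rewrite (sum_ord_split a Nn); apply: le_lt_trans (hN _ Nn).
by rewrite (sum_ord_split (fun k => normc (a k)) Nn) ler_normc_sum.
Qed.

Lemma csum_normc_le a S (l : R[i]) : summable_by a S -> csum a l -> normc l <= S.
Proof.
move=> aS; apply: clim_normc_le => n; exact: le_trans (ler_normc_sum _ _ _) (aS n).
Qed.

Lemma csumD a b (k l : R[i]) : csum a k -> csum b l -> csum (fun n => a n + b n) (k + l).
Proof.
move=> ha hb; apply: eq_clim (climD ha hb) => n; by rewrite -big_split.
Qed.

Lemma csumZ a (c k : R[i]) : csum a k -> csum (fun n => c * a n) (c * k).
Proof. by move=> ha; apply: eq_clim (climZ c ha) => n; rewrite mulr_sumr. Qed.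

Lemma sum_fps_mul (A : fieldType) (a b : nat -> A) N :
  \sum_(n < N) fps_mul a b n = \sum_(i < N) a i * \sum_(j < N - i) b j.
Proof.
elim: N => [|N ih]; first by rewrite !big_ord0.
rewrite big_ord_recr /= ih /fps_mul [RHS]big_ord_recr /= big_ord_recr /= addrA.
congr (_ + _); last by rewrite subSnn big_ord1 subnn.
rewrite -big_split; apply: eq_bigr => i _.
by rewrite /= -mulrDr subSn ?(ltnW (ltn_ord i)) // big_ord_recr.
Qed.

Lemma summable_fps_mul a b S T : summable_by a S -> summable_by b T ->
  summable_by (fps_mul a b) (S * T).
Proof.
move=> aS bT N.
have T0 : 0 <= T by have := bT 0%N; rewrite big_ord0.
have S0 : 0 <= S by have := aS 0%N; rewrite big_ord0.
pose a' n := normc (a n); pose b' n := normc (b n).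
have : \sum_(k < N) normc (fps_mul a b k) <= \sum_(k < N) fps_mul a' b' k.
  apply: ler_sum => k _; apply: le_trans (ler_normc_sum _ _ _) _.
  by apply: ler_sum => i _; rewrite normcM.
move=> /le_trans; apply; rewrite sum_fps_mul.
have : \sum_(i < N) a' i * \sum_(j < N - i) b' j <= \sum_(i < N) a' i * T.
  by apply: ler_sum => i _; rewrite ler_wpM2l ?normc_ge0 // bT.
move=> /le_trans; apply; rewrite -mulr_suml ler_wpM2r //; exact: aS.
Qed.

(* The truncation error is the sum over the pairs [i, j < N] with [N <= i + j],
   at least one of which is at least [N./2]. *)
Lemma csum_fps_mul a b S T (k l : R[i]) : summable_by a S -> summable_by b T ->
  csum a k -> csum b l -> csum (fps_mul a b) (k * l).
Proof.
move=> aS bT ha hb.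
have T0 : 0 <= T by have := bT 0%N; rewrite big_ord0.
have S0 : 0 <= S by have := aS 0%N; rewrite big_ord0.
have h : clim (fun N => \sum_(n < N) fps_mul a b n -
    (\sum_(n < N) a n) * (\sum_(n < N) b n)) 0.
  move=> e e0.
  have d0 : 0 < e / 2 / (S + T + 1) by rewrite !divr_gt0 // ltr_wpDl ?addr_ge0.
  have [N1 h1] := summable_cauchy aS d0; have [N2 h2] := summable_cauchy bT d0.
  exists (maxn N1 N2).*2 => n hn.
  have hN1 : (N1 <= n - N2)%N by lia.
  rewrite subr0 sum_fps_mul mulr_suml -sumrB.
  apply: le_lt_trans (ler_normc_sum _ _ _) _.
  have le0 (i : 'I_n) : normc (a i * \sum_(j < n - i) b j - a i * \sum_(j < n) b j)
      <= normc (a i) * (e / 2 / (S + T + 1)) + (if (N1 <= i)%N then normc (a i) * T else 0).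
    rewrite -mulrBr normcM normcB (sum_ord_split b) ?leq_subr //.
    have bb : normc (\sum_(n - i <= j < n) b j) <= \sum_(j < n) normc (b j) - \sum_(j < n - i) normc (b j).
      by rewrite (sum_ord_split (fun j => normc (b j))) ?leq_subr // ler_normc_sum.
    have s0 : 0 <= \sum_(j < n - i) normc (b j) by apply: sumr_ge0 => *; exact: normc_ge0.
    have a0 := normc_ge0 (a i).
    case: ifPn => [iN|iN].
      have : normc (a i) * normc (\sum_(n - i <= j < n) b j) <= normc (a i) * T.
        by apply: ler_wpM2l => //; apply: le_trans bb _; have := bT n; lra.
      have : 0 <= normc (a i) * (e / 2 / (S + T + 1)) by rewrite mulr_ge0 // ltW.
      lra.
    move: iN; rewrite -ltnNge => iN.
    rewrite addr0; apply: ler_wpM2l => //; apply: le_trans bb _.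
    have nN2 : (N2 <= n)%N by lia.
    have niN2 : (N2 <= n - i)%N by lia.
    have := h2 _ nN2.
    have : \sum_(j < N2) normc (b j) <= \sum_(j < n - i) normc (b j).
      by rewrite -subr_ge0 (sum_ord_split (fun j => normc (b j))) //; apply: sumr_ge0 => *; exact: normc_ge0.
    lra.
  apply: le_lt_trans (ler_sum _ (fun i _ => le0 i)) _.
  rewrite big_split /= -mulr_suml.
  have : \sum_(i < n) (if (N1 <= i)%N then normc (a i) * T else 0) <=
         (\sum_(k < n) normc (a k) - \sum_(k < N1) normc (a k)) * T.
    have N1n : (N1 <= n)%N by lia.
    rewrite (sum_ord_split (fun j => normc (a j))) // mulr_suml.
    rewrite -(big_mkord xpredT (fun i => if (N1 <= i)%N then normc (a i) * T else 0)).
    rewrite (big_cat_nat (leq0n N1) N1n) /= big_nat_cond big1 ?add0r.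
      by rewrite big_nat_cond [leRHS]big_nat_cond ler_sum // => i /andP[/andP[-> _] _].
    by move=> i /andP[/andP[_ iN] _]; rewrite leqNgt iN.
  have := h1 n; rewrite (leq_trans hN1 (leq_subr _ _)) => /(_ isT) hh.
  have := aS n; have sa0 : 0 <= \sum_(k < n) normc (a k) by apply: sumr_ge0 => *; exact: normc_ge0.
  set D := e / 2 / _ in d0 hh *; set A := \sum_(k < n) normc (a k) in sa0 hh *.
  set A' := \sum_(k < N1) normc (a k) in hh *.
  have DE : D * (S + T + 1) = e / 2 by rewrite /D; field; lra.
  have : (A - A') * T <= D * T by rewrite ler_wpM2r // ltW.
  move=> q1 q2 q3; have : A * D <= S * D by rewrite ler_wpM2r // ltW.
  lra.
have := climD h (climM ha hb); rewrite add0r; apply: eq_clim => n.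
by rewrite subrK.
Qed.

Lemma tannery (f : nat -> nat -> R[i]) (L : nat -> R[i]) (m : nat -> R) (S : R) (l : R[i]) :
  (forall j N, normc (f j N) <= m j) -> (forall N, \sum_(j < N) m j <= S) ->
  (forall j, clim (f j) (L j)) -> csum L l ->
  clim (fun N => \sum_(j < N) f j N) l.
Proof.
move=> fm mS fL Ll e e0.
have m0 j : 0 <= m j by apply: le_trans (fm j 0%N); exact: normc_ge0.
have Lm j : normc (L j) <= m j by apply: clim_normc_le (fL j).
have e40 : 0 < e / 4 by rewrite divr_gt0.
have [|J hJ] := @bounded_nondecreasing_cauchy (fun N => \sum_(j < N) m j) S _ mS _ e40.
  by move=> n; rewrite big_ord_recr /= lerDl.
have : clim (fun N => \sum_(j < J) f j N) (\sum_(j < J) L j).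
  elim: (J) => [|k ih]; first by rewrite big_ord0; apply: eq_clim (clim_cst 0) => n; rewrite big_ord0.
  rewrite big_ord_recr; apply: eq_clim (climD ih (fL k)) => n; by rewrite big_ord_recr.
move=> /(_ _ e40) [N1 h1].
exists (maxn J N1) => n; rewrite geq_max => /andP[Jn /h1 h2].
have h3 : normc (l - \sum_(j < J) L j) <= e / 4.
  have h : clim (fun n => \sum_(j < n + J) L j - \sum_(j < J) L j) (l - \sum_(j < J) L j).
    apply: climD; last exact: clim_cst.
    by move=> d /Ll [M hM]; exists M => k Mk; apply: hM; rewrite (leq_trans Mk) // leq_addr.
  apply: clim_normc_le h => k; rewrite (sum_ord_split L) ?leq_addl //.
  apply: le_trans (ltW (hJ _ (leq_addl k J))); rewrite (sum_ord_split m) ?leq_addl //.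
  by apply: le_trans (ler_normc_sum _ _ _) _; apply: ler_sum.
have h4 : normc (\sum_(j < n) f j n - \sum_(j < J) f j n) < e / 4.
  apply: le_lt_trans (hJ _ Jn); rewrite (sum_ord_split m Jn) (sum_ord_split (fun j => f j n) Jn).
  by apply: le_trans (ler_normc_sum _ _ _) _; apply: ler_sum.
have -> : \sum_(j < n) f j n - l = (\sum_(j < n) f j n - \sum_(j < J) f j n) +
   ((\sum_(j < J) f j n - \sum_(j < J) L j) - (l - \sum_(j < J) L j)) by ring.
apply: le_lt_trans (ler_normcD _ _) _.
have := ler_normcB (\sum_(j < J) f j n - \sum_(j < J) L j) (l - \sum_(j < J) L j); lra.
Qed.

End ComplexSums.

(** * Formal power series *)

Section FpsAlgebra.
Context {A : numFieldType}.
Implicit Types a b u : nat -> A.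

Lemma coef_poly_exp a N j n : (n < N)%N ->
  ((\poly_(i < N) a i) ^+ j)`_n = fps_pow a j n.
Proof.
elim: j n => [|j ih] n nN; first by rewrite expr0 coef1.
rewrite exprS coefM; apply: eq_bigr => -[i /= hi] _.
rewrite coef_poly ih ?(leq_ltn_trans (leq_subr _ _)) //.
by rewrite (leq_trans hi nN).
Qed.

Lemma fps_pow_eq0 a j n : a 0%N = 0 -> (n < j)%N -> fps_pow a j n = 0.
Proof.
move=> a0; elim: j n => [//|j ih] n nj; rewrite /= /fps_mul big1 // => -[[|i] /= hi] _.
  by rewrite a0 mul0r.
by rewrite ih ?mulr0 //; lia.
Qed.

Lemma fps_pow_deriv a j n :
  n.+1%:R * fps_pow a j.+1 n.+1 =
  j.+1%:R * \sum_(i < n.+1) i.+1%:R * a i.+1 * fps_pow a j (n - i).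
Proof.
rewrite -(@coef_poly_exp a n.+2) // mulr_natl -coef_deriv deriv_exp coefMn.
rewrite mulr_natl; congr (_ *+ _); rewrite coefM; apply: eq_bigr => -[i /= hi] _.
have hi' : (i.+1 < n.+2)%N by lia.
rewrite coef_deriv coef_poly hi' -(mulr_natl (a i.+1)) coef_poly_exp //; lia.
Qed.

Lemma fps_exp0 a : fps_exp a 0 = 1.
Proof. by rewrite /fps_exp big_ord1 /= /fps_one eqxx fact0 divr1. Qed.

Lemma fps_expS a n : a 0%N = 0 ->
  n.+1%:R * fps_exp a n.+1 = \sum_(i < n.+1) i.+1%:R * a i.+1 * fps_exp a (n - i).
Proof.
move=> a0; rewrite /fps_exp big_ord_recl /= /fps_one /= mul0r add0r mulr_sumr.
have st (j : 'I_n.+1) : n.+1%:R * (fps_pow a (lift ord0 j) n.+1 / (lift ord0 j)`!%:R) =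
    (\sum_(i < n.+1) i.+1%:R * a i.+1 * fps_pow a j (n - i)) / j`!%:R.
  rewrite lift0 mulrA fps_pow_deriv factS natrM; set S := \sum_(_ < _) _.
  have : (j.+1%:R : A) != 0 by rewrite pnatr_eq0.
  have : (j`!%:R : A) != 0 by rewrite pnatr_eq0 -lt0n fact_gt0.
  by move: (j`!%:R) (j.+1%:R) => x y x0 y0; field; rewrite x0 y0.
rewrite (eq_bigr _ (fun j _ => st j)).
under [RHS]eq_bigr => i _ do rewrite mulr_sumr.
have -> : \sum_(i < n.+1) \sum_(j < (n - i).+1) i.+1%:R * a i.+1 * (fps_pow a j (n - i) / j`!%:R)
  = \sum_(i < n.+1) \sum_(j < n.+1) i.+1%:R * a i.+1 * (fps_pow a j (n - i) / j`!%:R).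
  apply: eq_bigr => i _.
  rewrite [RHS](bigID (fun j : 'I_n.+1 => (j < (n - i).+1)%N)) /=.
  rewrite [X in _ + X]big1 ?addr0.
    rewrite (big_ord_widen_cond n.+1 xpredT (fun j => i.+1%:R * a i.+1 * (fps_pow a j (n - i) / j`!%:R))) //.
    by rewrite ltnS leq_subr.
  by move=> j; rewrite -leqNgt => hj; rewrite fps_pow_eq0 // mul0r mulr0.
rewrite exchange_big /=; apply: eq_bigr => j _.
by rewrite mulr_suml; apply: eq_bigr => i _; rewrite mulrA.
Qed.

Lemma fps_exp_unique a u : a 0%N = 0 -> u 0%N = 1 ->
  (forall n, n.+1%:R * u n.+1 = \sum_(i < n.+1) i.+1%:R * a i.+1 * u (n - i)%N) ->
  u =1 fps_exp a.
Proof.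
move=> a0 u0 hu n; elim/ltn_ind: n => -[_|n ih]; first by rewrite u0 fps_exp0.
have n0 : (n.+1%:R : A) != 0 by rewrite pnatr_eq0.
apply: (mulfI n0); rewrite hu fps_expS //; apply: eq_bigr => i _.
by rewrite ih // ltnS leq_subr.
Qed.

Lemma fps_mul_scale a b t n :
  fps_mul (fun k => a k * t ^+ k) (fun k => b k * t ^+ k) n = fps_mul a b n * t ^+ n.
Proof.
rewrite /fps_mul mulr_suml; apply: eq_bigr => -[i /= hi] _.
by rewrite mulrACA -exprD subnKC.
Qed.

Lemma fps_pow_scale a t j n :
  fps_pow (fun k => a k * t ^+ k) j n = fps_pow a j n * t ^+ n.
Proof.
elim: j n => [|j ih] n /=.
  by rewrite /fps_one; case: n => [|n]; rewrite /= ?mulr1 ?mul0r.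
rewrite -fps_mul_scale; apply: eq_bigr => i _; by rewrite ih.
Qed.

Lemma fps_exp_scale a t n :
  fps_exp (fun k => a k * t ^+ k) n = fps_exp a n * t ^+ n.
Proof.
rewrite /fps_exp mulr_suml; apply: eq_bigr => i _.
by rewrite fps_pow_scale mulrAC.
Qed.

Lemma fps_exp_add a b n : a 0%N = 0 -> b 0%N = 0 ->
  fps_mul (fps_exp a) (fps_exp b) n = fps_exp (fun k => a k + b k) n.
Proof.
move=> a0 b0; apply: (@fps_exp_unique _ (fps_mul (fps_exp a) (fps_exp b))).
- by rewrite a0 b0 addr0.
- by rewrite /fps_mul big_ord1 !fps_exp0 mulr1.
move=> {}n.
pose N := n.+2; pose P (u : nat -> A) := \poly_(i < N) u i.
have PE u i : (i < N)%N -> (P u)`_i = u i by move=> h; rewrite coef_poly h.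
have PM u v i : (i < N)%N -> (P u * P v)`_i = fps_mul u v i.
  move=> iN; rewrite coefM; apply: eq_bigr => -[j /= hj] _; rewrite !PE //; lia.
have dP c i : c 0%N = 0 -> (i < n.+1)%N -> ((P (fps_exp c))^`())`_i = ((P c)^`() * P (fps_exp c))`_i.
  move=> c0 hi; rewrite coef_deriv coefM PE; last by rewrite /N; lia.
  rewrite -mulr_natl fps_expS //; apply: eq_bigr => -[j /= hj] _.
  rewrite coef_deriv !PE; [|by rewrite /N; lia..].
  by rewrite -(mulr_natl (c j.+1)).
rewrite -PM // mulr_natl -coef_deriv derivM coefD.
have -> : ((P (fps_exp a))^`() * P (fps_exp b))`_n =
   ((P a)^`() * (P (fps_exp a) * P (fps_exp b)))`_n.
  rewrite mulrA !coefM; apply: eq_bigr => -[j /= hj] _; by rewrite dP.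
have -> : (P (fps_exp a) * (P (fps_exp b))^`())`_n =
   ((P b)^`() * (P (fps_exp a) * P (fps_exp b)))`_n.
  rewrite mulrCA !coefM; apply: eq_bigr => -[j /= hj] _.
  by rewrite dP // ltnS leq_subr.
rewrite -coefD -mulrDl -derivD coefM; apply: eq_bigr => -[j /= hj] _.
rewrite coef_deriv coefD PE ?PE ?PM; [|by rewrite /N; lia..].
by rewrite -(mulr_natl (a j.+1 + b j.+1)).
Qed.

End FpsAlgebra.

Section RisingFactorial.
Context {A : numFieldType}.

(* The coefficient of [t ^ n] in [(1 - t) ^ (- z)]. *)
Definition rising (z : A) n := (\prod_(k < n) (z + k%:R)) / n`!%:R.

Lemma rising0 z : rising z 0 = 1.
Proof. by rewrite /rising big_ord0 fact0 divr1. Qed.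

Lemma risingS z n : n.+1%:R * rising z n.+1 = (z + n%:R) * rising z n.
Proof.
rewrite /rising big_ord_recr /= factS natrM invfM.
have n0 : (n.+1%:R : A) != 0 by rewrite pnatr_eq0.
have f0 : (n`!%:R : A) != 0 by rewrite pnatr_eq0 -lt0n fact_gt0.
move: (\prod_(_ < _) _) n0 f0 (z + n%:R).
by move: (n`!%:R) (n.+1%:R) => x y p x0 y0 q; field; rewrite x0 y0.
Qed.

Lemma rising_sum z n : z * \sum_(i < n.+1) rising z i = (z + n%:R) * rising z n.
Proof.
elim: n => [|n ih]; first by rewrite big_ord1 addr0.
by rewrite big_ord_recr /= mulrDr ih -(risingS z n); ring.
Qed.

Lemma rising_fps_exp z :
  rising z =1 fps_exp (fun k => if k is 0 then 0 else z / k%:R).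
Proof.
apply: fps_exp_unique => //; first exact: rising0.
move=> n; rewrite risingS -rising_sum mulr_sumr [LHS](reindex_inj rev_ord_inj) /=.
apply: eq_bigr => i _; rewrite subSS; congr (_ * _).
by rewrite mulrCA divff ?mulr1 // pnatr_eq0.
Qed.

End RisingFactorial.

(** * The exponential series *)

Section ComplexExponential.
Context {R : realType}.
Implicit Types (z w : R[i]) (a : nat -> R[i]).

Lemma cexp0 : cexp 0 = 1 :> R[i].
Proof. by rewrite /cexp /= expR0 cos0 sin0 mul1r. Qed.

Lemma cexpD z w : cexp (z + w) = cexp z * cexp w.
Proof.
rewrite /cexp ReD ImD expRD cosD sinD; apply: complex_eqP => /=; ring.
Qed.

Lemma normc_cexp z : normc (cexp z) = expR (complex.Re z).
Proof.
rewrite /cexp normcM normc_real ger0_norm ?expR_ge0 // /= cos2Dsin2 sqrtr1 mulr1 //.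
Qed.

Lemma cexp_neq0 z : cexp z != 0.
Proof. by rewrite -normc_gt0 normc_cexp expR_gt0. Qed.

Lemma cexpN z : cexp (- z) = (cexp z)^-1.
Proof.
apply: (mulfI (cexp_neq0 z)).
by rewrite -cexpD subrr cexp0 divff // cexp_neq0.
Qed.

Lemma cexpB z w : cexp (z - w) = cexp z / cexp w.
Proof. by rewrite cexpD cexpN. Qed.

Lemma cexpMn z n : cexp (z * n%:R) = cexp z ^+ n.
Proof.
elim: n => [|n ih]; first by rewrite mulr0 cexp0.
by rewrite -natr1 mulrDr mulr1 cexpD ih exprSr.
Qed.

Lemma cexp_real (x : R) : cexp x%:C = (expR x)%:C.
Proof. by rewrite /cexp /= cos0 sin0; apply: complex_eqP => /=; ring. Qed.

Lemma exp_coeff_sum_le (x : R) N : 0 <= x -> \sum_(k < N) x ^+ k / k`!%:R <= expR x.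
Proof.
move=> x0; rewrite expRE; set u := pseries _ _.
have -> : \sum_(k < N) x ^+ k / k`!%:R = u N.
  by rewrite /u /pseries /series /= big_mkord; apply: eq_bigr => i _; rewrite mulrC.
apply: nondecreasing_cvgn_le.
  apply/nondecreasing_seqP => n; rewrite /u /pseries /series /= big_nat_recr //= lerDl.
  by rewrite mulr_ge0 ?invr_ge0 ?exprn_ge0.
by have := is_cvg_series_exp_coeff x; rewrite exp_coeffE.
Qed.

Lemma cexp_summable z : summable_by (fun n => z ^+ n / n`!%:R) (expR (normc z)).
Proof.
move=> N; apply: le_trans (exp_coeff_sum_le N (normc_ge0 z)).
by apply: ler_sum => k _; rewrite normcM normcV normcX normc_nat.
Qed.

Lemma csum_ReIm a (l : R[i]) :
  series (fun n => complex.Re (a n)) @ \oo --> complex.Re l ->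
  series (fun n => complex.Im (a n)) @ \oo --> complex.Im l -> csum a l.
Proof.
move=> /cvgrPdist_lt h1 /cvgrPdist_lt h2 e e0.
have e20 : 0 < e / 2 by rewrite divr_gt0.
have [N _ hN] := h1 _ e20; have [M _ hM] := h2 _ e20; exists (maxn N M) => n.
rewrite geq_max => /andP[/hN /= k1 /hM /= k2].
have sRe : complex.Re (\sum_(k < n) a k) = series (fun n => complex.Re (a n)) n.
  rewrite /series /= big_mkord; apply: (big_morph (@complex.Re R)) => //; exact: ReD.
have sIm : complex.Im (\sum_(k < n) a k) = series (fun n => complex.Im (a n)) n.
  rewrite /series /= big_mkord; apply: (big_morph (@complex.Im R)) => //; exact: ImD.
apply: le_lt_trans (ler_normc_ReIm _) _.
rewrite ReD ReN ImD ImN sRe sIm distrC (distrC _ (complex.Im l)); lra.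
Qed.

Lemma csum_cexp z : csum (fun n => z ^+ n / n`!%:R) (cexp z).
Proof.
pose x : R[i] := (complex.Re z)%:C; pose y : R[i] := 0 +i* complex.Im z.
have zE : z = x + y by case: (z) @x @y => a b; apply: complex_eqP => /=; ring.
have natC n : (n%:R : R[i]) = (n%:R : R)%:C by rewrite -(rmorph_nat (real_complex R)).
have hx : csum (fun n => x ^+ n / n`!%:R) (cexp x).
  have xE n : x ^+ n / n`!%:R = (complex.Re z ^+ n / n`!%:R)%:C.
    by rewrite natC /x -rmorphXn -fmorphV -rmorphM.
  apply: csum_ReIm; rewrite cexp_real /=.
    have := is_cvg_series_exp_coeff (complex.Re z); rewrite /expR.
    have -> : (fun n => complex.Re (x ^+ n / n`!%:R)) = exp_coeff (complex.Re z).
      by apply/funext => n; rewrite xE.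
    by [].
  have -> : (fun n => complex.Im (x ^+ n / n`!%:R)) = fun=> 0.
    by apply/funext => n; rewrite xE.
  rewrite (_ : series _ = fun=> 0); first exact: cvg_cst.
  by apply/funext => n; rewrite /series /= big1.
have hy : csum (fun n => y ^+ n / n`!%:R) (cexp y).
  have i2 : y ^+ 2 = (- complex.Im z ^+ 2)%:C.
    by apply: complex_eqP => /=; rewrite ?expr2 /=; ring.
  have sgnE k : (- complex.Im z ^+ 2) ^+ k = (-1) ^+ k * complex.Im z ^+ (2 * k).
    by rewrite exprM -exprMn mulN1r.
  have yE n : y ^+ n / n`!%:R = cos_coeff (complex.Im z) n +i* sin_coeff (complex.Im z) n.
    rewrite natC /cos_coeff /sin_coeff /=.
    have [/eqP|] := boolP (odd n == true); last first.
      rewrite eqb_id => /negbTE on; rewrite -(odd_double_half n) on add0n half_double.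
      rewrite odd_double /= -mul2n exprM i2 -rmorphXn -fmorphV -rmorphM.
      apply: complex_eqP => /=; last by rewrite !mul0r.
      by rewrite mul1r sgnE.
    move=> on; rewrite -(odd_double_half n) on add1n /= uphalf_double odd_double /= half_double.
    rewrite exprS -mul2n exprM i2 -rmorphXn -mulrA -fmorphV -rmorphM.
    apply: complex_eqP => /=; first by rewrite mul0r; ring.
    rewrite sgnE exprS; ring.
  have cy : cexp y = cos (complex.Im z) +i* sin (complex.Im z).
    by rewrite /cexp /= expR0; apply: complex_eqP => /=; ring.
  rewrite cy; apply: csum_ReIm => /=.
    rewrite cos.unlock; have -> : (fun n => complex.Re (y ^+ n / n`!%:R)) = cos_coeff (complex.Im z).
      by apply/funext => n; rewrite yE.
    exact: is_cvg_series_cos_coeff.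
  rewrite sin.unlock; have -> : (fun n => complex.Im (y ^+ n / n`!%:R)) = sin_coeff (complex.Im z).
    by apply/funext => n; rewrite yE.
  exact: is_cvg_series_sin_coeff.
have := csum_fps_mul (@cexp_summable x) (@cexp_summable y) hx hy.
rewrite -cexpD -zE; apply: eq_csum => n.
have f0 k : (k`!%:R : R[i]) != 0 by rewrite pnatr_eq0 -lt0n fact_gt0.
rewrite zE addrC exprDn /fps_mul mulr_suml; apply: eq_bigr => -[i /= hi] _.
rewrite -[_ *+ 'C(n, i)]mulr_natr.
have -> : ('C(n, i)%:R : R[i]) = n`!%:R / (i`!%:R * (n - i)`!%:R).
  apply: (mulIf (mulf_neq0 (f0 i) (f0 (n - i)%N))).
  by rewrite divfK ?mulf_neq0 // -!natrM bin_fact.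
by field; rewrite !f0.
Qed.

Lemma csum_tail_le a (l : R[i]) (S : R) m : csum a l ->
  (forall N, \sum_(k < N) normc (a (m + k)%N) <= S) ->
  normc (l - \sum_(k < m) a k) <= S.
Proof.
move=> al aS.
have h : clim (fun n => \sum_(j < m + n) a j - \sum_(j < m) a j) (l - \sum_(j < m) a j).
  apply: climD; last exact: clim_cst.
  by move=> d /al [M hM]; exists M => k Mk; apply: hM; rewrite (leq_trans Mk) // leq_addl.
apply: clim_normc_le h => n; apply: le_trans (aS n).
rewrite big_split_ord /= addrAC subrr add0r; exact: ler_normc_sum.
Qed.

Lemma cexp_taylor z m :
  normc (cexp z - \sum_(k < m) z ^+ k / k`!%:R) <= normc z ^+ m * expR (normc z).
Proof.
apply: (csum_tail_le (csum_cexp z)) => N.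
apply: le_trans (ler_wpM2l (exprn_ge0 m (normc_ge0 z)) (exp_coeff_sum_le N (normc_ge0 z))).
rewrite mulr_sumr; apply: ler_sum => k _; rewrite normcM normcV normcX normc_nat exprD -mulrA.
rewrite ler_wpM2l ?exprn_ge0 ?normc_ge0 // ler_wpM2l ?exprn_ge0 ?normc_ge0 //.
rewrite lef_pV2 ?posrE ?ltr0n ?fact_gt0 // ler_nat.
by apply: leq_fact; exact: leq_addl.
Qed.

Lemma cexp_bound1 z : normc (cexp z - 1) <= normc z * expR (normc z).
Proof.
have := cexp_taylor z 1; rewrite big_ord1 expr0 fact0 divr1 expr1 //.
Qed.

Lemma cexp_bound2 z : normc (cexp z - 1 - z) <= normc z ^+ 2 * expR (normc z).
Proof.
have := cexp_taylor z 2; rewrite big_ord_recr big_ord1 /= expr0 fact0 !divr1 expr1.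
by rewrite opprD addrA.
Qed.

Lemma cdiff_cexp z : cdiff (@cexp R) z (cexp z).
Proof.
apply: cdiffP => e e0; set M := normc (cexp z) * expR 1.
have M0 : 0 < M by rewrite mulr_gt0 ?expR_gt0 // normc_cexp expR_gt0.
exists (Num.min 1 (e / M)); first by rewrite lt_min ltr01 divr_gt0.
move=> w; rewrite lt_min => /andP[h1 h2].
have -> : cexp w - cexp z - cexp z * (w - z) = cexp z * (cexp (w - z) - 1 - (w - z)).
  have -> : cexp w = cexp z * cexp (w - z) by rewrite -cexpD addrC subrK.
  ring.
rewrite normcM; have := cexp_bound2 (w - z); set x := normc (w - z) in h1 h2 *.
have x0 : 0 <= x by exact: normc_ge0.
have ex : expR x <= expR 1 by rewrite ler_expR ltW.
move=> hb; apply: le_trans (ler_wpM2l (normc_ge0 _) hb) _.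
have : normc (cexp z) * (x ^+ 2 * expR x) <= normc (cexp z) * (x ^+ 2 * expR 1).
  by rewrite !ler_wpM2l ?normc_ge0 ?sqr_ge0.
move=> /le_trans; apply.
have -> : normc (cexp z) * (x ^+ 2 * expR 1) = (M * x) * x by rewrite /M; ring.
by rewrite ler_wpM2r // mulrC -ler_pdivlMr // ltW.
Qed.

Lemma csum_fps_exp a S (l : R[i]) : a 0%N = 0 -> summable_by a S -> csum a l ->
  csum (fps_exp a) (cexp l).
Proof.
move=> a0 aS al.
have S0 : 0 <= S by have := aS 0%N; rewrite big_ord0.
have pS j : summable_by (fps_pow a j) (S ^+ j).
  elim: j => [|j ih]; last by rewrite exprS; exact: summable_fps_mul.
  case=> [|N]; first by rewrite big_ord0.
  rewrite big_ord_recl big1 /fps_pow /iter /fps_one ?eqxx ?normc1E ?addr0 //.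
  by move=> i _; rewrite normc0E.
have pl j : csum (fps_pow a j) (l ^+ j).
  elim: j => [|j ih]; last by rewrite exprS; exact: csum_fps_mul ih.
  apply: clim_shift; apply: eq_clim (clim_cst 1) => n.
  by rewrite big_ord_recl big1 /= /fps_one /= ?addr0.
have fact_ge (j : nat) : 0 <= (j`!%:R : R)^-1 by rewrite invr_ge0.
have : clim (fun N => \sum_(j < N) (\sum_(n < N) fps_pow a j n) / j`!%:R) (cexp l).
  apply: (@tannery R (fun j N => (\sum_(n < N) fps_pow a j n) / j`!%:R)
    (fun j => l ^+ j / j`!%:R) (fun j => S ^+ j / j`!%:R) (expR S)) => [j N|N|j|].
  - rewrite normcM normcV normc_nat ler_wpM2r //.
    exact: le_trans (ler_normc_sum _ _ _) (pS j N).
  - exact: exp_coeff_sum_le.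
  - by apply: climM (pl j) (clim_cst _).
  - exact: csum_cexp.
apply: eq_clim => N.
under eq_bigr do rewrite mulr_suml.
rewrite exchange_big /=; apply: eq_bigr => -[n /= nN] _.
rewrite /fps_exp [RHS](big_ord_widen N (fun j => fps_pow a j n / j`!%:R)) //.
rewrite [LHS](bigID (fun j : 'I_N => (j < n.+1)%N)) /= [X in _ + X]big1 ?addr0 //.
by move=> j; rewrite -leqNgt => hj; rewrite fps_pow_eq0 // mul0r.
Qed.

End ComplexExponential.

(** * Sums near 0 and the logarithm *)

Section PowerSeriesNear0.
Context {R : realType}.
Implicit Types (z w t : R[i]) (a c : nat -> R[i]).

Lemma near0_csumP c g : is_sum_near0 c g <->
  exists2 d : R, 0 < d & forall t, normc t < d -> csum (fun k => c k * t ^+ k) (g t).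
Proof.
rewrite /is_sum_near0 near_normcP; split=> -[d d0 h]; exists d => // t.
  by move=> td; apply/csumP/h; rewrite subr0.
by rewrite subr0 => /h /csumP.
Qed.

Lemma geometric_sum_le (x : R) N : 0 <= x <= 2^-1 -> \sum_(k < N) x ^+ k <= 2.
Proof.
move=> /andP[x0 x1]; have xn : 0 <= x ^+ N by rewrite exprn_ge0.
have := subrX1 x N; set s := \sum_(_ < _) _ => sE.
have : (1 - x) * s = 1 - x ^+ N by have := sE; lra.
have s0 : 0 <= s by apply: sumr_ge0 => i _; rewrite exprn_ge0.
nra.
Qed.

Lemma is_sum_near0_bound c g : is_sum_near0 c g ->
  exists d M : R, [/\ 0 < d, 0 <= M &
    forall t, normc t <= d -> csum (fun k => c k * t ^+ k) (g t) /\
      forall k, normc (c k * t ^+ k) <= M * (normc t / d / 2) ^+ k].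
Proof.
move=> /near0_csumP [e e0 h].
have e2 : normc ((e / 2)%:C : R[i]) < e by rewrite normc_real ger0_norm; lra.
have [M hM] : exists M, forall k, normc (c k * (e / 2)%:C ^+ k) <= M.
  have [M hM] := clim_bounded (h _ e2); exists (M + M) => k.
  have -> : c k * (e / 2)%:C ^+ k =
      \sum_(i < k.+1) c i * (e / 2)%:C ^+ i - \sum_(i < k) c i * (e / 2)%:C ^+ i.
    by rewrite big_ord_recr /= addrAC subrr add0r.
  by apply: le_trans (ler_normcB _ _) _; rewrite lerD.
exists (e / 4), M; split; first by rewrite divr_gt0.
  by apply: le_trans (hM 0%N); exact: normc_ge0.
move=> t te; split; first by apply: h; lra.
move=> k; have := hM k; rewrite !normcM !normcX normc_real ger0_norm; last by lra.
have -> : normc t / (e / 4) / 2 = normc t / (e / 2) by field; lra.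
move=> hk; have t0 : 0 <= (normc t / (e / 2)) ^+ k.
  by rewrite exprn_ge0 // divr_ge0 ?normc_ge0 //; lra.
have -> : normc (c k) * normc t ^+ k = (normc (c k) * (e / 2) ^+ k) * (normc t / (e / 2)) ^+ k.
  by rewrite -mulrA -exprMn (mulrC (e / 2)) divfK //; lra.
by rewrite ler_wpM2r.
Qed.

Lemma is_sum_near0_summable c g : is_sum_near0 c g ->
  exists d S : R, 0 < d /\ forall t, normc t <= d ->
    csum (fun k => c k * t ^+ k) (g t) /\ summable_by (fun k => c k * t ^+ k) S.
Proof.
move=> /is_sum_near0_bound [d [M [d0 M0 h]]]; exists d, (M * 2); split=> // t td.
have [h1 h2] := h t td; split=> // N.
apply: le_trans (ler_sum _ (fun (k : 'I_N) _ => h2 k)) _; rewrite -mulr_sumr ler_wpM2l //.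
have x1 : normc t / d <= 1 by rewrite ler_pdivrMr // mul1r.
have x0 : 0 <= normc t / d by rewrite divr_ge0 ?normc_ge0 ?ltW.
by apply: geometric_sum_le; apply/andP; split; lra.
Qed.

Lemma is_sum_near0_remainder c g : is_sum_near0 c g ->
  exists d M : R, [/\ 0 < d, 0 <= M & forall t n, normc t <= d ->
    normc (g t - \sum_(k < n) c k * t ^+ k) <= M * (normc t / d) ^+ n].
Proof.
move=> /is_sum_near0_bound [d [M [d0 M0 h]]]; exists d, (M * 2); split=> //.
  by rewrite mulr_ge0.
move=> t n td; have [h1 h2] := h t td.
have x0 : 0 <= normc t / d by rewrite divr_ge0 ?normc_ge0 ?ltW.
have x1 : normc t / d <= 1 by rewrite ler_pdivrMr // mul1r.
apply: (csum_tail_le h1) => N.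
apply: le_trans (ler_sum _ (fun (k : 'I_N) _ => h2 (n + k)%N)) _.
have : \sum_(k < N) M * (normc t / d / 2) ^+ (n + k) <=
       \sum_(k < N) M * (normc t / d) ^+ n * (2^-1) ^+ k.
  apply: ler_sum => k _.
  have -> : (normc t / d / 2) ^+ (n + k) =
      (normc t / d) ^+ n * 2^-1 ^+ k * ((normc t / d) ^+ k * 2^-1 ^+ n).
    by rewrite exprMn !exprD; ring.
  rewrite -[leRHS]mulrA ler_wpM2l // ler_piMr ?mulr_ge0 ?exprn_ge0 //.
  by rewrite mulr_ile1 ?exprn_ge0 ?exprn_ile1 //; lra.
move=> /le_trans; apply; rewrite -mulr_sumr mulrAC ler_wpM2r ?exprn_ge0 // ler_wpM2l //.
by apply: geometric_sum_le; rewrite invr_ge0 ler0n lexx.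
Qed.

Lemma is_sum_near0_unique c c' g : is_sum_near0 c g -> is_sum_near0 c' g -> c =1 c'.
Proof.
move=> /is_sum_near0_remainder [d [M [d0 M0 h]]] /is_sum_near0_remainder [d' [M' [d'0 M'0 h']]].
move=> n; elim/ltn_ind: n => n ih; apply/eqP; rewrite -subr_eq0 -normc_eq0.
rewrite eq_le normc_ge0 andbT; apply/ler_addgt0Pr => e e0; rewrite add0r.
set C := M / d ^+ n.+1 + M' / d' ^+ n.+1.
have C0 : 0 <= C by rewrite addr_ge0 // divr_ge0 // exprn_ge0 // ltW.
pose x := Num.min (Num.min d d') (e / (C + 1)).
have x0 : 0 < x by rewrite !lt_min d0 d'0 divr_gt0 // ltr_wpDl.
have xd : x <= d by rewrite !ge_min lexx.
have xd' : x <= d' by rewrite !ge_min lexx orbT.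
have xe : x <= e / (C + 1) by rewrite !ge_min lexx orbT.
have nx : normc x%:C = x by rewrite normc_real ger0_norm // ltW.
have := h x%:C n.+1; have := h' x%:C n.+1; rewrite !nx => /(_ xd') k1 /(_ xd) k2.
have key : normc ((c n - c' n) * x%:C ^+ n) <= C * x ^+ n.+1.
  have -> : (c n - c' n) * x%:C ^+ n =
     (g x%:C - \sum_(k < n.+1) c' k * x%:C ^+ k) - (g x%:C - \sum_(k < n.+1) c k * x%:C ^+ k).
    have -> : \sum_(k < n.+1) c k * x%:C ^+ k = \sum_(k < n) c' k * x%:C ^+ k + c n * x%:C ^+ n.
      by rewrite big_ord_recr /=; congr (_ + _); apply: eq_bigr => i _; rewrite ih.
    by rewrite big_ord_recr /=; ring.
  apply: le_trans (ler_normcB _ _) _.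
  have -> : C * x ^+ n.+1 = M' * (x / d') ^+ n.+1 + M * (x / d) ^+ n.+1.
    by rewrite /C !expr_div_n; ring.
  exact: lerD.
move: key; rewrite normcM normcX nx exprSr mulrA mulrAC ler_pM2r ?exprn_gt0 // => /le_trans; apply.
apply: (@le_trans _ _ ((C + 1) * x)); first by rewrite ler_wpM2r ?lerDl // ltW.
by rewrite mulrC -ler_pdivlMr // ltr_wpDl.
Qed.

Lemma is_sum_near0_cexp c g : c 0%N = 0 -> is_sum_near0 c g ->
  is_sum_near0 (fps_exp c) (fun t => cexp (g t)).
Proof.
move=> c0 /is_sum_near0_summable [d [S [d0 h]]]; apply/near0_csumP; exists d => // t /ltW /h[h1 h2].
apply: eq_csum (csum_fps_exp _ h2 h1); first exact: fps_exp_scale.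
by rewrite /= c0 mul0r.
Qed.

Lemma is_sum_near0Z c g (k : R[i]) : is_sum_near0 c g ->
  is_sum_near0 (fun n => k * c n) (fun t => k * g t).
Proof.
move=> /near0_csumP [d d0 h]; apply/near0_csumP; exists d => // t /h h1.
by apply: eq_csum (csumZ k h1) => n; rewrite mulrA.
Qed.

Lemma is_sum_near0D c c' g g' : is_sum_near0 c g -> is_sum_near0 c' g' ->
  is_sum_near0 (fun n => c n + c' n) (fun t => g t + g' t).
Proof.
move=> /near0_csumP [d d0 h] /near0_csumP [d' d'0 h']; apply/near0_csumP.
exists (Num.min d d'); first by rewrite lt_min d0.
move=> t; rewrite lt_min => /andP[/h h1 /h' h2].
by apply: eq_csum (csumD h1 h2) => n; rewrite mulrDl.
Qed.

Lemma is_sum_near0_dilate c g (k : R[i]) : is_sum_near0 c g ->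
  is_sum_near0 (fun n => c n * k ^+ n) (fun t => g (t * k)).
Proof.
move=> /near0_csumP [d d0 h]; apply/near0_csumP; exists (d / (normc k + 1)).
  by rewrite divr_gt0 // ltr_wpDl ?normc_ge0.
move=> t td; have k0 := normc_ge0 k; have t0 := normc_ge0 t.
have /h : normc (t * k) < d.
  move: td; rewrite normcM ltr_pdivlMr; nra.
by apply: eq_csum => n; rewrite exprMn; ring.
Qed.

Lemma eq_is_sum_near0 c c' g g' (d : R) : c =1 c' -> 0 < d ->
  (forall t, normc t < d -> g t = g' t) -> is_sum_near0 c g -> is_sum_near0 c' g'.
Proof.
move=> cc d0 gg /near0_csumP [e e0 h]; apply/near0_csumP.
exists (Num.min d e); first by rewrite lt_min d0.
move=> t; rewrite lt_min => /andP[/gg <- /h]; apply: eq_csum => n; by rewrite cc.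
Qed.

End PowerSeriesNear0.

Section ComplexLogarithm.
Context {R : realType}.
Implicit Types (z w t : R[i]).

Lemma clog_cexp w : - pi < complex.Im w <= pi -> clog (cexp w) = w.
Proof.
move=> /andP[h1 h2]; rewrite /clog /carg normc_cexp expRK.
have e0 : 0 < expR (complex.Re w) by exact: expR_gt0.
have -> : complex.Re (cexp w) / expR (complex.Re w) = cos (complex.Im w).
  by rewrite /cexp /= mul0r subr0 mulrC mulKf // gt_eqF.
have -> : complex.Im (cexp w) = expR (complex.Re w) * sin (complex.Im w).
  by rewrite /cexp /= mul0r addr0.
rewrite pmulr_rge0 //; apply: complex_eqP => //=.
have [y0|y0] := leP 0 (complex.Im w).
  by rewrite sin_ge0_pi ?y0 // cosK // in_itv /= y0.
rewrite leNgt -oppr_gt0 -sinN sin_gt0_pi /=; last by lra.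
by rewrite cosKN ?opprK //; lra.
Qed.

Lemma Im_clog z : z != 0 -> - pi < complex.Im (clog z) <= pi.
Proof.
move=> z0; rewrite /clog /carg /=.
have n0 : 0 < normc z by rewrite normc_gt0.
have hr : -1 <= complex.Re z / normc z <= 1.
  by rewrite -ler_norml normrM normfV (ger0_norm (ltW n0)) ler_pdivrMr // mul1r ler_normRe.
have a0 := acos_ge0 hr; have a1 := acos_lepi hr; have p0 := pi_gt0 R.
case: ifPn => [_|]; first by rewrite a1 andbT; lra.
rewrite -ltNge => i0; have {}hr : -1 < complex.Re z / normc z <= 1.
  have /andP[h1 ->] := hr; rewrite andbT lt_neqAle h1 andbT; apply/eqP => /esym h.
  have rz : complex.Re z = - normc z by rewrite -[LHS](divfK (lt0r_neq0 n0)) h mulN1r.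
  have := normc_sqr z; rewrite rz sqrrN => /eqP; rewrite eq_sym -subr_eq0 addrAC subrr add0r.
  by rewrite sqrf_eq0 => /eqP i00; move: i0; rewrite i00 ltxx.
have := acos_ltpi hr; lra.
Qed.

Lemma cexp_clog z : z != 0 -> cexp (clog z) = z.
Proof.
move=> z0; rewrite /clog /cexp /=.
have n0 : 0 < normc z by rewrite normc_gt0.
have hr : -1 <= complex.Re z / normc z <= 1.
  by rewrite -ler_norml normrM normfV (ger0_norm (ltW n0)) ler_pdivrMr // mul1r ler_normRe.
rewrite lnK ?posrE //.
have ca : cos (carg z) = complex.Re z / normc z.
  by rewrite /carg; case: ifP => _; rewrite ?cosN acosK // in_itv.
have sa : sin (carg z) = complex.Im z / normc z.
  have sq : Num.sqrt (1 - (complex.Re z / normc z) ^+ 2) = `|complex.Im z| / normc z.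
    have -> : 1 - (complex.Re z / normc z) ^+ 2 = (complex.Im z / normc z) ^+ 2.
      have := normc_sqr z => e; apply: (mulIf (x := normc z ^+ 2)); first by rewrite expf_neq0 // gt_eqF.
      rewrite mulrBl mul1r -!exprMn !divfK ?gt_eqF // e; ring.
    by rewrite sqrtr_sqr normrM normfV (ger0_norm (ltW n0)).
  rewrite /carg; case: ifPn => [i0|]; first by rewrite sin_acos // sq ger0_norm.
  by rewrite -ltNge => i0; rewrite sinN sin_acos // sq ltr0_norm // mulNr opprK.
apply: complex_eqP => /=; rewrite ca sa mul0r ?subr0 ?addr0 mulrC divfK // gt_eqF //.
Qed.

Lemma Re_clog z : complex.Re (clog z) = ln (normc z).
Proof. by []. Qed.

Lemma csum_log t : normc t <= 2^-1 ->
  csum (fun k => if k is 0 then 0 else k%:R^-1 * t ^+ k) (clog ((1 - t)^-1)).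
Proof.
move=> t1; set a := fun k : nat => _.
have t0 : 1 - t != 0.
  apply/eqP => /eqP; rewrite subr_eq0 => /eqP e; move: t1; rewrite -e normc1E; lra.
have an k : normc (a k.+1) <= normc t * normc t ^+ k.
  rewrite /a normcM normcV normcX normc_nat -exprS ler_piMl ?exprn_ge0 ?normc_ge0 //.
  by rewrite invf_le1 ?ltr0n // ler1n.
have aS : summable_by a 1.
  case=> [|N]; first by rewrite big_ord0.
  rewrite big_ord_recl (_ : normc (a (ord0 : 'I_N.+1)) = 0) ?add0r; last exact: normc0E.
  apply: le_trans (ler_sum _ (fun (k : 'I_N) _ => an k)) _; rewrite -mulr_sumr.
  have := @geometric_sum_le R (normc t) N; rewrite normc_ge0 t1 => /(_ isT).
  have := normc_ge0 t; have : 0 <= \sum_(i < N) normc t ^+ i.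
    by apply: sumr_ge0 => i _; rewrite exprn_ge0 ?normc_ge0.
  nra.
have [l al] := summable_csum aS.
suff -> : clog (1 - t)^-1 = l by [].
have lE : cexp l = (1 - t)^-1.
  have h1 := csum_fps_exp (erefl : a 0%N = 0) aS al.
  apply: (@clim_unique _ (fun N => \sum_(k < N) t ^+ k)); last first.
    apply: eq_csum h1 => n.
    rewrite -[RHS]mul1r.
    have -> : (1 : R[i]) = rising 1 n.
      rewrite /rising; have -> : \prod_(k < n) (1 + k%:R) = n`!%:R :> R[i].
        by elim: n => [|n ih]; rewrite ?big_ord0 ?fact0 // big_ord_recr /= ih factS natrM mulrC nat1r.
      by rewrite divff // pnatr_eq0 -lt0n fact_gt0.
    rewrite rising_fps_exp -fps_exp_scale; congr (fps_exp _ n).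
    by apply/funext => -[|k]; rewrite /a ?mul0r // mul1r.
  have st N : \sum_(k < N) t ^+ k = (1 - t)^-1 + - (1 - t)^-1 * t ^+ N.
    apply: (mulfI t0); have := subrX1 t N; set S := \sum_(_ < _) _ => e.
    have -> : (1 - t) * S = 1 - t ^+ N by rewrite -[1 - t]opprB mulNr -e opprB.
    by field.
  have tN : clim (fun N => t ^+ N) 0.
    move=> e e0; have [N hN] : exists N : nat, e^-1 < N%:R.
      by exists (Num.truncn e^-1).+1; rewrite truncnS_gt.
    exists N => n Nn; rewrite subr0 normcX.
    have n2 : (n%:R : R) < 2 ^+ n by rewrite -natrX ltr_nat ltn_expl.
    apply: (@le_lt_trans _ _ ((2^-1) ^+ n)); first by rewrite lerXn2r ?nnegrE ?normc_ge0 ?invr_ge0.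
    rewrite exprVn invf_plt ?posrE ?exprn_gt0 //; apply: lt_trans hN _.
    by apply: le_lt_trans n2; rewrite ler_nat.
  apply: (@eq_clim _ (fun N => (1 - t)^-1 + - (1 - t)^-1 * t ^+ N)) => [N|]; first by rewrite st.
  have := climD (clim_cst (1 - t)^-1) (climZ (- (1 - t)^-1) tN).
  by rewrite mulr0 addr0.
rewrite -lE clog_cexp //.
have := csum_normc_le aS al; have := ler_normIm l; have := pi_ge2 R.
rewrite ler_norml => p /andP[h1 h2] h3; apply/andP; split; lra.
Qed.

Lemma is_sum_near0_log :
  is_sum_near0 (fun k => if k is 0 then 0 else k%:R^-1) (fun t => clog ((1 - t)^-1)).
Proof.
apply/near0_csumP; exists 2^-1; rewrite ?invr_gt0 // => t /ltW /csum_log.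
by apply: eq_csum => -[|k]; rewrite ?mul0r.
Qed.

Lemma ccontV z : z != 0 -> ccont (fun w => w^-1) z.
Proof.
move=> z0 e e0; have n0 : 0 < normc z by rewrite normc_gt0.
exists (Num.min (normc z / 2) (e * normc z ^+ 2 / 2)).
  by rewrite lt_min !divr_gt0 // mulr_gt0 // exprn_gt0.
move=> w; rewrite lt_min => /andP[h1 h2].
have wn : normc z / 2 < normc w.
  have := ler_normc_dist w z; rewrite ler_norml => /andP[h _]; lra.
have w0 : w != 0 by rewrite -normc_gt0; lra.
have -> : w^-1 - z^-1 = - (w - z) / (w * z) by field; rewrite z0.
rewrite normcM normcNE normcV normcM ltr_pdivrMr; last by rewrite mulr_gt0 //; lra.
apply: lt_le_trans h2 _.
have k : normc z / 2 * normc z <= normc w * normc z by rewrite ler_wpM2r // ltW.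
by have := ler_wpM2l (ltW e0) k; lra.
Qed.

Lemma cdiffV z : z != 0 -> cdiff (fun w => w^-1) z (- (z^-1 * z^-1)).
Proof.
move=> z0; apply: (@cdiff_near _ (fun w => if w == 0 then 0 else w^-1) _ _ _ 1) => // [w _|].
  by case: eqP => // ->; rewrite invr0.
exists (fun w => if w == 0 then z^-1 * z^-1 else - (w^-1 * z^-1)); split.
- move=> w; rewrite (negbTE z0); case: eqP => [->|/eqP w0]; first by field; rewrite z0.
  by field; rewrite w0 z0.
- by rewrite (negbTE z0).
- apply: (@ccont_near _ (fun w => - z^-1 * w^-1) _ _ (normc z)); first by rewrite normc_gt0.
    move=> w h; case: eqP => [w0|_]; last by ring.
    by move: h; rewrite w0 sub0r normcNE ltxx.
  by apply: ccontM; [exact: ccont_cst|exact: ccontV].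
Qed.

Lemma clog1 : clog 1 = 0 :> R[i].
Proof. by rewrite -cexp0 clog_cexp //=; have := pi_gt0 R; lra. Qed.

Lemma cdiff_log1 : cdiff (fun t : R[i] => clog ((1 - t)^-1)) 0 1.
Proof.
have [d [M [d0 M0 h]]] := is_sum_near0_remainder is_sum_near0_log.
apply: cdiffP => e e0; exists (Num.min d (e * d ^+ 2 / (M + 1))).
  by rewrite lt_min d0 divr_gt0 ?ltr_wpDl // mulr_gt0 // exprn_gt0.
move=> t; rewrite !subr0 lt_min => /andP[td te].
have := h t 2%N (ltW td).
rewrite !big_ord_recr !big_ord0 /= mul0r !add0r invr1 mul1r => k2.
rewrite clog1 subr0; apply: le_trans k2 _.
have t0 := normc_ge0 t.
have -> : M * (normc t / d) ^+ 2 = M * normc t / d ^+ 2 * normc t.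
  by field; lra.
rewrite ler_wpM2r // ler_pdivrMr ?exprn_gt0 //.
move: te; rewrite ltr_pdivlMr ?ltr_wpDl // => te; nra.
Qed.

Lemma cdiff_clog z : z != 0 -> complex.Im (clog z) != pi -> cdiff (@clog R) z z^-1.
Proof.
move=> z0 zpi; have n0 : 0 < normc z by rewrite normc_gt0.
have dt : cdiff (fun w => 1 - z * w^-1) z (z^-1).
  have := cdiffB (cdiff_cst 1 z) (cdiffZ z (cdiffV z0)).
  have -> : 0 - z * - (z^-1 * z^-1) = z^-1 by field.
  by [].
have t0 : 1 - z * z^-1 = 0 by rewrite divff // subrr.
have dl : cdiff (fun w => clog (1 - (1 - z * w^-1))^-1) z (1 * z^-1).
  by apply: (cdiff_comp (f := fun t => clog (1 - t)^-1) dt); rewrite t0; exact: cdiff_log1.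
have := cdiffD (cdiff_cst (clog z) z) dl; rewrite mul1r add0r => h.
have := cdiff_cont dl; have := Im_clog z0 => /andP[i1 i2].
have {}i2 : complex.Im (clog z) < pi by rewrite lt_neqAle zpi.
pose e := Num.min (complex.Im (clog z) + pi) (pi - complex.Im (clog z)).
have e0 : 0 < e by rewrite lt_min; apply/andP; split; lra.
move=> /(_ e e0) [d d0 hd].
have dd : 0 < Num.min d (normc z) by rewrite lt_min d0.
apply: cdiff_near dd _ h => w; rewrite lt_min => /andP[/hd h1 h2].
have w0 : w != 0 by apply: contraTneq h2 => ->; rewrite sub0r normcNE ltxx.
have wE : (1 - (1 - z * w^-1))^-1 = w / z by field; rewrite z0 w0.
move: h1; rewrite t0 subr0 invr1 wE.
rewrite clog1 subr0 => h1.
have wz0 : w / z != 0 by rewrite mulf_neq0 ?invr_eq0.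
have -> : w = cexp (clog z + clog (w / z)).
  by rewrite cexpD !cexp_clog // mulrC divfK.
rewrite clog_cexp; first by rewrite cexpD !cexp_clog // [z * _]mulrC divfK.
have := le_lt_trans (ler_normIm _) h1; rewrite ltr_norml ImD !lt_min.
move=> /andP[]; rewrite ltrNl lt_min => /andP[k1 k2] /andP[k3 k4]; apply/andP; split; lra.
Qed.

End ComplexLogarithm.

(** * The reciprocal Gamma function *)

Section ReciprocalGamma.
Context {R : realType}.
Implicit Types (z w : R[i]).

Lemma natcpowD n z w : natcpow n (z + w) = natcpow n z * natcpow n w.
Proof. by rewrite /natcpow mulrDl cexpD. Qed.

Lemma natcpow_neq0 n z : natcpow n z != 0.
Proof. exact: cexp_neq0. Qed.

Lemma normc_natcpow n z : normc (natcpow n z) = expR (complex.Re z * ln (n%:R : R)).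
Proof. by rewrite /natcpow normc_cexp ReM /= mulr0 subr0. Qed.

Lemma natcpow1n n : (0 < n)%N -> natcpow n 1 = n%:R :> R[i].
Proof.
move=> n0; rewrite /natcpow mul1r cexp_real lnK ?posrE ?ltr0n //.
by rewrite -(rmorph_nat (real_complex R)).
Qed.

Definition gauss_factor (n : nat) z : R[i] :=
  (\prod_(0 <= k < n.+1) (z + k%:R)) / (n`!%:R * natcpow n z).

Lemma ln_succ_bounds n : (0 < n)%N ->
  n.+1%:R^-1 <= ln (n.+1%:R : R) - ln (n%:R) <= n%:R^-1.
Proof.
move=> n0; have a0 : 0 < n%:R :> R by rewrite ltr0n.
have a1 : n.+1%:R = n%:R + 1 :> R by rewrite natr1.
have b0 : 0 < n.+1%:R :> R by rewrite ltr0n.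
apply/andP; split.
  have := @le_ln1Dx R (- n.+1%:R^-1).
  have -> : 1 + - n.+1%:R^-1 = n%:R / n.+1%:R :> R by rewrite a1; field; lra.
  rewrite ln_div ?posrE // ltrN2 invf_lt1 // a1 => /(_ _); lra.
have := @le_ln1Dx R (n%:R^-1).
have -> : 1 + n%:R^-1 = n.+1%:R / n%:R :> R by rewrite a1; field; lra.
rewrite ln_div ?posrE // => -> //.
have : 0 < n%:R^-1 :> R by rewrite invr_gt0.
lra.
Qed.

Lemma gauss_factorS n z : (0 < n)%N ->
  gauss_factor n.+1 z = gauss_factor n z *
    ((1 + z / n.+1%:R) * cexp (- z * (ln (n.+1%:R : R) - ln (n%:R))%:C)).
Proof.
move=> n0; rewrite /gauss_factor big_nat_recr //=.
have -> : natcpow n.+1 z = natcpow n z * cexp (z * (ln (n.+1%:R : R) - ln (n%:R))%:C).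
  by rewrite /natcpow -cexpD -mulrDr -rmorphD /= addrC subrK.
rewrite mulNr cexpN; set p := \prod_(0 <= k < n.+1) _; set e := cexp (z * _).
have e0 : e != 0 by exact: cexp_neq0.
have := natcpow_neq0 n z; rewrite factS natrM; move: (natcpow n z) => c c0.
have : (n`!%:R : R[i]) != 0 by rewrite pnatr_eq0 -lt0n fact_gt0.
have : (n.+1%:R : R[i]) != 0 by rewrite pnatr_eq0.
by move: (n`!%:R) (n.+1%:R) => f y y0 f0; field; rewrite e0 c0 y0 f0.
Qed.

Lemma gauss_ratio (A : R) : 0 <= A -> exists2 C : R, 0 <= C &
  forall n z, (0 < n)%N -> normc z <= A ->
  normc ((1 + z / n.+1%:R) * cexp (- z * (ln (n.+1%:R : R) - ln (n%:R))%:C) - 1)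
    <= C * (n%:R^-1 * n.+1%:R^-1).
Proof.
move=> A0; exists (A + A ^+ 2 * 2 + A ^+ 2 * expR A * (1 + A) * 2).
  by rewrite !addr_ge0 ?mulr_ge0 ?expR_ge0 ?sqr_ge0 // addr_ge0.
move=> n z n0 zA; have /andP[] := ln_succ_bounds n0.
set d := _ - _ => d1 d2.
have a0 : 0 < n%:R :> R by rewrite ltr0n.
have b0 : 0 < n.+1%:R :> R by rewrite ltr0n.
have a1 : n.+1%:R = n%:R + 1 :> R by rewrite natr1.
set u : R := n%:R^-1 in d2 *; set v : R := n.+1%:R^-1 in d1 *.
have u0 : 0 < u by rewrite invr_gt0.
have v0 : 0 < v by rewrite invr_gt0.
have uv : u - v = u * v by rewrite /u /v a1; field; lra.
have u1 : u <= 1 by rewrite invf_le1 // ler1n.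
have u2v : u <= 2 * v by nra.
have vC : (n.+1%:R^-1 : R[i]) = v%:C.
  by rewrite /v fmorphV rmorph_nat.
rewrite vC.
have d0 : 0 <= d by lra.
pose r := cexp (- z * d%:C) - 1 - (- z * d%:C).
have rE : cexp (- z * d%:C) = 1 - z * d%:C + r by rewrite /r; ring.
have nzd : normc (- z * d%:C) <= A * u.
  by rewrite normcM normcNE normc_real ger0_norm // ler_pM ?normc_ge0.
have rb : normc r <= A ^+ 2 * u ^+ 2 * expR A.
  apply: le_trans (cexp_bound2 _) _; rewrite ler_pM ?sqr_ge0 ?expR_ge0 //.
    by rewrite -exprMn lerXn2r ?nnegrE ?normc_ge0 // mulr_ge0 // ltW.
  by rewrite ler_expR (le_trans nzd) // ler_piMr.
have -> : (1 + z * v%:C) * cexp (- z * d%:C) - 1 =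
    z * (v - d)%:C + (- (z * z) * (d * v)%:C + r * (1 + z * v%:C)).
  have -> : (v - d)%:C = v%:C - d%:C :> R[i] by rewrite rmorphB.
  have -> : (d * v)%:C = d%:C * v%:C :> R[i] by rewrite rmorphM.
  by rewrite rE; ring.
apply: le_trans (ler_normcD _ _) _.
have k1 : normc (z * (v - d)%:C) <= A * (u * v).
  rewrite normcM normc_real ler_pM ?normc_ge0 // ler_norml; apply/andP; split; lra.
have k2 : normc (- (z * z) * (d * v)%:C) <= A ^+ 2 * (u * v).
  rewrite normcM normcNE normcM normc_real ger0_norm ?mulr_ge0 ?(ltW v0) // expr2.
  by rewrite !ler_pM ?mulr_ge0 ?normc_ge0 ?(ltW v0).
have k3 : normc (r * (1 + z * v%:C)) <= A ^+ 2 * u ^+ 2 * expR A * (1 + A).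
  rewrite normcM ler_pM ?normc_ge0 //.
  apply: le_trans (ler_normcD _ _) _; rewrite normc1E lerD2l normcM normc_real ger0_norm ?(ltW v0) //.
  have : v <= 1 by nra.
  have := normc_ge0 z; nra.
have k4 : A ^+ 2 * u ^+ 2 * expR A * (1 + A) <= A ^+ 2 * expR A * (1 + A) * 2 * (u * v).
  have -> : A ^+ 2 * u ^+ 2 * expR A * (1 + A) = A ^+ 2 * expR A * (1 + A) * (u * u) by ring.
  rewrite -[leRHS]mulrA ler_wpM2l ?mulr_ge0 ?expR_ge0 ?sqr_ge0 ?addr_ge0 //; nra.
have := ler_normcD (- (z * z) * (d * v)%:C) (r * (1 + z * v%:C)).
have A2 : 0 <= A ^+ 2 * (u * v) by rewrite mulr_ge0 ?sqr_ge0 // mulr_ge0 ?ltW.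
lra.
Qed.

Lemma gauss_factor_cauchy (A : R) : 0 <= A -> exists2 D : R, 0 <= D &
  forall n m z, (0 < n)%N -> (n <= m)%N -> normc z <= A ->
  normc (gauss_factor m z - gauss_factor n z) <= normc (gauss_factor n z) * D * n%:R^-1.
Proof.
move=> A0; have [C C0 hC] := gauss_ratio A0.
exists (C * expR C); first by rewrite mulr_ge0 ?expR_ge0.
move=> n m z n0 nm zA; set g := normc (gauss_factor n z).
have g0 : 0 <= g by exact: normc_ge0.
have a0 k : 0 < k.+1%:R^-1 :> R by rewrite invr_gt0 ltr0n.
have tel k : (0 < k)%N -> k%:R^-1 * k.+1%:R^-1 = k%:R^-1 - k.+1%:R^-1 :> R.
  move=> k0; rewrite -natr1; have : 0 < k%:R :> R by rewrite ltr0n.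
  by move=> h; field; lra.
have bnd k : (0 < k)%N -> normc (gauss_factor k.+1 z - gauss_factor k z) <=
    normc (gauss_factor k z) * (C * (k%:R^-1 - k.+1%:R^-1)).
  move=> k0; rewrite gauss_factorS // -[X in _ - X]mulr1 -mulrBr normcM.
  by rewrite ler_wpM2l ?normc_ge0 // -tel // hC.
have n1 : n%:R^-1 <= 1 :> R by rewrite invf_le1 ?ltr0n // ler1n.
have grow k : normc (gauss_factor (n + k) z) <= g * expR (C * (n%:R^-1 - (n + k)%:R^-1)).
  elim: k => [|k ih]; first by rewrite addn0 subrr mulr0 expR0 mulr1.
  have nk0 : (0 < n + k)%N by lia.
  rewrite addnS; have := bnd _ nk0 => b.
  have h : normc (gauss_factor (n + k).+1 z) <=
     normc (gauss_factor (n + k) z) * (1 + C * ((n + k)%:R^-1 - (n + k).+1%:R^-1)).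
    have := ler_normcD (gauss_factor (n + k).+1 z - gauss_factor (n + k) z) (gauss_factor (n + k) z).
    rewrite subrK mulrDr mulr1 => /le_trans; apply; rewrite addrC lerD2l; exact: b.
  apply: le_trans h _.
  have -> : C * (n%:R^-1 - (n + k).+1%:R^-1) = C * (n%:R^-1 - (n + k)%:R^-1) +
     C * ((n + k)%:R^-1 - (n + k).+1%:R^-1) by ring.
  rewrite expRD mulrA ler_pM ?normc_ge0 ?expR_ge1Dx //.
  rewrite addr_ge0 // mulr_ge0 // -tel // mulr_ge0 // ?ltW // invr_ge0 ler0n //.
have growC k : normc (gauss_factor (n + k) z) <= g * expR C.
  apply: le_trans (grow k) _; rewrite ler_wpM2l // ler_expR ler_piMr //.
  have : 0 <= (n + k)%:R^-1 :> R by rewrite invr_ge0.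
  lra.
rewrite -(subnKC nm); move: (m - n)%N => {m nm} k.
suff : normc (gauss_factor (n + k) z - gauss_factor n z) <=
    g * (C * expR C) * (n%:R^-1 - (n + k)%:R^-1).
  move=> /le_trans; apply; rewrite ler_wpM2l ?mulr_ge0 ?expR_ge0 //.
  have : 0 <= (n + k)%:R^-1 :> R by rewrite invr_ge0.
  lra.
elim: k => [|k ih]; first by rewrite addn0 !subrr mulr0 normc0E.
have nk0 : (0 < n + k)%N by lia.
have -> : gauss_factor (n + k.+1) z - gauss_factor n z =
  (gauss_factor (n + k).+1 z - gauss_factor (n + k) z) +
  (gauss_factor (n + k) z - gauss_factor n z) by rewrite addnS; ring.
apply: le_trans (ler_normcD _ _) _.
have := bnd _ nk0.
have h1 : 0 <= C * ((n + k)%:R^-1 - (n + k).+1%:R^-1).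
  by rewrite mulr_ge0 // -tel // mulr_ge0 // ?ltW // invr_ge0 ler0n.
have := ler_wpM2r h1 (growC k); rewrite addnS; move: ih.
move: ((n + k)%:R^-1) ((n + k).+1%:R^-1) (n%:R^-1) => u v w; lra.
Qed.

Lemma gauss_factor_lim (A : R) : 0 <= A -> exists2 D : R, 0 <= D &
  forall n z, (0 < n)%N -> normc z <= A ->
  normc (rGamma z - gauss_factor n z) <= normc (gauss_factor n z) * D * n%:R^-1.
Proof.
move=> A0; have [D D0 hD] := gauss_factor_cauchy A0; exists D => // n z n0 zA.
have [l hl] : exists l, clim (gauss_factor ^~ z) l.
  apply: cauchy_clim => e e0.
  set M := normc (gauss_factor 1 z) * (1 + D) * D.
  have M0 : 0 <= M by rewrite !mulr_ge0 ?normc_ge0 ?addr_ge0.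
  exists (Num.truncn (M / e)).+1 => m hm.
  apply: le_lt_trans (hD _ _ _ _ hm zA) _ => //.
  set N := (Num.truncn _).+1 in hm *.
  have hN : M / e < N%:R by rewrite truncnS_gt.
  have N0 : 0 < N%:R :> R by rewrite ltr0n.
  have g1 : normc (gauss_factor N z) <= normc (gauss_factor 1 z) * (1 + D).
    have := hD 1%N N z isT isT zA; rewrite invr1 mulr1.
    have := ler_normcD (gauss_factor N z - gauss_factor 1 z) (gauss_factor 1 z).
    rewrite subrK; lra.
  apply: (@le_lt_trans _ _ (M * N%:R^-1)).
    by rewrite ler_wpM2r ?invr_ge0 ?ler0n // /M ler_wpM2r.
  by rewrite ltr_pdivrMr // mulrC -ltr_pdivrMr.
have -> : rGamma z = l.
  apply: (@lim_normc _ (gauss_factor ^~ z)) => e /hl [N hN]; exists N => // k /= Nk.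
  by rewrite normcB hN.
have h : clim (fun k => gauss_factor (n + k) z - gauss_factor n z) (l - gauss_factor n z).
  apply: climD; last exact: clim_cst.
  by move=> e /hl [N hN]; exists N => k hk; apply: hN; rewrite (leq_trans hk) // leq_addl.
by apply: clim_normc_le h => k; apply: hD => //; exact: leq_addr.
Qed.

Lemma rGamma_gt0_neq0 (x : R) : 0 < x -> rGamma x%:C != 0.
Proof.
move=> x0; have [D D0 hD] := gauss_factor_lim (ltW x0).
have nx : normc x%:C <= x by rewrite normc_real ger0_norm // ltW.
apply/eqP => r0; set N := (Num.truncn D).+1.
have hN : D < N%:R by rewrite truncnS_gt.
have N0 : 0 < N%:R :> R by rewrite ltr0n.
have := hD N x%:C isT nx; rewrite r0 sub0r normcNE.
have g0 : 0 < normc (gauss_factor N x%:C).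
  have f0 : (N`!%:R : R[i]) != 0 by rewrite pnatr_eq0 -lt0n fact_gt0.
  rewrite normc_gt0; apply: mulf_neq0; last by rewrite invr_eq0 mulf_neq0 // natcpow_neq0.
  rewrite prodf_seq_neq0; apply/allP => k _ /=.
  have -> : x%:C + k%:R = (x + k%:R)%:C by rewrite rmorphD rmorph_nat.
  rewrite -normc_gt0 normc_real normr_gt0 gt_eqF // ltr_pwDl //.
rewrite -mulrA ler_pMr // leNgt ltr_pdivrMr // mul1r hN //.
Qed.

Lemma rGamma_bounded (A : R) : 0 <= A -> exists2 M : R, 0 <= M &
  forall z, normc z <= A -> normc (rGamma z) <= M.
Proof.
move=> A0; have [D D0 hD] := gauss_factor_lim A0.
exists (A * (A + 1) * (1 + D)); first by rewrite !mulr_ge0 // addr_ge0.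
move=> z zA; have := hD 1%N z isT zA; rewrite invr1 mulr1 => h.
have g1 : normc (gauss_factor 1 z) <= A * (A + 1).
  rewrite /gauss_factor big_nat_recr //= big_nat1 addr0 mul1r /natcpow ln1 mulr0 cexp0 divr1.
  rewrite normcM ler_pM ?normc_ge0 //; apply: le_trans (ler_normcD _ _) _.
  by rewrite normc1E lerD2r.
have := ler_normcD (rGamma z - gauss_factor 1 z) (gauss_factor 1 z); rewrite subrK.
have := normc_ge0 (gauss_factor 1 z); nra.
Qed.

Lemma rising_asymptotic (A : R) : 0 <= A -> exists (D : R) (N : nat), 0 <= D /\
  forall n z, (N <= n)%N -> normc z <= A ->
  normc (rising z n - natcpow n (z - 1) * rGamma z) <=
    normc (natcpow n (z - 1)) * (D * n%:R^-1).
Proof.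
move=> A0; have [D D0 hD] := gauss_factor_lim A0.
have [M M0 hM] := rGamma_bounded A0.
exists (A * M * 2 + (1 + 2 * A) * (M * 2) * D), (Num.truncn (2 * A + 2 * D)).+1.
split; first by rewrite addr_ge0 ?mulr_ge0 //; lra.
move=> n z hn zA.
have hN : 2 * A + 2 * D < n%:R.
  apply: (@lt_le_trans _ _ (Num.truncn (2 * A + 2 * D)).+1%:R); first exact: truncnS_gt.
  by rewrite ler_nat.
have n0 : (0 < n)%N by lia.
have a0 : 0 < n%:R :> R by rewrite ltr0n.
have zn : n%:R / 2 <= normc (z + n%:R).
  have := ler_normcB (z + n%:R) z; rewrite addrAC subrr add0r normc_nat; lra.
have zn0 : z + n%:R != 0 by rewrite -normc_gt0; lra.
have nC0 : (n%:R : R[i]) != 0 by rewrite pnatr_eq0; lia.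
pose x : R[i] := n%:R / (z + n%:R).
have rE : rising z n = natcpow n (z - 1) * (gauss_factor n z * x).
  rewrite natcpowD /x /gauss_factor /rising big_nat_recr //= big_mkord.
  rewrite (_ : natcpow n (-1) = n%:R^-1); last first.
    by rewrite /natcpow mulNr cexpN -/(natcpow n 1) natcpow1n.
  have := natcpow_neq0 n z; move: (natcpow n z) => c c0.
  have : (n`!%:R : R[i]) != 0 by rewrite pnatr_eq0 -lt0n fact_gt0.
  move: zn0 nC0; set p := \prod_(_ < _) _; move: (n`!%:R) (n%:R) => f y y0 yz f0.
  by field; rewrite f0 c0 y0 yz.
rewrite rE -mulrBr normcM ler_wpM2l ?normc_ge0 //.
have hx : normc (x - 1) <= A * 2 * n%:R^-1.
  have -> : x - 1 = - z / (z + n%:R) by rewrite /x; field.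
  rewrite normcM normcNE normcV -mulrA ler_pM ?normc_ge0 ?invr_ge0 ?normc_ge0 //.
  have -> : 2 * n%:R^-1 = (n%:R / 2)^-1 :> R by field; lra.
  by rewrite lef_pV2 ?posrE //; lra.
have g1 := hD n z n0 zA.
have gM : normc (gauss_factor n z) <= M * 2.
  have h : D * n%:R^-1 <= 2^-1 by rewrite ler_pdivrMr //; lra.
  have := ler_normcD (gauss_factor n z - rGamma z) (rGamma z); rewrite subrK normcB.
  have := hM z zA; have := normc_ge0 (gauss_factor n z); move: g1; rewrite -mulrA.
  set E := D * _ in h *; nra.
have nx : normc x <= 1 + 2 * A.
  have := ler_normcD (x - 1) 1; rewrite subrK normc1E.
  have : n%:R^-1 <= 1 :> R by rewrite invf_le1 // ler1n.
  have : 0 < n%:R^-1 :> R by rewrite invr_gt0.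
  nra.
have -> : gauss_factor n z * x - rGamma z = (gauss_factor n z - rGamma z) * x + rGamma z * (x - 1) by ring.
apply: le_trans (ler_normcD _ _) _; rewrite [normc (_ * x)]normcM [normc (_ * (x - 1))]normcM normcB.
have i0 : 0 < n%:R^-1 :> R by rewrite invr_gt0.
have k1 : normc (rGamma z) * normc (x - 1) <= M * (A * 2 * n%:R^-1).
  by rewrite ler_pM ?normc_ge0 // hM.
have k2 : normc (rGamma z - gauss_factor n z) * normc x <= (M * 2 * D * n%:R^-1) * (1 + 2 * A).
  rewrite ler_pM ?normc_ge0 //; apply: le_trans g1 _.
  by rewrite !ler_wpM2r // ltW.
by apply: le_trans (lerD k2 k1) _; rewrite le_eqVlt; apply/orP; left; apply/eqP; ring.
Qed.

End ReciprocalGamma.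

(** * Cycle counts *)

Section CycleIndex.
Import boot.fintype boot.finset fingroup perm.
Local Close Scope classical_set_scope.
Local Open Scope set_scope.
Context {A : numFieldType} {T : finType}.
Variable y : nat -> A.
Implicit Types (s t : {perm T}) (B : {set T}) (f : nat -> A).

Local Open Scope ring_scope.

Lemma porbit_agree s t u : {in porbit s u, s =1 t} -> porbit t u = porbit s u.
Proof.
move=> h; have it i : (t ^+ i)%g u = (s ^+ i)%g u.
  elim: i => [|i ih]; first by rewrite !expg0.
  by rewrite !expgSr !permM ih h // mem_porbit.
apply/setP => v; apply/porbitP/porbitP => -[i ->]; exists i; by rewrite it.
Qed.

Lemma porbit_stable s (C : {set T}) u : u \in C -> (forall v, v \in C -> s v \in C) ->
  porbit s u \subset C.
Proof.
move=> uC h; apply/subsetP => v /porbitP [i ->].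
by elim: i => [|i ih]; rewrite ?expg0 ?perm1 // expgSr permM h.
Qed.

Lemma porbit_sub B s u : perm_on B s -> u \in B -> porbit s u \subset B.
Proof.
by move=> sB uB; apply: porbit_stable => // v vB; rewrite perm_closed.
Qed.

Definition cycle_weight B s : A := \prod_(c in porbits s | c \subset B) y #|c|.
Definition cycle_sum B : A := \sum_(s | perm_on B s) cycle_weight B s.
Definition rooted_sum B x f : A := \sum_(s | perm_on B s)
  f #|porbit s x| * \prod_(c in porbits s | (c \subset B) && (x \notin c)) y #|c|.

Lemma porbit_mem_perm s u v : (s v \in porbit s u) = (v \in porbit s u).
Proof.
by rewrite -!eq_porbit_mem; have := porbit_perm s 1 v; rewrite expg1 => ->.
Qed.

Lemma rooted_sum_fixed B x f : x \in B ->
  \sum_(s | perm_on B s && (s x == x)) f #|porbit s x| *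
     \prod_(c in porbits s | (c \subset B) && (x \notin c)) y #|c| =
  f 1%N * cycle_sum (B :\ x).
Proof.
move=> xB; rewrite /cycle_sum mulr_sumr; apply: eq_big => [s|s /andP[sB /eqP sx]].
  apply/andP/idP => [[sB /eqP sx]|sB].
    apply/subsetP => v; rewrite !inE => vs.
    by rewrite (subsetP sB) ?inE // andbT; apply: contraNneq vs => ->; rewrite sx.
  split; first by apply: subset_trans sB (subsetDl _ _).
  by rewrite (out_perm sB) // !inE eqxx.
have -> : porbit s x = [set x].
  apply/eqP; rewrite eqEsubset sub1set porbit_id andbT.
  by apply: porbit_stable; rewrite ?inE // => v; rewrite !inE => /eqP ->; rewrite sx.
rewrite cards1; congr (_ * _); apply: eq_bigl => c; congr (_ && _).
by rewrite subsetD1.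
Qed.

Lemma porbit_insert s x z : x != z -> s z = z ->
  porbit (tperm x z * s)%g x = z |: porbit s x.
Proof.
move=> xz sz; set t := (tperm x z * s)%g.
have tx : t x = z by rewrite permM tpermL.
have tz : t z = s x by rewrite permM tpermR.
have tD v : v != x -> v != z -> t v = s v by move=> vx vz; rewrite permM tpermD // eq_sym.
apply/eqP; rewrite eqEsubset; apply/andP; split.
  apply: porbit_stable; first by rewrite !inE porbit_id orbT.
  move=> v; rewrite !inE => /orP[/eqP ->|vs].
    by rewrite tz porbit_mem_perm porbit_id orbT.
  have [->|vx] := eqVneq v x; first by rewrite tx eqxx.
  have [->|vz] := eqVneq v z; first by rewrite tz porbit_mem_perm porbit_id orbT.
  by rewrite tD // porbit_mem_perm vs orbT.
have zt : z \in porbit t x by rewrite -tx porbit_mem_perm porbit_id.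
rewrite subUset sub1set zt; apply: porbit_stable; first exact: porbit_id.
move=> v vt; have [->|vx] := eqVneq v x; first by rewrite -tz porbit_mem_perm.
have [->|vz] := eqVneq v z; first by rewrite sz.
by rewrite -tD // porbit_mem_perm.
Qed.

(* Removing [z = s x] from the cycle of [x] identifies these [s] with the
   permutations of [B :\ z]. *)
Lemma rooted_sum_moved B x z f : x \in B -> z \in B :\ x ->
  \sum_(s | perm_on B s && (s x == z)) f #|porbit s x| *
     \prod_(c in porbits s | (c \subset B) && (x \notin c)) y #|c| =
  rooted_sum (B :\ z) x (fun k => f k.+1).
Proof.
move=> xB; rewrite !inE => /andP[zx zB]; have xz : x != z by rewrite eq_sym.
rewrite /rooted_sum (reindex_inj (mulgI (tperm x z))) /=.
apply: eq_big => [s|s].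
  apply/andP/idP => [[/subsetP h /eqP e]|/subsetP h].
    have sz : s z = z by move: e; rewrite permM tpermL.
    apply/subsetP => v; rewrite !inE => vs.
    have vz : v != z by apply: contraNneq vs => ->; rewrite sz.
    rewrite vz /=; have [->//|vx] := eqVneq v x.
    by apply: h; rewrite inE permM tpermD // eq_sym.
  have sz : s z = z by apply/eqP; apply: contraT => /h; rewrite !inE eqxx.
  split; last by rewrite permM tpermL sz.
  apply/subsetP => v; rewrite !inE permM; case: tpermP => [->|->|vx vz] // sv.
  by have := h v; rewrite !inE => /(_ sv) /andP[].
move=> /andP[sB /eqP e].
have sz : s z = z by move: e; rewrite permM tpermL.
rewrite porbit_insert // cardsU1.
have zs : z \notin porbit s x.
  rewrite porbit_sym; apply/negP => /(subsetP (_ : porbit s z \subset [set z])) h.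
  have : x \in [set z].
    by apply: h; apply: porbit_stable; rewrite ?inE // => v; rewrite !inE => /eqP ->; rewrite sz.
  by rewrite !inE (negbTE xz).
rewrite zs add1n; congr (_ * _); apply: eq_bigl => c.
set t := (tperm x z * s)%g.
have tx : t x = z by rewrite permM tpermL.
have tD v : v != x -> v != z -> t v = s v by move=> vx vz; rewrite permM tpermD // eq_sym.
apply/andP/andP => -[/imsetP [u _ ->]] /andP[cB xc].
  have zc : z \notin porbit t u by rewrite -tx porbit_mem_perm.
  have E : porbit s u = porbit t u.
    apply: porbit_agree => v vc; apply: tD.
      by apply: contraNneq xc => <-.
    by apply: contraNneq zc => <-.
  by split; [rewrite -E; exact: imset_f|rewrite subsetD1 cB zc xc].
move: cB; rewrite subsetD1 => /andP[cB zc].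
have E : porbit t u = porbit s u.
  apply: porbit_agree => v vc; rewrite tD //.
    by apply: contraNneq xc => <-.
  by apply: contraNneq zc => <-.
rewrite cB xc; split=> //; rewrite -E; exact: imset_f.
Qed.

Lemma rooted_sum_rec B x f : x \in B ->
  rooted_sum B x f = f 1%N * cycle_sum (B :\ x) +
    \sum_(z in B :\ x) rooted_sum (B :\ z) x (fun k => f k.+1).
Proof.
move=> xB; rewrite {1}/rooted_sum (partition_big (fun s : {perm T} => s x) (mem B)) /=; last first.
  by move=> s sB; rewrite perm_closed.
rewrite (bigD1 x) //= rooted_sum_fixed //; congr (_ + _).
apply: eq_big => [z|z /andP[zB zx]]; first by rewrite !inE andbC.
by rewrite rooted_sum_moved // !inE zx.
Qed.

Lemma cycle_sum_rooted B x : x \in B -> cycle_sum B = rooted_sum B x y.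
Proof.
move=> xB; apply: eq_bigr => s sB; rewrite /cycle_weight.
rewrite (bigD1 (porbit s x)) /=; last by rewrite imset_f // porbit_sub.
congr (_ * _); apply: eq_bigl => c; rewrite -andbA; case: imsetP => //= -[u _ ->].
by rewrite eq_porbit_mem porbit_sym.
Qed.

Lemma rooted_sumE (E : nat -> A) n :
  (forall B, (#|B| <= n)%N -> cycle_sum B = (#|B|)`!%:R * E #|B|) ->
  forall B x f, x \in B -> #|B| = n.+1 ->
  rooted_sum B x f = n`!%:R * \sum_(i < n.+1) f i.+1 * E (n - i)%N.
Proof.
elim: n => [|n ih] hE B x f xB cB; rewrite rooted_sum_rec //.
  have Bx : #|B :\ x| = 0%N by have := cardsD1 x B; rewrite xB cB add1n => -[<-].
  rewrite hE ?Bx // big1 ?addr0 ?big_ord1 /=; last by move=> z; rewrite (cards0_eq Bx) inE.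
  by rewrite fact0 mul1r mul1r.
have Bx : #|B :\ x| = n.+1 by have := cardsD1 x B; rewrite xB cB add1n => -[<-].
rewrite hE ?Bx //.
rewrite (eq_bigr (fun=> n`!%:R * \sum_(i < n.+1) f i.+2 * E (n - i)%N)); last first.
  move=> z; rewrite !inE => /andP[zx zB]; apply: ih.
  - by move=> C hC; apply: hE; rewrite leqW.
  - by rewrite !inE eq_sym zx.
  - by have := cardsD1 z B; rewrite zB cB add1n => -[<-].
rewrite sumr_const Bx [in RHS]big_ord_recl /= subn0 mulrDr; congr (_ + _); first by rewrite mulrCA.
by rewrite -[LHS]mulr_natl mulrA -natrM -factS; congr (_ * _).
Qed.

Lemma cycle_sumE B :
  cycle_sum B = (#|B|)`!%:R * fps_exp (fun k => if k is 0 then 0 else y k / k%:R) #|B|.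
Proof.
set a := fun k : nat => _; move: {2}#|B| (leqnn #|B|) => n.
elim: n B => [|n ih] B.
  rewrite leqn0 cards_eq0 => /eqP ->; rewrite cards0 fps_exp0 fact0 mul1r.
  rewrite /cycle_sum (bigD1 1%g) /=; last by rewrite perm_on1.
  rewrite [X in _ + X]big1 ?addr0; last first.
    move=> s /andP[/subsetP h /eqP []]; apply/permP => u; rewrite perm1.
    by apply/eqP; apply: contraT => /h; rewrite inE.
  rewrite /cycle_weight big1 // => c /andP[/imsetP [u _ ->]].
  by rewrite subset0 => /eqP h; have := porbit_id 1%g u; rewrite h inE.
rewrite leq_eqVlt => /orP[/eqP cB|]; last by rewrite ltnS; exact: ih.
have [x xB] : exists x, x \in B by apply/set0Pn; rewrite -card_gt0 cB.
rewrite (cycle_sum_rooted xB) (rooted_sumE ih) // cB factS natrM (mulrC n.+1%:R) -mulrA.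
congr (_ * _); rewrite fps_expS //; apply: eq_bigr => i _.
by rewrite /a mulrCA divff ?mulr1 // pnatr_eq0.
Qed.

End CycleIndex.

Section CycleGeneratingFunction.
Import boot.fintype boot.finset fingroup perm.
Local Close Scope classical_set_scope.
Local Open Scope set_scope.
Context {R : realType}.
Variable Theta : nat -> R.
Hypothesis Theta_ge0 : forall m : nat, (0 < m)%N -> 0 <= Theta m.

Lemma weight_ge0 n (s : 'S_n) : 0 <= weight Theta s.
Proof.
by rewrite /weight big_nat_cond prodr_ge0 // => m /andP[/andP[m0 _] _]; rewrite exprn_ge0 // Theta_ge0.
Qed.

Lemma h_ETheta n (u : 'S_n -> R[i]) :
  (h Theta n)%:C * ETheta Theta u = (n`!%:R)^-1 * \sum_(s : 'S_n) (weight Theta s)%:C * u s.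
Proof.
have f0 : (n`!%:R : R) != 0 by rewrite pnatr_eq0 -lt0n fact_gt0.
have fC : (n`!%:R : R[i])^-1 = (n`!%:R^-1)%:C by rewrite fmorphV rmorph_nat.
rewrite /ETheta !mulr_sumr; apply: eq_bigr => s _; rewrite /PTheta !mulrA; congr (_ * _).
rewrite fC -!rmorphM; congr (_%:C).
have [h0|h0] := eqVneq (h Theta n) 0; last first.
  by rewrite invfM; field; rewrite f0 h0.
rewrite h0 mul0r; suff -> : weight Theta s = 0 by rewrite mulr0.
move: h0 => /eqP; rewrite mulf_eq0 invr_eq0 (negbTE f0) /= => /eqP h0.
by apply: (psumr_eq0P _ h0) => // t _; exact: weight_ge0.
Qed.

Lemma porbits_prod n (y : nat -> R[i]) (s : 'S_n) :
  \prod_(c in porbits s) y #|c| = \prod_(1 <= m < n.+1) y m ^+ ncycles m s.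
Proof.
rewrite (partition_big (fun c : {set 'I_n} => (inord #|c| : 'I_n.+1)) xpredT) //=.
have cn (c : {set 'I_n}) : (#|c| < n.+1)%N by rewrite ltnS -[X in (_ <= X)%N]card_ord max_card.
rewrite (eq_bigr (fun m : 'I_n.+1 => y m ^+ ncycles m s)) => [|m _].
  rewrite -(big_mkord xpredT (fun m => y m ^+ ncycles m s)) big_ltn // /ncycles.
  rewrite (_ : [set c in porbits s | #|c| == 0%N] = set0) ?cards0 ?mul1r //.
  apply/setP => c; rewrite !inE; apply/negbTE/negP => /andP[/imsetP [u _ ->]].
  by rewrite (negbTE (card_porbit_neq0 _ _)).
rewrite -prodr_const; apply: eq_big => [c|c /andP[_ /eqP <-]]; last by rewrite inordK.
by rewrite inE -val_eqE /= inordK.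
Qed.

Lemma h_ETheta_cexp n (w : R[i]) :
  (h Theta n)%:C * ETheta Theta (fun s : 'S_n => cexp (w * (K0 s)%:R)) =
  fps_exp (fun k => cexp w * gTheta Theta k) n.
Proof.
rewrite h_ETheta; pose y m : R[i] := cexp w * (Theta m)%:C.
have -> : \sum_(s : 'S_n) (weight Theta s)%:C * cexp (w * (K0 s)%:R) = cycle_sum y [set: 'I_n].
  rewrite /cycle_sum; apply: eq_big => [s|s _].
    by apply/esym/subsetP => u; rewrite inE.
  rewrite /cycle_weight (eq_bigl (mem (porbits s))); last first.
    by move=> c; rewrite subsetT andbT.
  rewrite porbits_prod cexpMn /K0 /weight -prodrXr rmorph_prod -big_split /=.
  by apply: eq_bigr => m _; rewrite /y rmorphXn [RHS]exprMn mulrC.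
rewrite cycle_sumE cardsT card_ord mulKf; last by rewrite pnatr_eq0 -lt0n fact_gt0.
congr (fps_exp _ n); apply/funext => -[|k]; rewrite /gTheta ?mulr0 //.
by rewrite /y rmorphM fmorphV rmorph_nat mulrA.
Qed.

Lemma h_fps_exp n : (h Theta n)%:C = fps_exp (gTheta Theta) n.
Proof.
have := h_ETheta_cexp n 0; rewrite cexp0.
have -> : (fun k => 1 * gTheta Theta k) = gTheta Theta by apply/funext => k; rewrite mul1r.
move=> <-; rewrite h_ETheta (eq_bigr (fun s => (weight Theta s)%:C)); last first.
  by move=> s _; rewrite mul0r cexp0 mulr1.
by rewrite /h rmorphM fmorphV rmorph_nat rmorph_sum.
Qed.

End CycleGeneratingFunction.

(** * Integrals along segments and Goursat's theorem *)

Section PathDerivative.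
Context {R : realType}.
Implicit Types (F G : R -> R[i]) (t s : R) (d : R[i]).

Definition rdiff F t d := forall e : R, 0 < e -> exists2 r : R, 0 < r &
  forall s, `|s - t| < r -> normc (F s - F t - (s - t)%:C * d) <= e * `|s - t|.

Lemma rdiffD F G t d d' : rdiff F t d -> rdiff G t d' ->
  rdiff (fun s => F s + G s) t (d + d').
Proof.
move=> hF hG e e0; have e2 : 0 < e / 2 by rewrite divr_gt0.
have [r r0 h] := hF _ e2; have [r' r'0 h'] := hG _ e2.
exists (Num.min r r'); first by rewrite lt_min r0.
move=> s; rewrite lt_min => /andP[/h k /h' k'].
have -> : F s + G s - (F t + G t) - (s - t)%:C * (d + d') =
  (F s - F t - (s - t)%:C * d) + (G s - G t - (s - t)%:C * d') by ring.
apply: le_trans (ler_normcD _ _) _; lra.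
Qed.

Lemma rdiffZ F t d (c : R[i]) : rdiff F t d -> rdiff (fun s => c * F s) t (c * d).
Proof.
move=> hF e e0; have c0 := normc_ge0 c.
have [|r r0 h] := hF (e / (normc c + 1)); first by rewrite divr_gt0 // ltr_wpDl.
exists r => // s /h k.
have -> : c * F s - c * F t - (s - t)%:C * (c * d) = c * (F s - F t - (s - t)%:C * d) by ring.
rewrite normcM; apply: le_trans (ler_wpM2l c0 k) _.
rewrite mulrA ler_wpM2r // mulrCA ler_piMr ?(ltW e0) //.
by rewrite ler_pdivrMr; lra.
Qed.

Lemma rdiff_affine F t d (p q : R) : q != 0 -> rdiff F (p + t * q) d ->
  rdiff (fun s => F (p + s * q)) t (q%:C * d).
Proof.
move=> q0 hF e e0; have nq : 0 < `|q| by rewrite normr_gt0.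
have [|r r0 h] := hF (e / `|q|); first by rewrite divr_gt0.
exists (r / `|q|); first by rewrite divr_gt0.
move=> s; rewrite ltr_pdivlMr // => hs.
have E : p + s * q - (p + t * q) = (s - t) * q by ring.
have := h (p + s * q); rewrite E normrM => /(_ hs).
have -> : e / `|q| * (`|s - t| * `|q|) = e * `|s - t| by field; rewrite gt_eqF.
by rewrite rmorphM -mulrA.
Qed.

Lemma rdiff_real (F1 F2 : R -> R) t (d : R[i]) :
  is_derive t 1 F1 (complex.Re d) -> is_derive t 1 F2 (complex.Im d) ->
  rdiff (fun s => F1 s +i* F2 s) t d.
Proof.
have key (f : R -> R) a : is_derive t 1 f a -> forall e : R, 0 < e ->
    exists2 r : R, 0 < r & forall s, `|s - t| < r -> `|f s - f t - (s - t) * a| <= e * `|s - t|.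
  move=> [fd fv] e e0; move: fd; rewrite /derivable => /cvgrPdist_lt /(_ e e0).
  rewrite near_withinE => /nbhs_ballP [r /= r0 hr]; exists r => // s hs.
  have [->|st] := eqVneq s t; first by rewrite !subrr mul0r subrr normr0 mulr0.
  have st0 : s - t != 0 by rewrite subr_eq0.
  have := hr (s - t); rewrite /ball /= sub0r normrN => /(_ hs st0).
  rewrite -/(derive _ _ _) fv.
  rewrite {1}/GRing.scale /= [(s - t) *: _]mulr1 subrK => /ltW h.
  have -> : f s - f t - (s - t) * a = - (a - (s - t)^-1 *: (f s - f t)) * (s - t).
    by rewrite /GRing.scale /=; field.
  by rewrite normrM normrN ler_wpM2r.
move=> /key h1 /key h2 e e0; have e2 : 0 < e / 2 by rewrite divr_gt0.
have [r r0 h] := h1 _ e2; have [r' r'0 h'] := h2 _ e2.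
exists (Num.min r r'); first by rewrite lt_min r0.
move=> s; rewrite lt_min => /andP[/h k /h' k'].
apply: le_trans (ler_normc_ReIm _) _.
rewrite !ReD !ReN ReM !ImD !ImN ImM /= mul0r subr0 mul0r addr0; lra.
Qed.

Lemma rdiff_derive F t d (p : R[i] -> R) :
  (forall z w, p (z - w) = p z - p w) -> (forall (x : R) z, p (x%:C * z) = x * p z) ->
  (forall z, `|p z| <= normc z) ->
  rdiff F t d -> is_derive t 1 (fun s => p (F s)) (p d).
Proof.
move=> pB pZ pn hF.
have h : (fun s => s^-1 *: (((fun s => p (F s)) \o shift t) (s *: (1 : R)) - p (F t))) @ 0^' --> p d.
  apply/cvgrPdist_le => e e0; have [r r0 hr] := hF e e0.
  rewrite near_withinE; apply/nbhs_ballP; exists r => //= s.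
  rewrite /ball /= sub0r normrN => sr s0.
  have := hr (s + t); rewrite addrK => /(_ sr) k.
  rewrite /GRing.scale /= mulr1.
  have -> : p d - s^-1 * (p (F (s + t)) - p (F t)) = - s^-1 * p (F (s + t) - F t - s%:C * d).
    by rewrite !pB pZ; field.
  have s1 : 0 < `|s| by rewrite normr_gt0.
  rewrite normrM normrN normfV mulrC ler_pdivrMr //; exact: le_trans (pn _) k.
by apply: DeriveDef; [apply/cvg_ex; exists (p d)|apply/cvg_lim].
Qed.

Lemma mean_value_le (f g f' g' : R -> R) :
  (forall t, 0 <= t <= 1 -> is_derive t 1 f (f' t)) ->
  (forall t, 0 <= t <= 1 -> is_derive t 1 g (g' t)) ->
  (forall t, 0 <= t <= 1 -> f' t <= g' t) -> f 1 - f 0 <= g 1 - g 0.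
Proof.
move=> hf hg fg.
have hd t : 0 <= t <= 1 -> is_derive t 1 (g - f) (g' t - f' t).
  by move=> t01; have := hf t t01; have := hg t t01 => ? ?; exact: is_deriveB.
have dc : {within `[0, 1], continuous (g - f)}.
  by apply: derivable_within_continuous => t; rewrite in_itv /= => /hd; case.
have [|c] := @MVT R (g - f) (fun t => g' t - f' t) 0 1 ltr01 _ dc.
  by move=> t; rewrite in_itv /= => /andP[c0 c1]; apply: hd; rewrite !ltW.
rewrite in_itv /= => /andP[c0 c1]; rewrite subr0 mulr1.
have c01 : 0 <= c <= 1 by rewrite !ltW.
have h := fg c c01.
rewrite -[(g - f) 1]/(g 1 - f 1) -[(g - f) 0]/(g 0 - f 0) => k; lra.
Qed.

Lemma rdiff_mean_value F (F' : R -> R[i]) (g g' : R -> R) :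
  (forall t, 0 <= t <= 1 -> rdiff F t (F' t)) ->
  (forall t, 0 <= t <= 1 -> is_derive t 1 g (g' t)) ->
  (forall t, 0 <= t <= 1 -> normc (F' t) <= g' t) ->
  normc (F 1 - F 0) <= 2 * (g 1 - g 0).
Proof.
move=> hF hg le.
have key (p : R[i] -> R) : (forall z w, p (z - w) = p z - p w) ->
    (forall (x : R) z, p (x%:C * z) = x * p z) -> (forall z, `|p z| <= normc z) ->
    `|p (F 1 - F 0)| <= g 1 - g 0.
  move=> pB pZ pn.
  have d t : 0 <= t <= 1 -> is_derive t 1 (fun s => p (F s)) (p (F' t)).
    by move=> t01; apply: rdiff_derive => //; exact: hF.
  have dN t : 0 <= t <= 1 -> is_derive t 1 (- (fun s => p (F s))) (- p (F' t)).
    by move=> t01; have := d t t01 => ?; exact: is_deriveN.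
  have := mean_value_le d hg; have := mean_value_le dN hg.
  rewrite pB -![(- _) _]/(- _) => h1 h2; rewrite ler_norml.
  have n t : 0 <= t <= 1 -> `|p (F' t)| <= g' t by move=> /le; apply: le_trans.
  apply/andP; split; last first.
    by apply: h2 => t /n; rewrite ler_norml => /andP[].
  suff : - p (F 1) - - p (F 0) <= g 1 - g 0 by lra.
  by apply: h1 => t /n; rewrite ler_norml => /andP[]; lra.
have h1 : `|complex.Re (F 1 - F 0)| <= g 1 - g 0.
  apply: key => [z w|x z|]; [by rewrite ReD ReN| |exact: ler_normRe].
  by rewrite ReM /= mul0r subr0.
have h2 : `|complex.Im (F 1 - F 0)| <= g 1 - g 0.
  apply: key => [z w|x z|]; [by rewrite ImD ImN| |exact: ler_normIm].
  by rewrite ImM /= mul0r addr0.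
apply: le_trans (ler_normc_ReIm _) _; lra.
Qed.

Lemma antiderivative01 (f : R -> R) : continuous f ->
  exists F : R -> R, forall t, 0 <= t <= 1 -> is_derive t 1 F (f t).
Proof.
move=> fc; exists (fun x => \int[lebesgue_measure]_(u in `[-1, x]) f u) => t /andP[t0 t1].
have [| | | |d e] := @continuous_FTC1_closed R f (-1) t 2.
- lra.
- apply: continuous_compact_integrable; first exact: segment_compact.
  exact: continuous_subspaceT.
- lra.
- exact: fc.
by apply: (DeriveDef d); rewrite -derive1E.
Qed.

Lemma is_derive_affine (p q t : R) : is_derive t 1 (fun t : R => p + t * q) q.
Proof.
have := is_deriveD (is_derive_cst p t (1 : R))
  (is_deriveM (is_derive_id t (1 : R)) (is_derive_cst q t (1 : R))).
by rewrite /cst /GRing.scale /= mulr0 add0r mulr1 add0r.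
Qed.

Lemma is_derive_scaled_expR (k p q t : R) :
  is_derive t 1 (fun t : R => k * expR (p + t * q)) (k * (expR (p + t * q) * q)).
Proof.
have := is_deriveM (is_derive_cst k t (1 : R))
  (@is_derive1_comp R expR (fun t : R => p + t * q) t _ _ (is_derive_expR _) (is_derive_affine p q t)).
by rewrite /cst /GRing.scale /= mulr0 addr0.
Qed.

End PathDerivative.

Section SegmentIntegral.
Context {R : realType}.
Implicit Types (f g : R[i] -> R[i]) (a b c v w z : R[i]) (s t : R).

Definition seg a b t : R[i] := a + t%:C * (b - a).

Lemma seg0 a b : seg a b 0 = a. Proof. by rewrite /seg mul0r addr0. Qed.
Lemma seg1 a b : seg a b 1 = b. Proof. by rewrite /seg mul1r addrC subrK. Qed.

Lemma seg_rev a b t : seg b a t = seg a b (1 - t).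
Proof. by rewrite /seg rmorphB /=; ring. Qed.

(* The integral of [f] from [a] to [b], in terms of a primitive along the segment. *)
Definition is_seg f a b v := exists F : R -> R[i],
  (forall t, 0 <= t <= 1 -> rdiff F t (f (seg a b t) * (b - a))) /\ v = F 1 - F 0.

Definition seg_int f a b : R[i] := xget 0 (is_seg f a b).

Lemma is_seg_bound f a b v (g g' : R -> R) : is_seg f a b v ->
  (forall t, 0 <= t <= 1 -> is_derive t 1 g (g' t)) ->
  (forall t, 0 <= t <= 1 -> normc (f (seg a b t)) * normc (b - a) <= g' t) ->
  normc v <= 2 * (g 1 - g 0).
Proof.
move=> [F [hF ->]] hg le; apply: rdiff_mean_value hF hg _ => t /le.
by rewrite normcM.
Qed.

Lemma is_seg_sup f a b v (M : R) : is_seg f a b v ->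
  (forall t, 0 <= t <= 1 -> normc (f (seg a b t)) <= M) ->
  normc v <= 2 * (M * normc (b - a)).
Proof.
move=> hv le; have := @is_seg_bound f a b v ( *%R^~ (M * normc (b - a))) (fun=> M * normc (b - a)) hv.
rewrite mul1r mul0r subr0; apply => t t01; last by rewrite ler_wpM2r ?normc_ge0 // le.
have h := is_deriveM (is_derive_id t (1 : R)) (is_derive_cst (M * normc (b - a)) t (1 : R)).
apply: is_derive_eq; rewrite /cst /= /GRing.scale /= mulr0 add0r mulr1 //.
Qed.

Definition clamp01 t : R := Num.max 0 (Num.min t 1).

Lemma clamp01_in t : 0 <= clamp01 t <= 1.
Proof. by rewrite /clamp01 le_max lexx ge_max ler01 ge_min lexx orbT. Qed.

Lemma clamp01_id t : 0 <= t <= 1 -> clamp01 t = t.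
Proof. by move=> /andP[t0 t1]; rewrite /clamp01 (min_idPl t1) (max_idPr t0). Qed.

Lemma clamp01_lipschitz s t : `|clamp01 s - clamp01 t| <= `|s - t|.
Proof.
rewrite /clamp01; case: (leP s 1); case: (leP t 1) => h1 h2; case: (leP 0 s); case: (leP 0 t);
rewrite ?ltr01 ?ler01 ?maxEle ?minEle; move=> h3 h4; rewrite ?(ltW h3) ?(ltW h4) ?ler01 ?h3 ?h4;
by rewrite ler_norml; have := ler_norm (s - t); have := ler_norm (t - s); rewrite (distrC t);
   move=> k1 k2; apply/andP; split; lra.
Qed.

Lemma ccont_clamp f a b : (forall t, 0 <= t <= 1 -> ccont f (seg a b t)) ->
  forall t (e : R), 0 < e -> exists2 r : R, 0 < r &
  forall s, `|s - t| < r -> normc (f (seg a b (clamp01 s)) - f (seg a b (clamp01 t))) < e.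
Proof.
move=> fc t e e0; have [d d0 hd] := fc _ (clamp01_in t) e e0.
have n0 := normc_ge0 (b - a).
exists (d / (normc (b - a) + 1)); first by rewrite divr_gt0 // ltr_wpDl.
move=> s; rewrite ltr_pdivlMr ?ltr_wpDl // => hs; apply: hd.
have -> : seg a b (clamp01 s) - seg a b (clamp01 t) = (clamp01 s - clamp01 t)%:C * (b - a).
  by rewrite /seg rmorphB /=; ring.
rewrite normcM normc_real; apply: le_lt_trans hs.
by apply: ler_pM => //; rewrite ?clamp01_lipschitz // lerDl.
Qed.

Lemma ccont_seg_bounded f a b : (forall t, 0 <= t <= 1 -> ccont f (seg a b t)) ->
  exists M, forall t, 0 <= t <= 1 -> normc (f (seg a b t)) <= M.
Proof.
move=> fc; pose u t := normc (f (seg a b (clamp01 t))).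
have uc : continuous u.
  move=> t; apply/cvgrPdist_lt => e e0; have [r r0 h] := ccont_clamp fc t e0.
  apply/nbhs_ballP; exists r => // s; rewrite /ball /= distrC => /h hs.
  by apply: le_lt_trans hs; rewrite distrC ler_normc_dist.
have [c _ hc] := @EVT_max R u 0 1 ler01 (continuous_subspaceT uc).
exists (u c) => t t01; have := hc t; rewrite in_itv /= => /(_ t01).
by rewrite /u clamp01_id.
Qed.

Lemma is_seg_exists f a b : (forall t, 0 <= t <= 1 -> ccont f (seg a b t)) ->
  exists v, is_seg f a b v.
Proof.
move=> fc; pose u t := f (seg a b (clamp01 t)) * (b - a).
have uc t (e : R) : 0 < e -> exists2 r : R, 0 < r & forall s, `|s - t| < r -> normc (u s - u t) < e.
  apply: (@ccont_clamp (fun z => f z * (b - a))) => v v01.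
  by apply: ccontM; [exact: fc|exact: ccont_cst].
have pc (p : R[i] -> R) : (forall z w, p (z - w) = p z - p w) -> (forall z, `|p z| <= normc z) ->
    continuous (fun t => p (u t)).
  move=> pB pn t; apply/cvgrPdist_lt => e e0; have [r r0 h] := uc t e e0.
  apply/nbhs_ballP; exists r => // s; rewrite /ball /= distrC => /h hs.
  by rewrite distrC -pB; apply: le_lt_trans (pn _) hs.
have [|F1 h1] := antiderivative01 (pc (@complex.Re R) _ (@ler_normRe R)).
  by move=> z w; rewrite ReD ReN.
have [|F2 h2] := antiderivative01 (pc (@complex.Im R) _ (@ler_normIm R)).
  by move=> z w; rewrite ImD ImN.
exists ((F1 1 +i* F2 1) - (F1 0 +i* F2 0)), (fun t => F1 t +i* F2 t); split=> // t t01.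
by have := rdiff_real (h1 t t01) (h2 t t01); rewrite /u clamp01_id.
Qed.

Lemma is_seg_unique f a b v w : is_seg f a b v -> is_seg f a b w -> v = w.
Proof.
move=> [F [hF ->]] [G [hG ->]]; apply/eqP; rewrite -subr_eq0 -normc_eq0.
rewrite eq_le normc_ge0 andbT.
have h t : 0 <= t <= 1 -> rdiff (fun s => F s + (-1) * G s) t 0.
  move=> t01; have := rdiffD (hF t t01) (rdiffZ (-1) (hG t t01)).
  by rewrite mulN1r subrr.
have := @rdiff_mean_value R (fun s => F s + (-1) * G s) (fun=> 0) (cst 0) (fun=> 0) h.
move=> /(_ (fun t _ => is_derive_cst (0 : R) t (1 : R))).
rewrite /cst subrr mulr0 => /(_ _) h'.
have -> : F 1 - F 0 - (G 1 - G 0) = F 1 + -1 * G 1 - (F 0 + -1 * G 0) by ring.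
by apply: h' => t _; rewrite normc0E.
Qed.

Lemma seg_intE f a b v : is_seg f a b v -> seg_int f a b = v.
Proof.
move=> h; apply: (is_seg_unique _ h); rewrite /seg_int.
by apply: xgetPex; exists v.
Qed.

Lemma is_segD f g a b v w : is_seg f a b v -> is_seg g a b w ->
  is_seg (fun z => f z + g z) a b (v + w).
Proof.
move=> [F [hF ->]] [G [hG ->]]; exists (fun s => F s + G s); split; last by ring.
by move=> t t01; rewrite mulrDl; apply: rdiffD; [exact: hF|exact: hG].
Qed.

Lemma is_segZ f a b v (k : R[i]) : is_seg f a b v -> is_seg (fun z => k * f z) a b (k * v).
Proof.
move=> [F [hF ->]]; exists (fun s => k * F s); split; last by ring.
by move=> t t01; rewrite -mulrA; apply: rdiffZ; exact: hF.
Qed.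

Lemma eq_is_seg f g a b v : (forall t, 0 <= t <= 1 -> f (seg a b t) = g (seg a b t)) ->
  is_seg f a b v -> is_seg g a b v.
Proof.
by move=> fg [F [hF ->]]; exists F; split=> // t t01; rewrite -fg //; exact: hF.
Qed.

Lemma is_seg_rev f a b v : is_seg f a b v -> is_seg f b a (- v).
Proof.
move=> [F [hF ->]]; exists (fun s => F (1 + s * -1)); split; last first.
  by rewrite mul1r mul0r addr0 subrr; ring.
move=> t /andP[t0 t1].
have h : rdiff F (1 + t * -1) (f (seg a b (1 + t * -1)) * (b - a)).
  by apply: hF; apply/andP; split; lra.
have n1 : (-1 : R) != 0 by rewrite oppr_eq0 oner_eq0.
have := rdiff_affine n1 h; rewrite mulrN1 -seg_rev.
have -> // : (-1)%:C * (f (seg b a t) * (b - a)) = f (seg b a t) * (a - b).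
by rewrite rmorphN /=; ring.
Qed.

Lemma is_seg_shift f a b v (k : R[i]) :
  is_seg f a b v -> is_seg (fun z => f (z - k)) (a + k) (b + k) v.
Proof.
move=> [F [hF ->]]; exists F; split=> // t t01.
have -> : b + k - (a + k) = b - a by ring.
have -> : seg (a + k) (b + k) t - k = seg a b t by rewrite /seg; ring.
exact: hF.
Qed.

Definition mid a b : R[i] := (a + b) / 2.

Lemma is_seg_mid f a b v w : is_seg f a (mid a b) v -> is_seg f (mid a b) b w ->
  (forall t, 0 <= t <= 1 -> ccont f (seg a b t)) ->
  is_seg f a b (v + w).
Proof.
move=> hv hw fc; have [u [F [hF uE]]] := is_seg_exists fc.
have h2 : (2^-1 : R) != 0 by rewrite invr_eq0 pnatr_eq0.
have c2 : (2^-1 : R)%:C = 2^-1 :> R[i] by rewrite fmorphV rmorph_nat.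
have tC (t : R) : (t / 2)%:C = t%:C * 2^-1 :> R[i] by rewrite -c2 -rmorphM.
have m1 : mid a b - a = 2^-1 * (b - a) by rewrite /mid; field.
have m2 : b - mid a b = 2^-1 * (b - a) by rewrite /mid; field.
have k1 : is_seg f a (mid a b) (F 2^-1 - F 0).
  exists (fun s => F (0 + s * 2^-1)); split; last by rewrite mul1r mul0r !add0r.
  move=> t /andP[t0 t1].
  have h : rdiff F (0 + t * 2^-1) (f (seg a b (0 + t * 2^-1)) * (b - a)).
    by apply: hF; apply/andP; split; lra.
  have := rdiff_affine h2 h.
  have -> : seg a b (0 + t / 2) = seg a (mid a b) t.
    by rewrite /seg add0r tC m1; ring.
  by rewrite m1 c2 mulrCA.
have k2 : is_seg f (mid a b) b (F 1 - F 2^-1).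
  exists (fun s => F (2^-1 + s * 2^-1)); split; last first.
    by rewrite mul1r mul0r addr0; congr (F _ - _); field.
  move=> t /andP[t0 t1].
  have h : rdiff F (2^-1 + t * 2^-1) (f (seg a b (2^-1 + t * 2^-1)) * (b - a)).
    by apply: hF; apply/andP; split; lra.
  have := rdiff_affine h2 h.
  have -> : seg a b (2^-1 + t / 2) = seg (mid a b) b t.
    by rewrite /seg rmorphD /= tC c2 m2 /mid; field.
  by rewrite m2 c2 mulrCA.
rewrite (is_seg_unique hv k1) (is_seg_unique hw k2).
have -> : F 2^-1 - F 0 + (F 1 - F 2^-1) = F 1 - F 0 by ring.
by exists F.
Qed.

Lemma is_seg_primitive f F a b :
  (forall t, 0 <= t <= 1 -> cdiff F (seg a b t) (f (seg a b t))) ->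
  is_seg f a b (F b - F a).
Proof.
move=> hF; exists (fun s => F (seg a b s)); split; last by rewrite seg0 seg1.
move=> t t01 e e0; have [q [hq qz qc]] := hF t t01.
have n0 := normc_ge0 (b - a).
have [|d d0 hd] := qc (e / (normc (b - a) + 1)); first by rewrite divr_gt0 // ltr_wpDl.
exists (d / (normc (b - a) + 1)); first by rewrite divr_gt0 // ltr_wpDl.
move=> s; rewrite ltr_pdivlMr ?ltr_wpDl // => hs.
have E : seg a b s - seg a b t = (s - t)%:C * (b - a) by rewrite /seg rmorphB /=; ring.
have st0 := normr_ge0 (s - t).
have nE : normc (seg a b s - seg a b t) = `|s - t| * normc (b - a).
  by rewrite E normcM normc_real.
have /hd hq' : normc (seg a b s - seg a b t) < d by rewrite nE; lra.
have -> : F (seg a b s) - F (seg a b t) - (s - t)%:C * (f (seg a b t) * (b - a)) =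
   (q (seg a b s) - q (seg a b t)) * (seg a b s - seg a b t).
  by rewrite hq qz E; ring.
rewrite normcM nE; move/ltW: hq'; rewrite ler_pdivlMr ?ltr_wpDl // => k.
have n1 := normc_ge0 (q (seg a b s) - q (seg a b t)).
rewrite mulrCA [e * _]mulrC ler_wpM2l //; lra.
Qed.

End SegmentIntegral.

Lemma normc_half {R : realType} : normc (2^-1 : R[i]) = 2^-1.
Proof. by rewrite normcV normc_nat. Qed.

Section Goursat.
Context {R : realType}.
Variables (D : R[i] -> Prop) (f : R[i] -> R[i]).
Hypothesis D_convex : forall a b (t : R), 0 <= t <= 1 -> D a -> D b -> D (seg a b t).
Hypothesis D_closed : forall (u : nat -> R[i]) l, (forall n, D (u n)) -> clim u l -> D l.
Hypothesis f_cdiff : forall z, D z -> exists d, cdiff f z d.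
Implicit Types (a b c : R[i]).

Lemma D_is_seg a b : D a -> D b -> is_seg f a b (seg_int f a b).
Proof.
move=> Da Db; have [v hv] : exists v, is_seg f a b v.
  apply: is_seg_exists => t t01; have [d hd] := f_cdiff (D_convex t01 Da Db).
  exact: cdiff_cont hd.
by rewrite (seg_intE hv).
Qed.

Definition triangle_int a b c := seg_int f a b + seg_int f b c + seg_int f c a.

Lemma D_mid a b : D a -> D b -> D (mid a b).
Proof.
move=> Da Db; have -> : mid a b = seg a b 2^-1.
  by rewrite /mid /seg fmorphV rmorph_nat; field.
by apply: D_convex => //; apply/andP; split; lra.
Qed.

Lemma seg_int_mid a b : D a -> D b ->
  seg_int f a b = seg_int f a (mid a b) + seg_int f (mid a b) b.
Proof.
move=> Da Db; have Dm := D_mid Da Db; apply: seg_intE; apply: is_seg_mid; try exact: D_is_seg.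
move=> t t01; have [d hd] := f_cdiff (D_convex t01 Da Db); exact: cdiff_cont hd.
Qed.

Lemma seg_int_rev a b : D a -> D b -> seg_int f b a = - seg_int f a b.
Proof. by move=> Da Db; apply: seg_intE; apply: is_seg_rev; exact: D_is_seg. Qed.

Let tri := ((R[i] * R[i]) * R[i])%type.
Let tint (x : tri) := triangle_int x.1.1 x.1.2 x.2.
Let inD (x : tri) := [/\ D x.1.1, D x.1.2 & D x.2].
Let size (x : tri) := normc (x.1.1 - x.1.2) + normc (x.1.2 - x.2) + normc (x.2 - x.1.1).

Let sub1 (x : tri) : tri := (x.1.1, mid x.1.1 x.1.2, mid x.2 x.1.1).
Let sub2 (x : tri) : tri := (mid x.1.1 x.1.2, x.1.2, mid x.1.2 x.2).
Let sub3 (x : tri) : tri := (mid x.2 x.1.1, mid x.1.2 x.2, x.2).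
Let sub4 (x : tri) : tri := (mid x.1.2 x.2, mid x.2 x.1.1, mid x.1.1 x.1.2).

Let next (x : tri) : tri :=
  if normc (tint x) <= 4 * normc (tint (sub1 x)) then sub1 x
  else if normc (tint x) <= 4 * normc (tint (sub2 x)) then sub2 x
  else if normc (tint x) <= 4 * normc (tint (sub3 x)) then sub3 x else sub4 x.

Let next_cases x : next x = sub1 x \/ next x = sub2 x \/ next x = sub3 x \/ next x = sub4 x.
Proof.
rewrite /next; case: ifP => _; first by left.
right; case: ifP => _; first by left.
by right; case: ifP => _; [left|right].
Qed.

Let inD_next x : inD x -> inD (next x).
Proof.
move: x => [[a b] c] [/= Da Db Dc].
have := D_mid Da Db; have := D_mid Db Dc; have := D_mid Dc Da => h1 h2 h3.
by case: (next_cases (a, b, c)) => [->|[->|[->|->]]].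
Qed.

Let tint_split x : inD x -> tint x = tint (sub1 x) + tint (sub2 x) + tint (sub3 x) + tint (sub4 x).
Proof.
move: x => [[a b] c] [/= Da Db Dc]; rewrite /tint /triangle_int /=.
have Dab := D_mid Da Db; have Dbc := D_mid Db Dc; have Dca := D_mid Dc Da.
rewrite (seg_int_mid Da Db) (seg_int_mid Db Dc) (seg_int_mid Dc Da).
rewrite (seg_int_rev Dab Dca) (seg_int_rev Dbc Dab) (seg_int_rev Dca Dbc); ring.
Qed.

Let tint_next x : inD x -> normc (tint x) <= 4 * normc (tint (next x)).
Proof.
move=> Dx; have := tint_split Dx; rewrite /next.
case: ifPn => // /negP/negP; rewrite -ltNge => h1.
case: ifPn => // /negP/negP; rewrite -ltNge => h2.
case: ifPn => // /negP/negP; rewrite -ltNge => h3 e.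
have := ler_normcD (tint (sub1 x) + tint (sub2 x) + tint (sub3 x)) (tint (sub4 x)).
have := ler_normcD (tint (sub1 x) + tint (sub2 x)) (tint (sub3 x)).
have := ler_normcD (tint (sub1 x)) (tint (sub2 x)).
rewrite -e; lra.
Qed.

Let size_next x : size (next x) = size x / 2.
Proof.
move: x => [[a b] c].
have h (z : R[i]) : normc (2^-1 * z) = normc z / 2 by rewrite normcM normc_half mulrC.
rewrite /size; case: (next_cases (a, b, c)) => [->|[->|[->|->]]] /=.
- have -> : a - mid a b = 2^-1 * (a - b) by rewrite /mid; field.
  have -> : mid a b - mid c a = 2^-1 * (b - c) by rewrite /mid; field.
  have -> : mid c a - a = 2^-1 * (c - a) by rewrite /mid; field.
  by rewrite !h; ring.
- have -> : mid a b - b = 2^-1 * (a - b) by rewrite /mid; field.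
  have -> : b - mid b c = 2^-1 * (b - c) by rewrite /mid; field.
  have -> : mid b c - mid a b = 2^-1 * (c - a) by rewrite /mid; field.
  by rewrite !h; ring.
- have -> : mid c a - mid b c = 2^-1 * (a - b) by rewrite /mid; field.
  have -> : mid b c - c = 2^-1 * (b - c) by rewrite /mid; field.
  have -> : c - mid c a = 2^-1 * (c - a) by rewrite /mid; field.
  by rewrite !h; ring.
- have -> : mid b c - mid c a = 2^-1 * (b - a) by rewrite /mid; field.
  have -> : mid c a - mid a b = 2^-1 * (c - b) by rewrite /mid; field.
  have -> : mid a b - mid b c = 2^-1 * (a - c) by rewrite /mid; field.
  by rewrite !h (normcB b) (normcB c b) (normcB a c); ring.
Qed.

Lemma goursat a b c : D a -> D b -> D c -> triangle_int a b c = 0.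
Proof.
move=> Da Db Dc; pose x n := iter n next (a, b, c).
have xD n : inD (x n) by elim: n => [|n ih] //=; exact: inD_next.
pose d0 := size (a, b, c).
have d00 : 0 <= d0 by rewrite !addr_ge0 ?normc_ge0.
have xs n : size (x n) = d0 / 2 ^+ n.
  elim: n => [|n ih]; first by rewrite expr0 divr1.
  by rewrite /x iterS size_next -/(x n) ih exprSr invfM mulrA.
have xt n : normc (triangle_int a b c) <= 4 ^+ n * normc (tint (x n)).
  elim: n => [|n ih]; first by rewrite expr0 mul1r.
  apply: le_trans ih _; rewrite exprSr -mulrA ler_wpM2l ?exprn_ge0 //.
  exact: tint_next.
pose u n := (x n).1.1.
have side n : normc ((x n).1.1 - (x n).1.2) <= d0 / 2 ^+ n /\
   normc ((x n).1.2 - (x n).2) <= d0 / 2 ^+ n /\ normc ((x n).2 - (x n).1.1) <= d0 / 2 ^+ n.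
  rewrite -xs /size.
  have := normc_ge0 ((x n).1.1 - (x n).1.2); have := normc_ge0 ((x n).1.2 - (x n).2).
  have := normc_ge0 ((x n).2 - (x n).1.1); move=> h1 h2 h3; split; [|split]; lra.
have step n : normc (u n.+1 - u n) <= d0 / 2 ^+ n.
  have [s1 [s2 s3]] := side n.
  have -> : u n.+1 = (next (x n)).1.1 by [].
  have h (z : R[i]) : normc (2^-1 * z) <= normc z.
    rewrite normcM normc_half; have := normc_ge0 z; lra.
  rewrite /u; case: (next_cases (x n)) => [->|[->|[->|->]]] /=.
  - rewrite subrr normc0E; exact: le_trans (normc_ge0 _) s1.
  - have -> : mid (x n).1.1 (x n).1.2 - (x n).1.1 = - (2^-1 * ((x n).1.1 - (x n).1.2)).
      by rewrite /mid; field.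
    by rewrite normcNE; apply: le_trans (h _) s1.
  - have -> : mid (x n).2 (x n).1.1 - (x n).1.1 = 2^-1 * ((x n).2 - (x n).1.1).
      by rewrite /mid; field.
    by apply: le_trans (h _) s3.
  - have -> : mid (x n).1.2 (x n).2 - (x n).1.1 = 
       2^-1 * ((x n).2 - (x n).1.1) - 2^-1 * ((x n).1.1 - (x n).1.2) by rewrite /mid; field.
    apply: le_trans (ler_normcB _ _) _; rewrite !normcM normc_half; lra.
have e2 n : d0 / 2 ^+ n = 2 * (d0 / 2 ^+ n.+1) by rewrite exprS; field; rewrite expf_neq0.
have dn0 n : 0 <= d0 / 2 ^+ n by rewrite divr_ge0 // exprn_ge0.
have dist n k : normc (u (n + k)%N - u n) <= 2 * (d0 / 2 ^+ n) - 2 * (d0 / 2 ^+ (n + k)).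
  elim: k => [|k ih]; first by rewrite addn0 !subrr normc0E.
  have := ler_normcD (u (n + k).+1 - u (n + k)%N) (u (n + k)%N - u n).
  rewrite addrA subrK addnS; have := step (n + k)%N; have := e2 (n + k)%N; lra.
have small (e : R) : 0 < e -> exists n, 2 * (d0 / 2 ^+ n) < e.
  move=> e0; pose n := (Num.truncn (2 * d0 / e)).+1; exists n.
  have hn : 2 * d0 / e < n%:R by rewrite /n truncnS_gt.
  have n2 : (n%:R : R) < 2 ^+ n by rewrite -natrX ltr_nat ltn_expl.
  have p0 : 0 < 2 ^+ n :> R by rewrite exprn_gt0.
  rewrite mulrA ltr_pdivrMr // [ltRHS]mulrC -ltr_pdivrMr //; exact: lt_trans hn n2.
have [p up] : exists p, clim u p.
  apply: cauchy_clim => e /small [n hn]; exists n => m nm.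
  rewrite -(subnKC nm); apply: le_lt_trans (dist _ _) _.
  have := dn0 (n + (m - n))%N; lra.
have Dp : D p by apply: D_closed up => n; have [] := xD n.
have pn n : normc (p - u n) <= 2 * (d0 / 2 ^+ n).
  have h : clim (fun k => u (n + k)%N - u n) (p - u n).
    apply: climD; last exact: clim_cst.
    by move=> e /up [N hN]; exists N => k hk; apply: hN; rewrite (leq_trans hk) // leq_addl.
  apply: clim_normc_le h => k; apply: le_trans (dist n k) _.
  have := dn0 (n + k)%N; lra.
have [d [q [hq qp qc]]] := f_cdiff Dp.
apply/eqP; rewrite -normc_eq0 eq_le normc_ge0 andbT; apply/ler_addgt0Pr => e e0; rewrite add0r.
have [|r r0 hr] := qc (e / (24 * d0 ^+ 2 + 1)); first by rewrite divr_gt0 // ltr_wpDl // mulr_ge0 // sqr_ge0.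
have [|n hn] := small (r / 2); first by rewrite divr_gt0.
pose rem z := (q z - d) * (z - p).
pose aff z := f p + d * (z - p).
have fE z : f z = aff z + rem z.
  by rewrite /aff /rem -{1}(subrK (f p) (f z)) hq; ring.
pose prim z := (f p - d * p) * z + d / 2 * (z * z).
have affP y z : is_seg aff y z (prim z - prim y).
  apply: is_seg_primitive => t _; set w := seg _ _ _.
  have -> : aff w = (f p - d * p) * 1 + d / 2 * (1 * w + w * 1).
    by rewrite /aff; field.
  apply: cdiffD; apply: cdiffZ; first exact: cdiff_id.
  by apply: cdiffM; exact: cdiff_id.
have [Dxa Dxb Dxc] := xD n; have [s1 [s2 s3]] := side n.
set xa := (x n).1.1 in Dxa s1 s3; set xb := (x n).1.2 in Dxb s1 s2; set xc := (x n).2 in Dxc s2 s3.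
pose E := d0 / 2 ^+ n.
have E0 : 0 <= E by exact: dn0.
have pa : normc (p - xa) <= 2 * E by exact: pn.
have remS y z : D y -> D z -> normc (y - xa) <= E -> normc (z - y) <= E ->
    exists2 v, is_seg rem y z v & normc v <= 2 * ((e / (24 * d0 ^+ 2 + 1)) * (4 * E) * E).
  move=> Dy Dz hy hz.
  have hv : is_seg rem y z (seg_int f y z + -1 * (prim z - prim y)).
    apply: eq_is_seg (is_segD (D_is_seg Dy Dz) (is_segZ (-1) (affP y z))) => t _.
    by rewrite [f (seg y z t)]fE; ring.
  exists (seg_int f y z + -1 * (prim z - prim y)) => //.
  have e0' : 0 < e / (24 * d0 ^+ 2 + 1) by rewrite divr_gt0 // ltr_wpDl // mulr_ge0 // sqr_ge0.
  set e' := e / _ in e0' hr *.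
  apply: le_trans (is_seg_sup (M := e' * (4 * E)) hv _) _; last first.
    by rewrite ler_wpM2l // ler_wpM2l // mulr_ge0 ?(ltW e0') ?mulr_ge0.
  move=> t /andP[t0 t1]; set w := seg y z t.
  have wy : normc (w - y) <= E.
    rewrite /w /seg addrAC subrr add0r normcM normc_real ger0_norm //.
    by apply: le_trans hz; rewrite ler_piMl ?normc_ge0.
  have wp : normc (w - p) <= 4 * E.
    have := ler_normcD (w - y) (y - p); rewrite addrA subrK.
    have := ler_normcD (y - xa) (xa - p); rewrite addrA subrK (normcB xa p); lra.
  rewrite normcM ler_pM ?normc_ge0 //; apply: ltW; rewrite -qp; apply: hr.
  apply: le_lt_trans wp _; rewrite -/E in hn; lra.
have h0 : normc (xa - xa) <= E by rewrite subrr normc0E.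
have [v1 hv1 b1] := remS _ _ Dxa Dxb h0 (eq_ind_r (fun z => z <= E) s1 (normcB xb xa)).
have [v2 hv2 b2] := remS _ _ Dxb Dxc (eq_ind_r (fun z => z <= E) s1 (normcB xb xa))
  (eq_ind_r (fun z => z <= E) s2 (normcB xc xb)).
have [v3 hv3 b3] := remS _ _ Dxc Dxa s3 (eq_ind_r (fun z => z <= E) s3 (normcB xa xc)).
have sE y z v : is_seg rem y z v -> seg_int f y z = (prim z - prim y) + v.
  move=> hv; apply: seg_intE; apply: eq_is_seg (is_segD (affP y z) hv) => t _.
  by rewrite -fE.
have tE : tint (x n) = v1 + v2 + v3.
  by rewrite /tint /triangle_int -/xa -/xb -/xc (sE _ _ _ hv1) (sE _ _ _ hv2) (sE _ _ _ hv3); ring.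
have p0 : 0 < 2 ^+ n :> R by rewrite exprn_gt0.
have E4 : 4 ^+ n * E ^+ 2 = d0 ^+ 2.
  have -> : 4 ^+ n = (2 ^+ n) ^+ 2 :> R by rewrite -exprM mulnC exprM; congr (_ ^+ _); ring.
  by rewrite -exprMn /E mulrC divfK // gt_eqF.
have T : normc (tint (x n)) <= 24 * (e / (24 * d0 ^+ 2 + 1)) * E ^+ 2.
  rewrite tE; have := ler_normcD (v1 + v2) v3; have := ler_normcD v1 v2; lra.
apply: le_trans (xt n) _.
apply: le_trans (ler_wpM2l (exprn_ge0 n _) T) _ => //.
have -> : 4 ^+ n * (24 * (e / (24 * d0 ^+ 2 + 1)) * E ^+ 2) =
   e * (24 * d0 ^+ 2 / (24 * d0 ^+ 2 + 1)) by rewrite -E4; ring.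
rewrite ler_piMr ?(ltW e0) // ler_pdivrMr ?ltr_wpDl // ?mulr_ge0 ?sqr_ge0 //; lra.
Qed.

End Goursat.

(** * Coefficients as contour integrals *)

Section HalfPlane.
Context {R : realType}.
Implicit Types (a b z : R[i]) (p q M t : R).

Definition half_plane p q M z := p * complex.Re z + q * complex.Im z <= M.

Lemma half_plane_convex p q M a b t : 0 <= t <= 1 ->
  half_plane p q M a -> half_plane p q M b -> half_plane p q M (seg a b t).
Proof.
move=> /andP[t0 t1]; rewrite /half_plane /seg ReD ImD ReM ImM ReD ImD ReN ImN /= => ha hb.
have h1 : (1 - t) * (p * complex.Re a + q * complex.Im a) <= (1 - t) * M by rewrite ler_wpM2l //; lra.
have h2 : t * (p * complex.Re b + q * complex.Im b) <= t * M by rewrite ler_wpM2l.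
lra.
Qed.

Lemma half_plane_closed p q M (u : nat -> R[i]) l :
  (forall n, half_plane p q M (u n)) -> clim u l -> half_plane p q M l.
Proof.
move=> h hl; rewrite /half_plane; apply/ler_addgt0Pr => e e0.
pose K := `|p| + `|q| + 1.
have K0 : 0 < K by rewrite ltr_wpDl // addr_ge0.
have [|N hN] := hl (e / K); first by rewrite divr_gt0.
have {hN} hN := hN N (leqnn N); have := h N; rewrite /half_plane.
have h1 := le_lt_trans (ler_normRe _) hN; have h2 := le_lt_trans (ler_normIm _) hN.
rewrite ReD ReN in h1; rewrite ImD ImN in h2; rewrite distrC in h1; rewrite distrC in h2.
have k1 : p * (complex.Re l - complex.Re (u N)) <= `|p| * (e / K).
  by apply: le_trans (ler_norm _) _; rewrite normrM ler_wpM2l // ltW.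
have k2 : q * (complex.Im l - complex.Im (u N)) <= `|q| * (e / K).
  by apply: le_trans (ler_norm _) _; rewrite normrM ler_wpM2l // ltW.
have : (`|p| + `|q|) * (e / K) <= e.
  rewrite mulrCA ler_piMr ?(ltW e0) // ler_pdivrMr // mul1r /K; lra.
lra.
Qed.

End HalfPlane.

Section Contour.
Context {R : realType}.
Variables (g : R[i] -> R[i]) (c : nat -> R[i]) (eps kap : R).
Hypotheses (eps0 : 0 < eps) (kap0 : 0 < kap) (kap_eps : 2 * kap * eps <= pi).
Hypothesis g_cdiff : forall w : R[i], complex.Re w <= eps -> `|complex.Im w| <= pi ->
  kap * complex.Re w < `|complex.Im w| -> exists d, cdiff g (cexp w) d.
Hypothesis g_sum : is_sum_near0 c g.

Let f (n : nat) (w : R[i]) : R[i] := g (cexp w) * cexp (- n%:R * w).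

(* In the coordinate [w = log t] the slit disc is a strip without the sector
   [|Im w| <= kap * Re w]; [s = 1] and [s = -1] select its upper and lower
   halves, which are convex. *)
Let region (s eta : R) (w : R[i]) :=
  [/\ half_plane 1 0 eps w, half_plane 0 (- s) 0 w, half_plane 0 s pi w &
      half_plane kap (- s) (- eta) w].

Let region_convex s eta a b t : 0 <= t <= 1 -> region s eta a -> region s eta b ->
  region s eta (seg a b t).
Proof. by move=> t01 [? ? ? ?] [? ? ? ?]; split; exact: half_plane_convex. Qed.

Let region_closed s eta (u : nat -> R[i]) l : (forall n, region s eta (u n)) -> clim u l ->
  region s eta l.
Proof.
move=> h hl.
by split; apply: (half_plane_closed _ hl) => n; have [] := h n.
Qed.

Let f_cdiff s eta n w : s = 1 \/ s = -1 -> 0 < eta -> region s eta w -> exists d, cdiff (f n) w d.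
Proof.
move=> hs eta0 [] ; rewrite /half_plane => h1 h2 h3 h4.
have e : s * complex.Im w = `|complex.Im w|.
  have h : 0 <= s * complex.Im w by lra.
  by rewrite -(ger0_norm h) normrM; case: hs => ->; rewrite ?normrN normr1 mul1r.
have [|||d hd] := g_cdiff (w := w); [lra|rewrite -e; lra|rewrite -e; lra|].
have d1 := cdiff_comp (cdiff_cexp w) hd.
have d2 := cdiff_comp (cdiffZ (- n%:R) (cdiff_id w)) (cdiff_cexp (- n%:R * w)).
by eexists; apply: cdiffM d1 d2.
Qed.

Definition vertexA s : R[i] := eps +i* (s * pi).
Definition vertexB s : R[i] := eps +i* (s * (2 * kap * eps)).
Definition vertexC s n : R[i] := n%:R^-1 +i* (s * (2 * kap * n%:R^-1)).
Definition vertexD n : R[i] := (- n%:R^-1)%:C.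
Let vertexQ (X s : R) : R[i] := (- X) +i* (s * pi).

Definition branch s n : R[i] := seg_int (f n) (vertexA s) (vertexB s) +
  seg_int (f n) (vertexB s) (vertexC s n) + seg_int (f n) (vertexC s n) (vertexD n).

Let region_vertices s n X : s = 1 \/ s = -1 -> (0 < n)%N -> n%:R^-1 <= eps -> n%:R^-1 <= X ->
  let D := region s (kap * n%:R^-1) in
  [/\ D (vertexA s), D (vertexB s), D (vertexC s n), D (vertexD n) &
      D (vertexQ X 0) /\ D (vertexQ X s)].
Proof.
move=> hs n0 ne nX D.
have ss : s * s = 1 by case: hs => ->; rewrite ?mulrNN mulr1.
have u0 : 0 < n%:R^-1 :> R by rewrite invr_gt0 ltr0n.
have p0 := pi_gt0 R.
have k1 : kap * n%:R^-1 <= kap * eps by rewrite ler_wpM2l // ltW.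
have k2 : kap * n%:R^-1 <= kap * X by rewrite ler_wpM2l // ltW.
have k3 : 0 < kap * n%:R^-1 by rewrite mulr_gt0.
have k4 : 0 < kap * eps by rewrite mulr_gt0.
have ke : 2 * (kap * eps) <= pi by rewrite mulrA.
have sE x : s * (s * x) = x by rewrite mulrA ss mul1r.
rewrite /D /region /half_plane /=; split; [..|split]; split => /=;
  rewrite ?mulNr ?sE ?mul0r ?mulr0; lra.
Qed.

Let f_region_seg s n a b : s = 1 \/ s = -1 -> (0 < n)%N -> let D := region s (kap * n%:R^-1) in
  D a -> D b -> is_seg (f n) a b (seg_int (f n) a b).
Proof.
move=> hs n0 D; apply: D_is_seg; first exact: region_convex.
move=> z; apply: f_cdiff => //; by rewrite mulr_gt0 // invr_gt0 ltr0n.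
Qed.

Lemma branch_segs s n : s = 1 \/ s = -1 -> (0 < n)%N -> n%:R^-1 <= eps ->
  [/\ is_seg (f n) (vertexA s) (vertexB s) (seg_int (f n) (vertexA s) (vertexB s)),
      is_seg (f n) (vertexB s) (vertexC s n) (seg_int (f n) (vertexB s) (vertexC s n)) &
      is_seg (f n) (vertexC s n) (vertexD n) (seg_int (f n) (vertexC s n) (vertexD n))].
Proof.
move=> hs n0 ne; have [hA hB hC hD _] := region_vertices hs n0 ne (lexx _).
by split; apply: f_region_seg hs n0 _ _.
Qed.

Let polygon s n X : s = 1 \/ s = -1 -> (0 < n)%N -> n%:R^-1 <= eps -> n%:R^-1 <= X ->
  seg_int (f n) (vertexQ X 0) (vertexQ X s) + seg_int (f n) (vertexQ X s) (vertexA s) +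
  branch s n + seg_int (f n) (vertexD n) (vertexQ X 0) = 0.
Proof.
move=> hs n0 ne nX; have [hA hB hC hD [hQ hQ1]] := region_vertices hs n0 ne nX.
have e0 : 0 < kap * n%:R^-1 by rewrite mulr_gt0 // invr_gt0 ltr0n.
have fd z : region s (kap * n%:R^-1) z -> exists d, cdiff (f n) z d by apply: f_cdiff.
have G := goursat (@region_convex s (kap * n%:R^-1)) (@region_closed s (kap * n%:R^-1)) fd.
have rv := seg_int_rev (@region_convex s (kap * n%:R^-1)) fd.
have := G _ _ _ hQ hQ1 hA; have := G _ _ _ hQ hA hB.
have := G _ _ _ hQ hB hC; have := G _ _ _ hQ hC hD.
rewrite /triangle_int (rv _ _ hQ hA) (rv _ _ hQ hB) (rv _ _ hQ hC) /branch.
move=> g1 g2 g3 g4; rewrite -[RHS]addr0 -{1}g1 -[X in _ = _ + X]addr0 -{1}g2.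
rewrite -[X in _ = _ + (_ + X)]addr0 -{1}g3 -g4; ring.
Qed.

Let cexp2pi (w : R[i]) : cexp (w - (0 +i* (2 * pi))) = cexp w.
Proof.
rewrite cexpB (_ : cexp (0 +i* (2 * pi)) = 1) ?divr1 // /cexp /= expR0 mul1r mulr_natl cos2pi sin2pi.
by [].
Qed.

Let cexpnM (k : nat) (z : R[i]) : cexp (k%:R * z) = cexp z ^+ k.
Proof. by rewrite mulrC cexpMn. Qed.

Let f_periodic n w : f n (w - (0 +i* (2 * pi))) = f n w.
Proof.
rewrite /f cexp2pi; congr (_ * _).
by rewrite !mulNr !cexpN !cexpnM cexp2pi.
Qed.

(* The horizontal sides of the two halves cancel by [2 pi i]-periodicity, and the
   vertical ones tend to [2 pi i * c n] as they move to [Re w = -oo]. *)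
Lemma contour_formula n : (0 < n)%N -> n%:R^-1 <= eps ->
  c n * (0 +i* (2 * pi)) = branch (-1) n - branch 1 n.
Proof.
move=> n0 ne.
have [d [M [d0 M0 hM]]] := is_sum_near0_remainder g_sum.
have p0 := pi_gt0 R.
have hs1 : (1 : R) = 1 \/ (1 : R) = -1 by left.
have hsN : (-1 : R) = 1 \/ (-1 : R) = -1 by right.
pose M' := M / d ^+ n.+1.
have M'0 : 0 <= M' by rewrite divr_ge0 // exprn_ge0 // ltW.
have key (X : R) : n%:R^-1 <= X -> expR (- X) <= d ->
    normc (c n * (0 +i* (2 * pi)) - (branch (-1) n - branch 1 n)) <= 4 * (M' * expR (- X) * pi).
  move=> nX Xd.
  have [hA hB hC hD [hQ hQ1]] := region_vertices hs1 n0 ne nX.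
  have [hA' hB' hC' hD' [hQ' hQ1']] := region_vertices hsN n0 ne nX.
  have p1 := polygon hs1 n0 ne nX; have p2 := polygon hsN n0 ne nX.
  have per : seg_int (f n) (vertexQ X 1) (vertexA 1) = seg_int (f n) (vertexQ X (-1)) (vertexA (-1)).
    apply: seg_intE.
    have := is_seg_shift (0 +i* (2 * pi)) (f_region_seg hsN n0 hQ1' hA').
    have -> : vertexQ X (-1) + (0 +i* (2 * pi)) = vertexQ X 1.
      by apply: complex_eqP => /=; ring.
    have -> : vertexA (-1) + (0 +i* (2 * pi)) = vertexA 1.
      by apply: complex_eqP => /=; ring.
    by apply: eq_is_seg => t _; rewrite f_periodic.
  have -> : branch (-1) n - branch 1 n = seg_int (f n) (vertexQ X 0) (vertexQ X 1) -
      seg_int (f n) (vertexQ X 0) (vertexQ X (-1)).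
    by rewrite -[LHS]addr0 -{1}p1 -[X in _ = X]addr0 -{1}p2 per; ring.
  pose P (w : R[i]) : R[i] := \sum_(k < n.+1) c k * cexp (k%:R * w) * cexp (- n%:R * w).
  pose Pr (w : R[i]) : R[i] := c n * w +
     \sum_(k < n) c k / (k%:R - n%:R) * cexp ((k%:R - n%:R) * w).
  have PE w : P w = c n + \sum_(k < n) c k * cexp ((k%:R - n%:R) * w).
    rewrite /P big_ord_recr /= -mulrA -cexpD -mulrDl subrr mul0r cexp0 mulr1 addrC; congr (_ + _).
    by apply: eq_bigr => k _; rewrite -mulrA -cexpD -mulrDl.
  have dP w : cdiff Pr w (P w).
    rewrite PE -[c n in X in cdiff _ _ X]mulr1; apply: cdiffD; first by apply: cdiffZ; exact: cdiff_id.
    have dk (k : 'I_n) : cdiff (fun w => c k / (k%:R - n%:R) * cexp ((k%:R - n%:R) * w)) w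
        (c k * cexp ((k%:R - n%:R) * w)).
      have kn : (k%:R - n%:R : R[i]) != 0.
        by rewrite subr_eq0 eqr_nat neq_ltn ltn_ord.
      move: kn; move: (k%:R - n%:R : R[i]) => x x0.
      have := cdiffZ (c k / x) (cdiff_comp (cdiffZ x (cdiff_id w)) (cdiff_cexp (x * w))).
      by have -> // : c k / x * (cexp (x * w) * (x * 1)) = c k * cexp (x * w) by field.
    elim: (index_enum _) => [|k l ih].
      rewrite big_nil; apply: (cdiff_near ltr01 _ (cdiff_cst 0 w)) => x _.
      by rewrite big_nil.
    rewrite big_cons; apply: (cdiff_near ltr01 _ (cdiffD (dk k) ih)) => x _.
    by rewrite big_cons.
  have segP a b : is_seg P a b (Pr b - Pr a) by apply: is_seg_primitive => t _; exact: dP.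
  have Prper : Pr (vertexQ X 1) - Pr (vertexQ X (-1)) = c n * (0 +i* (2 * pi)).
    have -> : vertexQ X (-1) = vertexQ X 1 - (0 +i* (2 * pi)) by apply: complex_eqP => /=; ring.
    rewrite /Pr; set w := vertexQ X 1.
    have -> : \sum_(k < n) c k / (k%:R - n%:R) * cexp ((k%:R - n%:R) * (w - (0 +i* (2 * pi)))) =
              \sum_(k < n) c k / (k%:R - n%:R) * cexp ((k%:R - n%:R) * w).
      apply: eq_bigr => k _; congr (_ * _).
      by rewrite !mulrBl !cexpB !cexpnM !cexp2pi.
    ring.
  have rem s : s = 1 \/ s = -1 -> normc (seg_int (f n) (vertexQ X 0) (vertexQ X s) -
       (Pr (vertexQ X s) - Pr (vertexQ X 0))) <= 2 * (M' * expR (- X) * pi).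
    move=> hs; have [_ _ _ _ [q0 q1]] := region_vertices hs n0 ne nX.
    have hr := is_segD (f_region_seg hs n0 q0 q1) (is_segZ (-1) (segP (vertexQ X 0) (vertexQ X s))).
    have npi : normc (vertexQ X s - vertexQ X 0) = pi.
      have -> : vertexQ X s - vertexQ X 0 = 0 +i* (s * pi) by apply: complex_eqP => /=; ring.
      rewrite /= expr0n add0r sqrtr_sqr normrM (gtr0_norm p0).
      by case: hs => ->; rewrite ?normrN normr1 mul1r.
    rewrite -npi -[X in normc (_ + X)]mulN1r.
    apply: is_seg_sup hr _ => t _; set w := seg _ _ _.
    have wX : complex.Re w = - X.
      by rewrite /w /seg ReD ReM ReD ReN ImD ImN /=; ring.
    have nw : normc (cexp w) = expR (- X) by rewrite normc_cexp wX.
    have -> : f n w + -1 * P w =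
        (g (cexp w) - \sum_(k < n.+1) c k * cexp w ^+ k) * cexp (- n%:R * w).
      rewrite /f /P mulrBl mulr_suml mulN1r; congr (_ - _); apply: eq_bigr => k _.
      by rewrite -cexpnM.
    rewrite normcM; have := hM (cexp w) n.+1; rewrite nw => /(_ Xd) k.
    have -> : normc (cexp (- n%:R * w)) = expR (n%:R * X).
      have nC : (- n%:R : R[i]) = (- n%:R)%:C by rewrite rmorphN rmorph_nat.
      by rewrite normc_cexp nC ReM wX /=; congr expR; ring.
    apply: le_trans (ler_wpM2r (expR_ge0 _) k) _.
    have -> : M * (expR (- X) / d) ^+ n.+1 = M' * expR (- X) ^+ n.+1.
      by rewrite /M' exprMn exprVn; ring.
    by rewrite -mulrA -expRM_natl -expRD -natr1 mulrDl mul1r mulrN addrAC addNr add0r.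
  have := rem 1 hs1; have := rem (-1) hsN; rewrite -Prper.
  set u := seg_int _ _ _; set v := seg_int _ _ _; set a := Pr (vertexQ X 1).
  set b := Pr (vertexQ X (-1)); set q := Pr _ => h1 h2.
  have -> : a - b - (v - u) = (u - (b - q)) - (v - (a - q)) by ring.
  apply: le_trans (ler_normcB _ _) _; lra.
apply/eqP; rewrite -subr_eq0 -normc_eq0 eq_le normc_ge0 andbT.
apply/ler_addgt0Pr => e e0; rewrite add0r.
pose K := 4 * (M' * pi) + 1.
have K0 : 0 < K by rewrite ltr_wpDl // mulr_ge0 // mulr_ge0 // ltW.
pose X := Num.max n%:R^-1 (Num.max (- ln d) (- ln (e / K))).
have X1 : n%:R^-1 <= X by rewrite /X le_max lexx.
have X2 : - ln d <= X by rewrite /X !le_max lexx orbT.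
have X3 : - ln (e / K) <= X by rewrite /X !le_max lexx !orbT.
have eK : 0 < e / K by rewrite divr_gt0.
have E1 : expR (- X) <= d by rewrite -[leRHS]lnK ?posrE // ler_expR; lra.
have E2 : expR (- X) <= e / K by rewrite -[leRHS]lnK ?posrE // ler_expR; lra.
apply: le_trans (key X X1 E1) _.
have : 4 * (M' * pi) * expR (- X) <= 4 * (M' * pi) * (e / K).
  by rewrite ler_wpM2l // mulr_ge0 // mulr_ge0 // ltW.
have : K * (e / K) = e by rewrite mulrC divfK // gt_eqF.
rewrite /K in eK *; lra.
Qed.

End Contour.

Section ContourEstimate.
Context {R : realType}.
Variables (g : R[i] -> R[i]) (c : nat -> R[i]) (eps kap : R) (n : nat) (M C : R).
Hypotheses (eps0 : 0 < eps) (kap0 : 0 < kap) (kap_eps : 2 * kap * eps <= pi).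
Hypothesis g_cdiff : forall w : R[i], complex.Re w <= eps -> `|complex.Im w| <= pi ->
  kap * complex.Re w < `|complex.Im w| -> exists d, cdiff g (cexp w) d.
Hypothesis g_sum : is_sum_near0 c g.
Hypotheses (n0 : (0 < n)%N) (ne : n%:R^-1 <= eps) (M0 : 0 <= M) (C0 : 0 <= C).
Hypothesis g_far : forall s t : R, s = 1 \/ s = -1 -> 0 <= t <= 1 ->
  normc (g (cexp (seg (vertexA eps s) (vertexB eps kap s) t))) <= M.
Hypothesis g_near : forall w, complex.Re w <= eps -> `|complex.Im w| <= pi ->
  kap * complex.Re w - `|complex.Im w| <= - (kap * n%:R^-1) ->
  normc w <= (1 + 2 * kap) * eps ->
  normc (g (cexp w)) <= C * expR ((2 * (1 + 2 * kap))^-1 * (n%:R * normc w)).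

Let f (w : R[i]) : R[i] := g (cexp w) * cexp (- n%:R * w).
Let k1 : 0 < 1 + 2 * kap. Proof. by rewrite addr_gt0 // mulr_gt0. Qed.

Let sign_norm (s x : R) : s = 1 \/ s = -1 -> 0 <= x -> `|s * x| = x.
Proof. by move=> hs x0; rewrite normrM (ger0_norm x0); case: hs => ->; rewrite ?normrN normr1 mul1r. Qed.

Let norm_exp (w : R[i]) : normc (cexp (- n%:R * w)) = expR (- (n%:R * complex.Re w)).
Proof.
have e : (- n%:R : R[i]) = (- n%:R)%:C by rewrite rmorphN rmorph_nat.
by rewrite normc_cexp e ReM /= mul0r subr0 mulNr.
Qed.

Let near_f (w : R[i]) (y : R) : complex.Re w <= eps -> `|complex.Im w| <= pi ->
  kap * complex.Re w - `|complex.Im w| <= - (kap * n%:R^-1) ->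
  normc w <= (1 + 2 * kap) * y -> y <= eps ->
  normc (f w) <= C * expR (n%:R / 2 * y - n%:R * complex.Re w).
Proof.
have nR : 0 < n%:R :> R by rewrite ltr0n.
have u0 : 0 < n%:R^-1 :> R by rewrite invr_gt0.
move=> h1 h2 h3 h4 y1.
have h5 : normc w <= (1 + 2 * kap) * eps.
  by apply: le_trans h4 _; rewrite ler_wpM2l // ltW.
rewrite normcM norm_exp expRD mulrA ler_wpM2r ?expR_ge0 //.
apply: le_trans (g_near h1 h2 h3 h5) _; rewrite ler_wpM2l // ler_expR.
have -> : n%:R / 2 * y = (2 * (1 + 2 * kap))^-1 * (n%:R * ((1 + 2 * kap) * y)).
  by field; rewrite gt_eqF.
by rewrite ler_wpM2l ?invr_ge0 ?mulr_ge0 ?(ltW k1) // ler_wpM2l // ltW.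
Qed.

Let seg_far (s : R) v : s = 1 \/ s = -1 -> is_seg f (vertexA eps s) (vertexB eps kap s) v ->
  normc v <= 2 * (M * expR (- (n%:R * eps)) * pi).
Proof.
have nR : 0 < n%:R :> R by rewrite ltr0n.
have u0 : 0 < n%:R^-1 :> R by rewrite invr_gt0.
move=> hs hv; have pi0 := pi_gt0 R.
have ke0 : 0 < 2 * kap * eps by rewrite !mulr_gt0.
have nBA : normc (vertexB eps kap s - vertexA eps s) <= pi.
  have -> : vertexB eps kap s - vertexA eps s = 0 +i* (s * - (pi - 2 * kap * eps)).
    by rewrite /vertexA /vertexB; apply: complex_eqP => /=; ring.
  have h : 0 <= pi - 2 * kap * eps by rewrite subr_ge0.
  by rewrite /= expr0n add0r sqrtr_sqr mulrN normrN sign_norm //; lra.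
apply: le_trans (is_seg_sup (M := M * expR (- (n%:R * eps))) hv _) _.
  move=> t t01; rewrite normcM ler_pM ?normc_ge0 ?g_far // norm_exp.
  have -> // : complex.Re (seg (vertexA eps s) (vertexB eps kap s) t) = eps.
  by rewrite /seg /vertexA /vertexB /=; ring.
by rewrite ler_wpM2l // ler_wpM2l // mulr_ge0 ?expR_ge0.
Qed.

Let seg_slanted (s : R) v : s = 1 \/ s = -1 -> is_seg f (vertexB eps kap s) (vertexC kap s n) v ->
  normc v <= 4 * (1 + 2 * kap) * C * n%:R^-1.
Proof.
have nR : 0 < n%:R :> R by rewrite ltr0n.
have u0 : 0 < n%:R^-1 :> R by rewrite invr_gt0.
move=> hs hv.
have ke : 2 * (kap * eps) <= pi by rewrite mulrA.
pose d : R := n%:R^-1 - eps; pose u (t : R) : R := eps + t * d.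
pose q (t : R) : R := C * (1 + 2 * kap) * (2 * n%:R^-1) * expR (- (n%:R / 2) * u t).
have wE t : seg (vertexB eps kap s) (vertexC kap s n) t = (u t) +i* (s * (2 * kap * u t)).
  by rewrite /seg /vertexB /vertexC /u /d; apply: complex_eqP => /=; ring.
have dq (t : R) : is_derive t (1 : R) q (C * (1 + 2 * kap) * (2 * n%:R^-1) *
    (expR (- (n%:R / 2) * eps + t * (- (n%:R / 2) * d)) * (- (n%:R / 2) * d))).
  have <- : (fun t : R => C * (1 + 2 * kap) * (2 * n%:R^-1) *
      expR (- (n%:R / 2) * eps + t * (- (n%:R / 2) * d))) = q.
    by apply/funext => x; rewrite /q /u; congr (_ * expR _); ring.
  exact: is_derive_scaled_expR.
have q_ge0 t : 0 <= q t by rewrite /q !mulr_ge0 ?expR_ge0 ?(ltW k1) ?(ltW u0).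
have q1 : q 1 <= C * (1 + 2 * kap) * (2 * n%:R^-1).
  rewrite /q ler_piMr ?mulr_ge0 ?(ltW k1) ?(ltW u0) // expR_le1.
  have : 0 <= n%:R * u 1 by rewrite mulr_ge0 ?(ltW nR) // /u /d; lra.
  by rewrite mulNr; lra.
apply: le_trans (is_seg_bound hv (fun t _ => dq t) _) _; last first.
  have -> : 4 * (1 + 2 * kap) * C * n%:R^-1 = 2 * (C * (1 + 2 * kap) * (2 * n%:R^-1)) by ring.
  by rewrite ler_wpM2l //; have := q_ge0 0; lra.
move=> t /andP[t0 t1]; rewrite wE.
have [ut1 ut2] : n%:R^-1 <= u t /\ u t <= eps.
  have h1 : 0 <= (1 - t) * (eps - n%:R^-1) by rewrite mulr_ge0 ?subr_ge0.
  have h2 : 0 <= t * (eps - n%:R^-1) by rewrite mulr_ge0 ?subr_ge0.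
  by rewrite /u /d; split; lra.
have ut0 : 0 < u t by exact: lt_le_trans ut1.
have kut : 0 <= 2 * kap * u t by rewrite !mulr_ge0 ?(ltW kap0) // ltW.
have kue : kap * u t <= kap * eps by rewrite ler_wpM2l // ltW.
have kun : kap * n%:R^-1 <= kap * u t by rewrite ler_wpM2l // ltW.
have iE := sign_norm hs kut.
have kk : 0 <= 2 * kap * (eps - n%:R^-1) by rewrite mulr_ge0 ?subr_ge0 // mulr_ge0 // ltW.
have eB : normc (vertexC kap s n - vertexB eps kap s) <= (1 + 2 * kap) * (eps - n%:R^-1).
  have -> : vertexC kap s n - vertexB eps kap s = d +i* (s * - (2 * kap * (eps - n%:R^-1))).
    by rewrite /vertexB /vertexC /d; apply: complex_eqP => /=; ring.
  apply: le_trans (ler_normc_ReIm _) _ => /=; rewrite mulrN normrN (sign_norm hs kk).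
  by rewrite /d distrC ger0_norm ?subr_ge0 //; lra.
have bnd : normc (f ((u t) +i* (s * (2 * kap * u t)))) <= C * expR (- (n%:R / 2) * u t).
  have -> : - (n%:R / 2) * u t = n%:R / 2 * u t - n%:R * complex.Re ((u t) +i* (s * (2 * kap * u t)) : R[i]).
    by rewrite /=; lra.
  have nw : normc ((u t) +i* (s * (2 * kap * u t)) : R[i]) <= (1 + 2 * kap) * u t.
    by apply: le_trans (ler_normc_ReIm _) _ => /=; rewrite iE ger0_norm ?(ltW ut0) //; lra.
  by apply: (near_f _ _ _ nw ut2); rewrite /= ?iE //; lra.
apply: le_trans (ler_pM (normc_ge0 _) (normc_ge0 _) bnd eB) _.
rewrite (_ : - (n%:R / 2) * eps + t * (- (n%:R / 2) * d) = - (n%:R / 2) * u t); last by rewrite /u; ring.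
rewrite le_eqVlt; apply/orP; left; apply/eqP; rewrite /d.
by field; rewrite gt_eqF.
Qed.

Let seg_close (s : R) v : s = 1 \/ s = -1 -> is_seg f (vertexC kap s n) (vertexD n) v ->
  normc v <= 2 * expR (3 / 2) * (2 + 2 * kap) * C * n%:R^-1.
Proof.
have nR : 0 < n%:R :> R by rewrite ltr0n.
have u0 : 0 < n%:R^-1 :> R by rewrite invr_gt0.
move=> hs hv.
have ke : 2 * (kap * eps) <= pi by rewrite mulrA.
have kn0 : 0 < kap * n%:R^-1 by rewrite mulr_gt0.
have kne : kap * n%:R^-1 <= kap * eps by rewrite ler_wpM2l // ltW.
have wE t : seg (vertexC kap s n) (vertexD n) t =
   ((1 - 2 * t) * n%:R^-1) +i* (s * (2 * kap * n%:R^-1 * (1 - t))).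
  by rewrite /seg /vertexD /vertexC; apply: complex_eqP => /=; ring.
have eD : normc (vertexD n - vertexC kap s n) <= (2 + 2 * kap) * n%:R^-1.
  have -> : vertexD n - vertexC kap s n = (- (2 * n%:R^-1)) +i* (s * - (2 * (kap * n%:R^-1))).
    by rewrite /vertexD /vertexC; apply: complex_eqP => /=; ring.
  have kk : 0 <= 2 * (kap * n%:R^-1) by lra.
  by apply: le_trans (ler_normc_ReIm _) _ => /=; rewrite mulrN !normrN (sign_norm hs kk) ger0_norm; lra.
apply: le_trans (is_seg_sup (M := C * expR (3 / 2)) hv _) _; last first.
  have -> : 2 * expR (3 / 2) * (2 + 2 * kap) * C * n%:R^-1 =
    2 * (C * expR (3 / 2) * ((2 + 2 * kap) * n%:R^-1)) by ring.
  by rewrite ler_wpM2l // ler_wpM2l // mulr_ge0 ?expR_ge0.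
move=> t /andP[t0 t1]; rewrite wE.
set x := (1 - 2 * t) * n%:R^-1; set y := 2 * kap * n%:R^-1 * (1 - t).
have [tn1 tn0] : t * n%:R^-1 <= n%:R^-1 /\ 0 <= t * n%:R^-1.
  by rewrite ler_piMl ?mulr_ge0 ?(ltW u0).
have [x1 x2] : x <= n%:R^-1 /\ - n%:R^-1 <= x by rewrite /x; split; lra.
have [y0 y1] : 0 <= y /\ y <= 2 * (kap * n%:R^-1).
  have : t * (kap * n%:R^-1) <= kap * n%:R^-1 by rewrite ler_piMl // ltW.
  have : 0 <= t * (kap * n%:R^-1) by rewrite mulr_ge0 // ltW.
  by rewrite /y; split; lra.
have xy : kap * x - y = - (kap * n%:R^-1) by rewrite /x /y; ring.
have iE := sign_norm hs y0.
have nw : normc (x +i* (s * y) : R[i]) <= (1 + 2 * kap) * n%:R^-1.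
  have ax : `|x| <= n%:R^-1 by rewrite ler_norml x1 x2.
  apply: le_trans (ler_normc_ReIm _) _ => /=; rewrite iE.
  by apply: le_trans (lerD ax y1) _; lra.
apply: le_trans (near_f (w := x +i* (s * y)) _ _ _ nw ne) _; rewrite /= ?iE ?xy //.
- exact: le_trans x1 ne.
- by apply: le_trans y1 _; lra.
rewrite ler_wpM2l // ler_expR mulrAC divff ?gt_eqF // mul1r.
have : n%:R * - n%:R^-1 <= n%:R * x by rewrite ler_wpM2l // ltW.
by rewrite mulrN divff ?gt_eqF //; lra.
Qed.

Lemma contour_estimate : normc (c n) <= 2 * (M * expR (- (n%:R * eps)) * pi) +
  (4 * (1 + 2 * kap) + 2 * expR (3 / 2) * (2 + 2 * kap)) * C * n%:R^-1.
Proof.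
have nR : 0 < n%:R :> R by rewrite ltr0n.
have u0 : 0 < n%:R^-1 :> R by rewrite invr_gt0.
have pi0 := pi_gt0 R; have pi2 := pi_ge2 R.
have bb s : s = 1 \/ s = -1 -> normc (branch g eps kap s n) <=
    2 * (M * expR (- (n%:R * eps)) * pi) +
    (4 * (1 + 2 * kap) + 2 * expR (3 / 2) * (2 + 2 * kap)) * C * n%:R^-1.
  move=> hs; have [sAB sBC sCD] := branch_segs eps0 kap0 kap_eps g_cdiff hs n0 ne.
  apply: le_trans (ler_normcD _ _) _.
  apply: le_trans (lerD (ler_normcD _ _) (seg_close hs sCD)) _.
  apply: le_trans (lerD (lerD (seg_far hs sAB) (seg_slanted hs sBC)) (lexx _)) _.
  by rewrite le_eqVlt; apply/orP; left; apply/eqP; ring.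
have := contour_formula eps0 kap0 kap_eps g_cdiff g_sum n0 ne.
move: (bb 1 (or_introl erefl)) (bb (-1) (or_intror erefl)); set B := _ + _ => h1 h2 e.
have := ler_normcB (branch g eps kap (-1) n) (branch g eps kap 1 n).
rewrite -e normcM.
have -> : normc (0 +i* (2 * pi) : R[i]) = 2 * pi.
  by rewrite /= expr0n add0r sqrtr_sqr ger0_norm // mulr_ge0 // ltW.
move=> h3; have n1 := normc_ge0 (c n).
have : normc (c n) * 4 <= normc (c n) * (2 * pi) by rewrite ler_wpM2l //; lra.
lra.
Qed.

End ContourEstimate.

(** * Transfer of a logarithmic singularity *)

Section SlitGeometry.
Context {R : realType}.
Implicit Types (z w : R[i]) (x y r rho phi : R).

Lemma norm_carg z : z != 0 -> `|carg z| = acos (complex.Re z / normc z).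
Proof.
move=> z0; have n0 : 0 < normc z by rewrite normc_gt0.
have hr : -1 <= complex.Re z / normc z <= 1.
  by rewrite -ler_norml normrM normfV (ger0_norm (ltW n0)) ler_pdivrMr // mul1r ler_normRe.
by rewrite /carg; case: ifP => _; rewrite ?normrN ger0_norm // acos_ge0.
Qed.

Lemma Delta0_intro r rho phi z : 0 < phi < pi / 2 -> normc z < rho ->
  complex.Re (z - r%:C) < cos phi * normc (z - r%:C) -> Delta0 r rho phi z.
Proof.
move=> /andP[p0 p1] zr h; have pi0 := pi_gt0 R.
have zr0 : z - r%:C != 0 by apply: contraTneq h => ->; rewrite normc0E mulr0 ltxx.
have n0 : 0 < normc (z - r%:C) by rewrite normc_gt0.
split=> //; first by rewrite -subr_eq0.
rewrite norm_carg //; set q := complex.Re _ / _.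
have hr : -1 <= q <= 1.
  by rewrite -ler_norml normrM normfV (ger0_norm (ltW n0)) ler_pdivrMr // mul1r ler_normRe.
have qc : q < cos phi by rewrite ltr_pdivrMr.
have ha : acos q \in `[0, pi] by rewrite in_itv /= acos_ge0 ?acos_lepi.
have hp : phi \in `[0, pi] by rewrite in_itv /=; apply/andP; split; lra.
by rewrite -ltr_cos // acosK // in_itv.
Qed.

Lemma cos_phi_bounds phi : 0 < phi < pi / 2 -> 0 < cos phi < 1.
Proof.
move=> /andP[p0 p1]; have pi0 := pi_gt0 R.
rewrite cos_gt0_pihalf ?p1 /=; last by apply/andP; split; lra.
rewrite -[ltRHS]cos0 ltr_cos // in_itv /= ?lexx ?pi_ge0 //; apply/andP; split; lra.
Qed.

Lemma sin_phi_gt0 phi : 0 < phi < pi / 2 -> 0 < sin phi.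
Proof. exact: sin_gt0_pihalf. Qed.

Lemma sin_ge_mul_cos y : 0 <= y <= pi -> 0 <= cos y -> y * cos y <= sin y.
Proof.
move=> /andP[y0 y1] cy; move: y0; rewrite le_eqVlt => /orP[/eqP <-|y0].
  by rewrite mul0r sin0.
have [|c] := @MVT R sin cos 0 y y0 (fun x _ => is_derive_sin x).
  exact/continuous_subspaceT/continuous_sin.
rewrite in_itv /= => /andP[c0 cy']; rewrite sin0 !subr0 => ->.
rewrite mulrC; apply: ler_wpM2r; first exact: ltW.
by apply: ltW; rewrite ltr_cos // in_itv /=; apply/andP; split; lra.
Qed.

Lemma cexp_slit phi w : 0 < phi < pi / 2 -> complex.Re w <= 2^-1 -> `|complex.Im w| <= pi ->
  2 * sin phi / cos phi * complex.Re w < `|complex.Im w| ->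
  complex.Re (cexp w - 1) < cos phi * normc (cexp w - 1).
Proof.
set x := complex.Re w; set y := complex.Im w => hp hx hy hk.
have /andP[c0 c1] := cos_phi_bounds hp; have s0 := sin_phi_gt0 hp.
set p := expR x * cos y - 1; set q := expR x * sin y.
have e0 := expR_gt0 x.
have -> : cexp w - 1 = p +i* q.
  by apply: complex_eqP; rewrite /cexp /p /q /x /y; case: (w) => a b /=; ring.
have -> : complex.Re (p +i* q) = p by [].
have [pneg|ppos] := ltP p 0.
  by apply: lt_le_trans pneg _; rewrite mulr_ge0 ?normc_ge0 // ltW.
have ex : 1 - x <= expR (- x) by have := expR_ge1Dx (- x); lra.
have eV : expR x * expR (- x) = 1 by rewrite -expRD subrr expR0.
have cyx : expR (- x) <= cos y.
  have : 1 <= expR x * cos y by rewrite /p in ppos; lra.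
  rewrite -eV ler_pM2l //.
have x0 : 0 < x.
  rewrite ltNge; apply/negP => x0.
  have cy1 : cos y = 1.
    by apply/eqP; rewrite eq_le cos_le1 /=; apply: le_trans cyx; lra.
  have y0 : `|y| = 0.
    apply: cos_inj; rewrite ?in_itv /= ?lexx ?pi_ge0 ?normr_ge0 //.
    by rewrite cos_norm cos0.
  have x00 : x = 0.
    apply/eqP; rewrite eq_le x0 /= leNgt; apply/negP => xn.
    have : 1 < expR (- x) by rewrite expR_gt1; lra.
    have := cos_le1 y; lra.
  by move: hk; rewrite x00 y0 mulr0 ltxx.
have cy : 2^-1 <= cos y by lra.
have sy : `|y| / 2 <= sin `|y|.
  have := @sin_ge_mul_cos `|y|; rewrite normr_ge0 hy cos_norm => /(_ isT) h.
  have : `|y| * 2^-1 <= `|y| * cos y by rewrite ler_wpM2l.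
  have := h _; lra.
have qn : `|q| = expR x * sin `|y|.
  rewrite /q normrM (gtr0_norm e0); congr (_ * _).
  have [y0|y0] := leP 0 y.
    by rewrite (ger0_norm y0) ger0_norm // sin_ge0_pi // y0; move: hy; rewrite ger0_norm.
  rewrite (ltr0_norm y0) sinN ltr0_norm // -oppr_gt0 -sinN sin_gt0_pi //.
  rewrite oppr_gt0 y0 /=; move: hy; rewrite ltr0_norm // le_eqVlt => /orP[/eqP e|//].
  by move: cy; rewrite -cosN e cospi; lra.
have pe : p <= expR x * x.
  have : expR x * (1 - x) <= expR x * expR (- x) by rewrite ler_wpM2l // ltW.
  have : expR x * cos y <= expR x * 1 by rewrite ler_wpM2l ?cos_le1 // ltW.
  rewrite eV /p; lra.
have key : sin phi * p < cos phi * `|q|.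
  apply: (@le_lt_trans _ _ (expR x * (sin phi * x))).
    by rewrite mulrCA ler_wpM2l // ltW.
  rewrite qn [ltRHS]mulrCA ltr_pM2l //; apply: (@lt_le_trans _ _ (cos phi * (`|y| / 2))); last first.
    by rewrite ler_wpM2l // ltW.
  have : cos phi * (2 * sin phi / cos phi * x) < cos phi * `|y| by rewrite ltr_pM2l.
  have -> : cos phi * (2 * sin phi / cos phi * x) = 2 * (sin phi * x) by field; rewrite gt_eqF.
  lra.
have n0 := normc_ge0 (p +i* q).
have n2 : normc (p +i* q) ^+ 2 = p ^+ 2 + q ^+ 2 by rewrite normc_sqr.
have cs := cos2Dsin2 phi.
rewrite ltNge; apply/negP => h.
have h2 : (cos phi * normc (p +i* q)) ^+ 2 <= p ^+ 2.
  by rewrite lerXn2r ?nnegrE // mulr_ge0 // ltW.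
have k2 : (sin phi * p) ^+ 2 < (cos phi * `|q|) ^+ 2.
  by rewrite ltrXn2r // ?nnegrE ?mulr_ge0 // ltW.
move: h2 k2; rewrite !exprMn n2 real_normK ?num_real //.
have : p ^+ 2 * (cos phi ^+ 2 + sin phi ^+ 2) = p ^+ 2 by rewrite cs mulr1.
lra.
Qed.

Lemma expR_half_le2 x : x <= 2^-1 -> expR x <= 2.
Proof.
move=> h; have : expR x * expR (- x) = 1 by rewrite -expRD subrr expR0.
have := expR_ge1Dx (- x); have := expR_gt0 x; nra.
Qed.

Lemma cexp_sub1_upper w : normc w <= 2^-1 -> normc (cexp w - 1) <= 2 * normc w.
Proof.
move=> h; apply: le_trans (cexp_bound1 w) _; rewrite mulrC ler_wpM2r ?normc_ge0 //.
exact: expR_half_le2.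
Qed.

Lemma cexp_sub1_lower w : normc w <= 4^-1 -> normc w / 2 <= normc (cexp w - 1).
Proof.
move=> h; have := cexp_bound2 w; have n0 := normc_ge0 w.
have e : expR (normc w) <= 2 by apply: expR_half_le2; lra.
have : normc w ^+ 2 * expR (normc w) <= normc w ^+ 2 * 2 by rewrite ler_wpM2l // sqr_ge0.
have := ler_normcD (cexp w - 1) (- (cexp w - 1 - w)).
rewrite (_ : _ + - _ = w); last by ring.
rewrite normcNE expr2; nra.
Qed.

Lemma ln_le_linear (a Y : R) : 0 < a -> 0 < Y -> ln Y <= a * Y - ln a.
Proof.
move=> a0 Y0; have := @le_ln1Dx R (a * Y - 1); rewrite (_ : 1 + (a * Y - 1) = a * Y); last by ring.
rewrite lnM ?posrE // => h; have := mulr_gt0 a0 Y0; lra.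
Qed.

Lemma cdiff_log_slit phi t : 0 < phi < pi / 2 ->
  complex.Re (t - 1) < cos phi * normc (t - 1) ->
  exists d, cdiff (fun t : R[i] => clog ((1 - t)^-1)) t d.
Proof.
move=> hp h; have /andP[c0 c1] := cos_phi_bounds hp.
have t0 : 1 - t != 0.
  by rewrite -opprB oppr_eq0; apply: contraTneq h => ->; rewrite normc0E mulr0 ltxx.
have dl : cdiff (@clog R) (1 - t)^-1 ((1 - t)^-1)^-1.
  apply: cdiff_clog; first by rewrite invr_eq0.
  apply/eqP => e.
  have n0 : 0 < normc (1 - t)^-1 by rewrite normc_gt0 invr_eq0.
  have : (1 - t)^-1 = (- normc (1 - t)^-1)%:C :> R[i].
    rewrite -[LHS]cexp_clog ?invr_eq0 // /cexp e cospi sinpi Re_clog lnK ?posrE //.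
    by move: (normc _) => m; apply: complex_eqP => /=; ring.
  move=> /(congr1 (fun z => z^-1)); rewrite invrK -fmorphV /= => e1.
  have e2 : t - 1 = ((normc (1 - t)^-1)^-1)%:C by rewrite -(opprB 1 t) [X in - X]e1 invrN rmorphN opprK.
  move: h; rewrite e2 normc_real ger0_norm /=; last by rewrite invr_ge0 normc_ge0.
  by rewrite -[ltLHS]mul1r ltr_pM2r ?invr_gt0 //; lra.
have d1 := cdiffB (cdiff_cst 1 t) (cdiff_id t).
by eexists; apply: (cdiff_comp (g := fun t => (1 - t)^-1) _ dl); exact: cdiff_comp d1 (cdiffV t0).
Qed.

End SlitGeometry.

Section UnitCircle.
Context {R : realType}.
Implicit Types (s : R).

Definition cis s : R[i] := cexp (0 +i* s).

Lemma cisE s : cis s = cos s +i* sin s.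
Proof. by rewrite /cis /cexp /= expR0; apply: complex_eqP => /=; ring. Qed.

Lemma normc_cis s : normc (cis s) = 1.
Proof. by rewrite /cis normc_cexp expR0. Qed.

Lemma normc_cexp_le (z : R[i]) : normc (cexp z) <= expR (normc z).
Proof. by rewrite normc_cexp ler_expR ler_Re. Qed.

Lemma normc_cexp_cis_le s (z : R[i]) : normc (cexp (cis s * z)) <= expR (normc z).
Proof.
apply: le_trans (normc_cexp_le _) _; by rewrite normcM normc_cis mul1r.
Qed.

End UnitCircle.

Lemma oppr_sum_le {R : realType} (x y z : R) : - (x + y) <= z -> - y <= x + z.
Proof. lra. Qed.

Lemma cos_ln_bound {R : realType} (c Y Z s : R) : 0 < c <= 1 -> c <= Y -> Y / 2 <= Z <= 2 * Y ->
  - (cos s * ln Z) <= ln Y - 2 * ln c + 1.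
Proof.
move=> /andP[c0 c1] cY /andP[Z1 Z2].
have Y0 : 0 < Y by exact: lt_le_trans cY.
have Z0 : 0 < Z by lra.
have lnc : ln c <= 0 by rewrite ln_le0.
have lncY : ln c <= ln Y by rewrite ler_ln ?posrE.
have ln2 : ln (2 : R) <= 1.
  by have := @le_ln1Dx R 1; rewrite (_ : 1 + 1 = 2) //; apply; lra.
have z1 : ln Z <= ln Y + ln 2 by rewrite -lnM ?posrE // ler_ln ?posrE ?mulr_gt0 // mulrC.
have z2 : ln Y - ln 2 <= ln Z by rewrite -ln_div ?posrE // ler_ln ?posrE ?divr_gt0.
have z3 : `|ln Z| <= ln Y - 2 * ln c + 1 by rewrite ler_norml; apply/andP; split; lra.
apply: le_trans (ler_norm _) _; rewrite normrN normrM; apply: le_trans z3.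
by rewrite ler_piMl // cos_max.
Qed.

Section SingularityTransfer.
Context {R : realType}.
Variables (a : nat -> R[i]) (g : R[i] -> R[i]) (K : R[i]) (r theta rho phi M0 eta : R).
Hypotheses (a0 : a 0%N = 0) (g_sum : is_sum_near0 a g).
Hypotheses (r0 : 0 < r) (theta0 : 0 <= theta) (r_rho : r < rho) (hphi : 0 < phi < pi / 2).
Hypotheses (eta0 : 0 < eta) (M00 : 0 <= M0).
Hypothesis g_hol : forall z, Delta0 r rho phi z -> exists d, cdiff g z d.
Hypothesis g_sing : forall z, normc (z - r%:C) < eta -> Delta0 r rho phi z ->
  normc (g z - (log_sing r theta z + K)) <= M0 * normc (z - r%:C).

Let L (t : R[i]) : R[i] := clog ((1 - t)^-1).
Let Err s (t : R[i]) : R[i] :=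
  cexp (cis s * g (t * r%:C)) - cexp (cis s * K) * cexp (cis s * theta%:C * L t).
Let cErr s (n : nat) : R[i] := fps_exp (fun k => cis s * a k) n * r%:C ^+ n -
  cexp (cis s * K) * rising (cis s * theta%:C) n.
Let kap := 2 * sin phi / cos phi.

Let Err_sum s : is_sum_near0 (cErr s) (Err s).
Proof.
have h1 := is_sum_near0_dilate r%:C (is_sum_near0_cexp (c := fun k => cis s * a k)
   (etrans (congr1 _ a0) (mulr0 _)) (is_sum_near0Z (cis s) g_sum)).
have h2 := is_sum_near0_cexp (c := fun k => cis s * theta%:C * (if k is 0 then 0 else k%:R^-1))
   (mulr0 _) (is_sum_near0Z (cis s * theta%:C) is_sum_near0_log).
have h3 := is_sum_near0D h1 (is_sum_near0Z (- cexp (cis s * K)) h2).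
have h n : fps_exp (fun k => cis s * theta%:C * (if k is 0 then 0 else k%:R^-1)) n =
    rising (cis s * theta%:C) n.
  rewrite rising_fps_exp; congr (fps_exp _ n).
  by apply/funext => -[|k]; rewrite ?mulr0.
apply: eq_is_sum_near0 ltr01 _ h3 => [n|t _]; first by rewrite h mulNr.
by rewrite /Err mulNr.
Qed.

Let kap0 : 0 < kap.
Proof.
have /andP[c0 _] := cos_phi_bounds hphi.
by rewrite divr_gt0 // mulr_gt0 // sin_phi_gt0.
Qed.

Let slit_Delta0 (t : R[i]) : normc t * r < rho ->
  complex.Re (t - 1) < cos phi * normc (t - 1) -> Delta0 r rho phi (t * r%:C).
Proof.
move=> tr h; apply: Delta0_intro => //.
  by rewrite normcM normc_real gtr0_norm.
have -> : t * r%:C - r%:C = (t - 1) * r%:C by ring.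
rewrite normcM normc_real gtr0_norm // ReM /= mulr0 subr0 mulrA ltr_pM2r //.
Qed.

Let Err_cdiff s (t : R[i]) : normc t * r < rho ->
  complex.Re (t - 1) < cos phi * normc (t - 1) -> exists d, cdiff (Err s) t d.
Proof.
move=> tr h; have [dg hg] := g_hol (slit_Delta0 tr h).
have [dL hL] := cdiff_log_slit hphi h.
have d1 : cdiff (fun t => t * r%:C) t (1 * r%:C + t * 0) := cdiffM (cdiff_id t) (cdiff_cst r%:C t).
have d2 := cdiff_comp (cdiffZ (cis s) (cdiff_comp d1 hg)) (cdiff_cexp (cis s * g (t * r%:C))).
have d3 := cdiff_comp (cdiffZ (cis s * theta%:C) hL) (cdiff_cexp (cis s * theta%:C * L t)).
by eexists; apply: cdiffB d2 (cdiffZ (cexp (cis s * K)) d3).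
Qed.

Let c1 := kap / (1 + kap).

Let del0 : R := Num.min 4^-1 (eta / (4 * r)).

(* With [Y = n |w|], which the region bounds from below by [c1], the factor
   [Y ^ (theta + 1)] is absorbed into [exp (del * Y)]. *)
Lemma near_bound (del : R) : 0 < del -> exists2 C : R, 0 <= C &
  forall n s (w : R[i]), (0 < n)%N -> complex.Re w <= 2^-1 -> `|complex.Im w| <= pi ->
    expR (complex.Re w) * r < rho ->
    kap * complex.Re w - `|complex.Im w| <= - (kap * n%:R^-1) -> normc w <= del0 ->
    normc (Err s (cexp w)) <=
      C * expR ((theta * cos s - 1) * ln (n%:R : R)) * expR (del * (n%:R * normc w)).
Proof.
move=> delgt0.
pose C0 := expR (normc K) * expR (theta * pi) * (2 * M0 * r * expR (2 * M0 * r)) *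
  expR (theta * (1 - 2 * ln c1)).
exists (C0 * expR (- (theta + 1) * ln (del / (theta + 1)))).
  by rewrite !mulr_ge0 ?expR_ge0 // ltW.
move=> n s w n0 wx wy wr hk wd.
have nR : 0 < n%:R :> R by rewrite ltr0n.
have u0 : 0 < n%:R^-1 :> R by rewrite invr_gt0.
have wd1 : normc w <= 4^-1 by apply: le_trans wd _; rewrite ge_min lexx.
have wd2 : normc w <= eta / (4 * r) by apply: le_trans wd _; rewrite ge_min lexx orbT.
have pi0 := pi_gt0 R.
have kap1 : 0 < 1 + kap by rewrite addr_gt0.
have c10 : 0 < c1 by rewrite divr_gt0.
have c11 : c1 <= 1 by rewrite ler_pdivrMr // mul1r lerDr.
have wc1 : c1 <= n%:R * normc w.
  have h1 := ler_normRe w; have h2 := ler_normIm w.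
  have h3 : kap * n%:R^-1 <= (1 + kap) * normc w.
    have : - complex.Re w <= normc w by apply: le_trans h1; rewrite -normrN ler_norm.
    move=> h4; have : kap * (- complex.Re w) <= kap * normc w by rewrite ler_wpM2l // ltW.
    lra.
  rewrite /c1 ler_pdivrMr //.
  have : n%:R * (kap * n%:R^-1) <= n%:R * ((1 + kap) * normc w) by rewrite ler_wpM2l // ltW.
  have -> : n%:R * (kap * n%:R^-1) = kap by field; rewrite gt_eqF.
  lra.
have w0 : 0 < normc w by rewrite -(pmulr_rgt0 _ nR); apply: lt_le_trans wc1.
set t := cexp w.
have slit : complex.Re (t - 1) < cos phi * normc (t - 1).
  apply: (cexp_slit hphi wx wy).
  by have := mulr_gt0 kap0 u0; move: hk; rewrite -/kap; move: kap => k; lra.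
have ntr : normc t * r < rho by rewrite /t normc_cexp.
have hD := slit_Delta0 ntr slit.
have up := cexp_sub1_upper (le_trans wd1 (_ : 4^-1 <= 2^-1)).
have {}up : normc (t - 1) <= 2 * normc w by apply: up; lra.
have lo : normc w / 2 <= normc (t - 1) := cexp_sub1_lower wd1.
have t1 : 0 < normc (t - 1) by apply: lt_le_trans lo; rewrite divr_gt0.
have zr : t * r%:C - r%:C = (t - 1) * r%:C by ring.
have nzr : normc (t * r%:C - r%:C) = normc (t - 1) * r.
  by rewrite zr normcM normc_real gtr0_norm.
have near : normc (t * r%:C - r%:C) < eta.
  rewrite nzr; have : normc w * (4 * r) <= eta by rewrite -ler_pdivlMr // mulr_gt0.
  have := ler_wpM2r (ltW r0) up; have := mulr_gt0 w0 r0; lra.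
have := g_sing near hD.
have rC : r%:C != 0 :> R[i] by rewrite -normc_eq0 normc_real normr_eq0 gt_eqF.
rewrite /log_sing mulfK // -/(L t) nzr.
set v := g _ - _ => hv.
have v1 : normc v <= 2 * M0 * r * normc w.
  apply: le_trans hv _; have : M0 * (normc (t - 1) * r) <= M0 * (2 * normc w * r).
    by rewrite ler_wpM2l // ler_wpM2r // ltW.
  lra.
have v2 : normc v <= 2 * M0 * r.
  apply: le_trans v1 _; rewrite ler_piMr ?mulr_ge0 // ?(ltW r0) //; lra.
have EE : Err s t = cexp (cis s * K) * cexp (cis s * theta%:C * L t) * (cexp (cis s * v) - 1).
  rewrite mulrBr mulr1 -!cexpD /Err -cexpD; congr (_ - _); congr cexp.
  by rewrite /v; ring.
rewrite EE normcM normcM.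
set b := theta * cos s.
have k1 := normc_cexp_cis_le s K.
have k2 : normc (cexp (cis s * theta%:C * L t)) <= expR (b * ln (n%:R : R)) *
   expR (theta * pi) * expR (theta * (1 - 2 * ln c1)) * expR (theta * ln (n%:R * normc w)).
  rewrite normc_cexp -!expRD ler_expR.
  have -> : complex.Re (cis s * theta%:C * L t) =
     theta * (cos s * complex.Re (L t) - sin s * complex.Im (L t)).
    by rewrite cisE ReM ReM ImM /=; ring.
  have t10 : (1 - t)^-1 != 0.
    by rewrite invr_eq0 -normc_gt0 normcB.
  have ReL : complex.Re (L t) = - ln (normc (t - 1)).
    by rewrite /L Re_clog normcV lnV ?posrE normcB.
  have ImL : `|complex.Im (L t)| <= pi.
    by have /andP[i1 i2] := Im_clog t10; rewrite ler_norml i2 ltW.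
  have q1 : - (sin s * complex.Im (L t)) <= pi.
    have : `|sin s * complex.Im (L t)| <= 1 * pi by rewrite normrM ler_pM // sin_max.
    rewrite mul1r ler_norml => /andP[]; lra.
  set Y := n%:R * normc w in wc1 *.
  have Y0 : 0 < Y by exact: lt_le_trans wc1.
  have q2 : - (cos s * ln (normc (t - 1))) <= cos s * ln (n%:R : R) + (ln Y - 2 * ln c1 + 1).
    have := @cos_ln_bound R c1 Y (n%:R * normc (t - 1)) s.
    rewrite c10 c11 lnM ?posrE // => /(_ isT wc1) h.
    suff /h : Y / 2 <= n%:R * normc (t - 1) <= 2 * Y by rewrite mulrDr => /oppr_sum_le.
    by rewrite /Y mulrCA -mulrA !ler_pM2l // lo up.
  rewrite ReL.
  have : theta * (cos s * - ln (normc (t - 1)) - sin s * complex.Im (L t)) <=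
     theta * (cos s * ln (n%:R : R) + (ln Y - 2 * ln c1 + 1) + pi).
    by rewrite ler_wpM2l //; lra.
  rewrite /b; lra.
have k3 : normc (cexp (cis s * v) - 1) <= 2 * M0 * r * expR (2 * M0 * r) * normc w.
  apply: le_trans (cexp_bound1 _) _; rewrite normcM normc_cis mul1r.
  rewrite mulrAC ler_pM ?normc_ge0 ?expR_ge0 // ler_expR //.
have k4 : expR (theta * ln (n%:R * normc w)) * normc w <=
   n%:R^-1 * (expR (- (theta + 1) * ln (del / (theta + 1))) * expR (del * (n%:R * normc w))).
  set Y := n%:R * normc w in wc1 *.
  have Y0 : 0 < Y by exact: lt_le_trans wc1.
  have -> : normc w = n%:R^-1 * expR (ln Y).
    by rewrite lnK ?posrE // /Y; field; rewrite gt_eqF.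
  rewrite mulrCA ler_wpM2l ?(ltW u0) // -!expRD ler_expR.
  have th1 : 0 < theta + 1 by rewrite ltr_wpDl.
  have := @ln_le_linear R (del / (theta + 1)) Y; rewrite divr_gt0 // => /(_ isT Y0) h.
  have := ler_wpM2l (ltW th1) h.
  have -> : (theta + 1) * (del / (theta + 1) * Y - ln (del / (theta + 1))) =
     del * Y - (theta + 1) * ln (del / (theta + 1)) by field; rewrite gt_eqF.
  lra.
have k5 : expR (b * ln (n%:R : R)) * n%:R^-1 = expR ((b - 1) * ln (n%:R : R)).
  by rewrite mulrBl mul1r expRB lnK ?posrE.
apply: le_trans (ler_pM _ _ (ler_pM _ _ k1 k2) k3) _; rewrite ?mulr_ge0 ?normc_ge0 //.
rewrite -k5.
set A1 := expR (normc K); set A2 := expR (b * _); set A3 := expR (theta * pi).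
set A4 := expR (theta * (1 - _)); set A5 := expR (theta * ln _) in k4 *.
set A6 := 2 * M0 * r * _; set A7 := expR (- (theta + 1) * _) in k4 *.
set A8 := expR (del * _) in k4 *.
have -> : A1 * (A2 * A3 * A4 * A5) * (A6 * normc w) = (A1 * A2 * A3 * A4 * A6) * (A5 * normc w) by ring.
have -> : C0 * A7 * (A2 / n%:R) * A8 = (A1 * A2 * A3 * A4 * A6) * (n%:R^-1 * (A7 * A8)).
  by rewrite /C0 -/A1 -/A3 -/A4 -/A6; ring.
by apply: ler_wpM2l k4; rewrite /A1 /A2 /A3 /A4 !mulr_ge0 ?expR_ge0 ?(ltW r0).
Qed.

Let cexp_region_bound w eps : expR eps * r < rho -> complex.Re w <= eps ->
  normc (cexp w) * r < rho.
Proof.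
move=> he hw; apply: le_lt_trans he; rewrite normc_cexp ler_wpM2r ?(ltW r0) //.
by rewrite ler_expR.
Qed.

Let Im_sign (sg x : R) : sg = 1 \/ sg = -1 -> 0 <= x -> `|sg * x| = x.
Proof. by move=> hs x0; rewrite normrM (ger0_norm x0); case: hs => ->; rewrite ?normrN normr1 mul1r. Qed.

Lemma far_bound eps sg : sg = 1 \/ sg = -1 -> 0 < eps -> eps <= 2^-1 -> expR eps * r < rho ->
  2 * kap * eps <= pi -> exists2 M : R, 0 <= M & forall s t, 0 <= t <= 1 ->
  normc (Err s (cexp (seg (vertexA eps sg) (vertexB eps kap sg) t))) <= M.
Proof.
move=> hs e0 e1 er ke.
have ke0 : 0 < kap * eps by rewrite mulr_gt0.
have wE t : seg (vertexA eps sg) (vertexB eps kap sg) t =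
    eps +i* (sg * (pi + t * (2 * kap * eps - pi))).
  by rewrite /seg /vertexA /vertexB; apply: complex_eqP => /=; ring.
have slit t : 0 <= t <= 1 -> complex.Re (cexp (seg (vertexA eps sg) (vertexB eps kap sg) t) - 1)
   < cos phi * normc (cexp (seg (vertexA eps sg) (vertexB eps kap sg) t) - 1).
  move=> /andP[t0 t1]; rewrite wE.
  have y0 : t * (pi - 2 * kap * eps) <= 1 * (pi - 2 * kap * eps).
    by rewrite ler_wpM2r // subr_ge0.
  have y1 : 0 <= t * (pi - 2 * kap * eps) by rewrite mulr_ge0 // subr_ge0.
  have yE : `|sg * (pi + t * (2 * kap * eps - pi))| = pi + t * (2 * kap * eps - pi).
    by apply: Im_sign => //; lra.
  have pk : kap * eps < pi + t * (2 * kap * eps - pi) by lra.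
  have pp : pi + t * (2 * kap * eps - pi) <= pi by lra.
  by apply: (cexp_slit hphi) => /=; rewrite ?yE.
have rb t : normc (cexp (seg (vertexA eps sg) (vertexB eps kap sg) t)) * r < rho.
  by apply: (cexp_region_bound er); rewrite wE.
have [M1 h1] : exists M, forall t, 0 <= t <= 1 ->
    normc (g (cexp (seg (vertexA eps sg) (vertexB eps kap sg) t) * r%:C)) <= M.
  apply: (@ccont_seg_bounded R (fun w => g (cexp w * r%:C))) => t t01.
  have [dg hg] := g_hol (slit_Delta0 (rb t) (slit t t01)).
  apply: (@ccont_comp R g (fun w => cexp w * r%:C)); last exact: cdiff_cont hg.
  by apply: ccontM; [exact: cdiff_cont (cdiff_cexp _)|exact: ccont_cst].
have [M2 h2] : exists M, forall t, 0 <= t <= 1 ->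
    normc (L (cexp (seg (vertexA eps sg) (vertexB eps kap sg) t))) <= M.
  apply: (@ccont_seg_bounded R (fun w => L (cexp w))) => t t01.
  have [dL hL] := cdiff_log_slit hphi (slit t t01).
  apply: (@ccont_comp R L (@cexp R)); last exact: cdiff_cont hL.
  exact: cdiff_cont (cdiff_cexp _).
exists (expR M1 + expR (normc K) * expR (theta * M2)).
  by rewrite addr_ge0 ?mulr_ge0 ?expR_ge0.
move=> s t t01; apply: le_trans (ler_normcB _ _) _; apply: lerD.
  by apply: le_trans (normc_cexp_cis_le _ _) _; rewrite ler_expR h1.
rewrite normcM; apply: ler_pM; [exact: normc_ge0|exact: normc_ge0|exact: normc_cexp_cis_le|].
rewrite -[cis s * _ * _]mulrA; apply: le_trans (normc_cexp_cis_le _ _) _.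
rewrite ler_expR normcM normc_real (ger0_norm theta0); apply: ler_wpM2l => //; exact: h2.
Qed.

Lemma expR_le_power (eps : R) n s : 0 < eps -> (0 < n)%N ->
  expR (- (n%:R * eps)) <= expR (- ((2 + theta) * ln (eps / (2 + theta)))) *
     expR ((theta * cos s - 2) * ln (n%:R : R)).
Proof.
move=> e0 n0; have th : 0 < 2 + theta by rewrite ltr_pwDl.
have nR : 0 < n%:R :> R by rewrite ltr0n.
have := @ln_le_linear R (eps / (2 + theta)) n%:R; rewrite divr_gt0 // => /(_ isT nR) h.
have := ler_wpM2l (ltW th) h.
have -> : (2 + theta) * (eps / (2 + theta) * n%:R - ln (eps / (2 + theta))) =
     n%:R * eps - (2 + theta) * ln (eps / (2 + theta)) by field; rewrite gt_eqF.
have l0 : 0 <= ln (n%:R : R) by rewrite ln_ge0 // ler1n.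
have : theta * (-1) <= theta * cos s by rewrite ler_wpM2l // cos_geN1.
move=> h1 h2; rewrite -expRD ler_expR.
have := ler_wpM2r l0 h1; lra.
Qed.

Lemma singularity_transfer : exists (C : R) (N : nat), 0 <= C /\ forall n s, (N <= n)%N ->
  normc (cErr s n) <= C * expR ((theta * cos s - 2) * ln (n%:R : R)).
Proof.
have pi0 := pi_gt0 R; have pi2 := pi_ge2 R.
have k1 : 0 < 1 + 2 * kap by rewrite addr_gt0 // mulr_gt0.
have lr : 0 < ln (rho / r) by rewrite ln_gt0 // ltr_pdivlMr // mul1r.
have d00 : 0 < del0 by rewrite lt_min invr_gt0 ltr0n divr_gt0 // mulr_gt0.
pose eps := Num.min (del0 / (1 + 2 * kap)) (ln (rho / r) / 2).
have e0 : 0 < eps by rewrite lt_min !divr_gt0.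
have ed : (1 + 2 * kap) * eps <= del0 by rewrite mulrC -ler_pdivlMr // ge_min lexx.
have d04 : del0 <= 4^-1 by rewrite ge_min lexx.
have ke0 : 0 < kap * eps by rewrite mulr_gt0.
have e12 : eps <= 2^-1 by lra.
have kepi : 2 * kap * eps <= pi by lra.
have er : expR eps * r < rho.
  rewrite -ltr_pdivlMr //; have rr : 0 < rho / r by rewrite divr_gt0 //; apply: lt_trans r_rho.
  rewrite -[ltRHS]lnK ?posrE // ltr_expR; apply: le_lt_trans (_ : ln (rho / r) / 2 < _).
    by rewrite ge_min lexx orbT.
  lra.
have Ecd s w : complex.Re w <= eps -> `|complex.Im w| <= pi ->
  kap * complex.Re w < `|complex.Im w| -> exists d, cdiff (Err s) (cexp w) d.
  move=> h1 h2 h3; apply: Err_cdiff; first exact: cexp_region_bound er h1.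
  by apply: cexp_slit => //; lra.
have del_gt0 : 0 < (2 * (1 + 2 * kap))^-1 by rewrite invr_gt0 mulr_gt0.
have [C C0 nb] := near_bound del_gt0.
have [M1 M10 fb1] := far_bound (or_introl erefl) e0 e12 er kepi.
have [M2 M20 fb2] := far_bound (or_intror erefl) e0 e12 er kepi.
pose C5 := expR (- ((2 + theta) * ln (eps / (2 + theta)))).
pose C6 := 4 * (1 + 2 * kap) + 2 * expR (3 / 2) * (2 + 2 * kap).
have C60 : 0 <= C6.
  by rewrite addr_ge0 // !mulr_ge0 ?expR_ge0 ?(ltW k1) // addr_ge0 // mulr_ge0 // ltW.
exists (2 * ((M1 + M2) * C5 * pi) + C6 * C), (Num.truncn (eps^-1)).+1; split.
  by rewrite !addr_ge0 ?mulr_ge0 ?expR_ge0 ?(ltW pi0) // addr_ge0.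
move=> n s Nn.
have n0 : (0 < n)%N by exact: leq_trans Nn.
have nR : 0 < n%:R :> R by rewrite ltr0n.
have ne : n%:R^-1 <= eps.
  rewrite invf_ple ?posrE // ltW //; apply: lt_le_trans (_ : (Num.truncn eps^-1).+1%:R <= _).
    exact: truncnS_gt.
  by rewrite ler_nat.
set b := theta * cos s; set P := expR ((b - 2) * ln (n%:R : R)).
have PE : expR ((b - 1) * ln (n%:R : R)) * n%:R^-1 = P.
  rewrite -[n%:R^-1]lnK ?posrE ?invr_gt0 // lnV ?posrE // -expRD /P; congr expR; ring.
have := @contour_estimate R (Err s) (cErr s) eps kap n (M1 + M2)
  (C * expR ((b - 1) * ln (n%:R : R))) e0 kap0 kepi (Ecd s) (Err_sum s) n0 ne.
move=> /(_ (addr_ge0 M10 M20) (mulr_ge0 C0 (expR_ge0 _)) _ _) h.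
apply: le_trans (h _ _) _ => {h}.
- move=> sg t hs t01.
  by case: hs => ->; [have := fb1 s t t01|have := fb2 s t t01]; lra.
- move=> w h1 h2 h3 h4; apply: nb => //; first exact: le_trans h1 e12.
    by apply: le_lt_trans er; rewrite ler_wpM2r ?(ltW r0) // ler_expR.
  exact: le_trans h4 ed.
rewrite -/C6 [leRHS]mulrDl; apply: lerD.
  have -> : 2 * ((M1 + M2) * C5 * pi) * P = 2 * ((M1 + M2) * (C5 * P) * pi) by ring.
  rewrite ler_wpM2l // ler_wpM2r ?(ltW pi0) // ler_wpM2l ?addr_ge0 //.
  exact: expR_le_power.
by rewrite -!mulrA PE.
Qed.

End SingularityTransfer.

(** * Perturbation of binomial coefficients *)

Section HarmonicSums.
Context {R : realType}.

Definition pw (x : R) n : R := expR (x * ln (n.+1%:R)).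

Lemma pw_ge0 x n : 0 <= pw x n. Proof. exact: expR_ge0. Qed.
Lemma pw_gt0 x n : 0 < pw x n. Proof. exact: expR_gt0. Qed.

Lemma pwD x y n : pw (x + y) n = pw x n * pw y n.
Proof. by rewrite /pw mulrDl expRD. Qed.

Lemma pw1 n : pw 1 n = n.+1%:R.
Proof. by rewrite /pw mul1r lnK // posrE ltr0n. Qed.

Lemma pwN1 n : pw (-1) n = n.+1%:R^-1.
Proof. by rewrite /pw mulN1r expRN lnK // posrE ltr0n. Qed.

Lemma pw_mulS x n : pw (x - 1) n * n.+1%:R = pw x n.
Proof. by rewrite -(pw1 n) -pwD subrK. Qed.

Lemma pw0 x : pw x 0 = 1.
Proof. by rewrite /pw ln1 mulr0 expR0. Qed.

Lemma pw_half x m n : (n.+1 <= 2 * m.+1)%N -> (m <= n)%N -> pw x m <= expR `|x| * pw x n.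
Proof.
move=> h1 h2; rewrite /pw -expRD ler_expR.
have lm : ln (m.+1%:R : R) <= ln (n.+1%:R) by rewrite ler_ln ?posrE ?ltr0n // ler_nat.
have ln2 : ln (2 : R) <= 1.
  by have := @le_ln1Dx R 1; rewrite (_ : 1 + 1 = 2) //; apply; lra.
have lm2 : ln (n.+1%:R : R) <= ln 2 + ln (m.+1%:R).
  by rewrite -lnM ?posrE ?ltr0n // ler_ln ?posrE ?mulr_gt0 ?ltr0n // -natrM ler_nat.
have : - x * (ln (n.+1%:R : R) - ln (m.+1%:R)) <= `|x| * (ln (n.+1%:R) - ln (m.+1%:R)).
  by rewrite ler_wpM2r ?subr_ge0 // -normrN ler_norm.
have : `|x| * (ln (n.+1%:R : R) - ln (m.+1%:R)) <= `|x| * 1 by rewrite ler_wpM2l //; lra.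
lra.
Qed.

Definition harmonic_sum n : R := \sum_(k < n) k.+1%:R^-1.

Lemma harmonic_sumS n : harmonic_sum n.+1 = harmonic_sum n + n.+1%:R^-1.
Proof. by rewrite /harmonic_sum big_ord_recr. Qed.

Lemma harmonic_sum_lower n : ln n.+1%:R <= harmonic_sum n.
Proof.
elim: n => [|n ih]; first by rewrite ln1 /harmonic_sum big_ord0.
have /andP[_ h] := @ln_succ_bounds R n.+1 isT.
rewrite harmonic_sumS; move: ih h; set x := n.+1%:R^-1.
rewrite lerBlDr => ih h; apply: le_trans h _; rewrite addrC lerD2r //.
Qed.

Lemma harmonic_sum_upper n : harmonic_sum n.+1 <= 1 + ln n.+1%:R.
Proof.
elim: n => [|n ih]; first by rewrite ln1 /harmonic_sum big_ord1 invr1 addr0.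
have /andP[h _] := @ln_succ_bounds R n.+1 isT.
rewrite harmonic_sumS; apply: (le_trans (lerD ih h)).
by rewrite addrCA addrK addrC.
Qed.

Lemma rising_ge0 (x : R) n : 0 <= x -> 0 <= rising x n.
Proof.
by move=> x0; rewrite /rising divr_ge0 // prodr_ge0 // => k _; rewrite addr_ge0.
Qed.

Lemma rising_le_pw (x : R) n : 0 <= x -> rising x n <= expR `|x - 1| * pw (x - 1) n.
Proof.
move=> x0.
have h : rising x n <= expR ((x - 1) * harmonic_sum n).
  elim: n => [|n ih]; first by rewrite rising0 /harmonic_sum big_ord0 mulr0 expR0.
  have n0 : 0 < n.+1%:R :> R by rewrite ltr0n.
  have e : rising x n.+1 = rising x n * (1 + (x - 1) / n.+1%:R).
    have := risingS x n; rewrite -natr1 in n0 *; move=> e.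
    apply: (mulfI (x := n%:R + 1)); first by rewrite gt_eqF.
    by rewrite e; field; rewrite gt_eqF.
  rewrite e harmonic_sumS [X in expR X]mulrDr expRD.
  apply: ler_pM => //; rewrite ?rising_ge0 ?expR_ge1Dx //.
  have -> : 1 + (x - 1) / n.+1%:R = (x + n%:R) / n.+1%:R.
    by rewrite -natr1 in n0 *; field; rewrite gt_eqF.
  by rewrite divr_ge0 ?addr_ge0 // ltW.
apply: le_trans h _; rewrite /pw -expRD ler_expR.
have lo := harmonic_sum_lower n.
have up : harmonic_sum n - ln (n.+1%:R : R) <= 1.
  case: n lo => [|n] lo; first by rewrite /harmonic_sum big_ord0 ln1; lra.
  have := harmonic_sum_upper n.
  have : ln (n.+1%:R : R) <= ln (n.+2%:R) by rewrite ler_ln ?posrE ?ltr0n // ler_nat.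
  lra.
have : (x - 1) * (harmonic_sum n - ln (n.+1%:R : R)) <= `|x - 1| * (harmonic_sum n - ln (n.+1%:R)).
  by rewrite ler_wpM2r ?subr_ge0 // ler_norm.
have : `|x - 1| * (harmonic_sum n - ln (n.+1%:R : R)) <= `|x - 1| * 1 by rewrite ler_wpM2l.
lra.
Qed.

Lemma pw_telescope (g : R) n : 0 < g ->
  pw (- 1 - g) n.+1 <= g^-1 * (pw (- g) n - pw (- g) n.+1).
Proof.
move=> g0; rewrite pwD pwN1 -ler_pdivrMl ?invr_gt0 // invrK.
have /andP[h _] := @ln_succ_bounds R n.+1 isT.
have e : pw (- g) n = pw (- g) n.+1 * expR (g * (ln (n.+2%:R) - ln (n.+1%:R))).
  by rewrite /pw -expRD; congr expR; ring.
have k : 1 + g * n.+2%:R^-1 <= expR (g * (ln (n.+2%:R) - ln (n.+1%:R))).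
  apply: le_trans (expR_ge1Dx _); rewrite lerD2l ler_wpM2l // ltW //.
rewrite e lerBrDr; apply: le_trans (ler_wpM2l (pw_ge0 (- g) n.+1) k).
by rewrite mulrDr mulr1 [leRHS]addrC lerD2r mulrA mulrC.
Qed.

Lemma pw_tail (g : R) m N : 0 < g -> \sum_(k < N) pw (- 1 - g) (m.+1 + k) <= g^-1 * pw (- g) m.
Proof.
move=> g0; have h : \sum_(k < N) pw (- 1 - g) (m.+1 + k) <= g^-1 * (pw (- g) m - pw (- g) (m + N)).
  elim: N => [|N ih]; first by rewrite big_ord0 addn0 subrr mulr0.
  rewrite big_ord_recr /= addnS; have := pw_telescope (m + N) g0; rewrite addSn; lra.
apply: le_trans h _; rewrite ler_wpM2l ?invr_ge0 ?(ltW g0) //.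
have := pw_ge0 (- g) (m + N); lra.
Qed.

Lemma pw_sum (g : R) N : 0 < g -> \sum_(k < N) pw (- 1 - g) k <= 1 + g^-1.
Proof.
move=> g0; case: N => [|N]; first by rewrite big_ord0 addr_ge0 // invr_ge0 ltW.
rewrite big_ord_recl pw0 lerD2l.
by have := pw_tail 0 N g0; rewrite pw0 mulr1.
Qed.

Lemma pw_sum_gamma (g : R) n : 0 < g <= 1 ->
  \sum_(k < n.+1) pw (- g) k <= pw (1 - g) n * (1 + ln (n.+1%:R)).
Proof.
move=> /andP[g0 g1].
apply: le_trans (ler_wpM2l (pw_ge0 (1 - g) n) (harmonic_sum_upper n)).
rewrite /harmonic_sum mulr_sumr; apply: ler_sum => -[k /= kn] _.
have -> : pw (- g) k = pw (1 - g) k * k.+1%:R^-1.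
  by rewrite -(pwN1 k) -pwD addrAC subrr add0r.
rewrite ler_wpM2r ?invr_ge0 // ler_expR ler_wpM2l ?subr_ge0 //.
by rewrite ler_ln ?posrE ?ltr0n // ler_nat.
Qed.

End HarmonicSums.

Section WeightedConvolution.
Context {R : realType}.
Variable g : R.
Hypothesis g01 : 0 < g <= 1.
Let w n := pw (- 1 - g) n.
Let D : R := 8 * expR 2 * (1 + g^-1).
Implicit Types (a b : nat -> R[i]).

Let g0 : 0 < g. Proof. by case/andP: g01. Qed.
Let w_half m n : (n.+1 <= 2 * m.+1)%N -> (m <= n)%N -> w m <= expR 2 * w n.
Proof.
move=> h1 h2; apply: le_trans (pw_half _ h1 h2) _; rewrite ler_wpM2r ?pw_ge0 // ler_expR.
by have /andP[k1 k2] := g01; rewrite ler0_norm; lra.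
Qed.

Lemma weighted_fps_mul a b (A B : R) : 0 <= A -> 0 <= B ->
  (forall n, normc (a n) <= A * w n) -> (forall n, normc (b n) <= B * w n) ->
  forall n, normc (fps_mul a b n) <= D * A * B * w n.
Proof.
move=> A0 B0 ha hb n.
have w0 k : 0 <= w k by exact: pw_ge0.
apply: le_trans (ler_normc_sum _ _ _) _.
have h (i : 'I_n.+1) : normc (a i * b (n - i)%N) <= A * B * (expR 2 * w n * (w i + w (n - i)%N)).
  case: i => i /= hi; rewrite normcM.
  apply: (@le_trans _ _ ((A * w i) * (B * w (n - i)%N))); first by rewrite ler_pM ?normc_ge0.
  have -> : A * w i * (B * w (n - i)%N) = A * B * (w i * w (n - i)%N) by ring.
  rewrite ler_wpM2l ?mulr_ge0 //.
  have E0 : 0 <= expR 2 * w n by rewrite mulr_ge0 ?expR_ge0.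
  have [le|lt] := leqP (n - i) i.
    have k : w i <= expR 2 * w n by apply: w_half; lia.
    apply: le_trans (ler_wpM2r (w0 (n - i)%N) k) _; rewrite ler_wpM2l // lerDr //.
  have k : w (n - i)%N <= expR 2 * w n by apply: w_half; lia.
  rewrite mulrC; apply: le_trans (ler_wpM2r (w0 i) k) _; rewrite ler_wpM2l // lerDl //.
apply: le_trans (ler_sum _ (fun i _ => h i)) _.
rewrite -mulr_sumr -mulr_sumr big_split /=.
have s1 := @pw_sum R g n.+1 g0.
have s2 : \sum_(i < n.+1) w (n - i)%N <= 1 + g^-1.
  by rewrite (reindex_inj rev_ord_inj) /=; under eq_bigr => i _ do rewrite subSS subKn ?leq_ord //.
have -> : D * A * B * w n = A * B * (expR 2 * w n * (8 * (1 + g^-1))) by rewrite /D; ring.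
rewrite ler_wpM2l ?mulr_ge0 // ler_wpM2l ?mulr_ge0 ?expR_ge0 //.
have : 0 <= g^-1 by rewrite invr_ge0 ltW.
move: s1 s2; rewrite /w; set x := \sum_(_ < _) _; set y := \sum_(_ < _) _; lra.
Qed.

Lemma weighted_fps_exp a (A : R) : 0 <= A -> (forall n, normc (a n) <= A * w n) ->
  forall n, normc (fps_exp a n) <= expR (D * A) * w n.
Proof.
move=> A0 ha n.
have D0 : 0 <= D by rewrite !mulr_ge0 ?expR_ge0 // addr_ge0 // invr_ge0 ltW.
have hp j k : normc (fps_pow a j k) <= (D * A) ^+ j * w k.
  elim: j k => [|j ih] k.
    rewrite expr0 mul1r /= /fps_one; case: k => [|k] /=.
      by rewrite -[X in X <= _]/(normc (1 : R[i])) normc1E /w pw0.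
    by rewrite -[X in X <= _]/(normc (0 : R[i])) normc0E pw_ge0.
  rewrite exprS; apply: weighted_fps_mul => //.
  by rewrite exprn_ge0 // mulr_ge0.
apply: le_trans (ler_normc_sum _ _ _) _.
apply: le_trans (ler_wpM2r (pw_ge0 _ n) (exp_coeff_sum_le n.+1 (mulr_ge0 D0 A0))).
rewrite mulr_suml; apply: ler_sum => j _; rewrite normcM normcV normc_nat mulrAC.
by rewrite ler_wpM2r ?invr_ge0.
Qed.

End WeightedConvolution.

Section RisingPerturbation.
Context {R : realType}.
Variables (g theta A : R) (c : nat -> R[i]) (K : R[i]).
Hypotheses (g01 : 0 < g <= 1) (theta0 : 0 < theta) (A0 : 0 <= A).
Hypotheses (c0 : c 0%N = 0) (cA : forall n, normc (c n) <= A * pw (- 1 - g) n).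
Hypothesis cK : csum c K.

Let g0 : 0 < g. Proof. by case/andP: g01. Qed.
Let rho n : R := rising theta n.
Let rho0 n : 0 <= rho n. Proof. exact/rising_ge0/ltW. Qed.
Let C1 : R := expR `|theta - 1|.
Let rho_le n : rho n <= C1 * pw (theta - 1) n. Proof. exact/rising_le_pw/ltW. Qed.
Let E : R := expR (8 * expR 2 * (1 + g^-1) * A).
Let C2 : R := C1 * (theta + 1) * expR `|theta - 2|.

Let fps_exp_le (al : R[i]) n : normc al = 1 ->
  normc (fps_exp (fun k => al * c k) n) <= E * pw (- 1 - g) n.
Proof.
by move=> al1; apply: weighted_fps_exp => // k; rewrite normcM al1 mul1r.
Qed.

Let normc_rising (al : R[i]) n : normc al = 1 -> normc (rising (al * theta%:C) n) <= rho n.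
Proof.
move=> al1; rewrite /rho /rising normcM normc_prod normcV normc_nat ler_wpM2r ?invr_ge0 //.
apply: ler_prod => k _; rewrite normc_ge0 /=; apply: le_trans (ler_normcD _ _) _.
by rewrite normcM al1 mul1r normc_nat normc_real gtr0_norm.
Qed.

Let rising_step (al : R[i]) j : normc al = 1 ->
  normc (rising (al * theta%:C) j.+1 - rising (al * theta%:C) j) <=
  C1 * (theta + 1) * pw (theta - 2) j.
Proof.
move=> al1; set z := al * _.
have n0 : j.+1%:R != 0 :> R[i] by rewrite pnatr_eq0.
have -> : rising z j.+1 - rising z j = rising z j * ((z - 1) * j.+1%:R^-1).
  apply: (mulfI n0); rewrite mulrBr risingS.
  rewrite [RHS](_ : _ = rising z j * (z - 1) * (j.+1%:R * j.+1%:R^-1)); last by ring.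
  by rewrite mulfV // -natr1; ring.
rewrite normcM (normcM (z - 1)) normcV normc_nat.
have z1 : normc (z - 1) <= theta + 1.
  apply: le_trans (ler_normcB _ _) _.
  by rewrite normcM al1 mul1r normc1E normc_real gtr0_norm.
have -> : C1 * (theta + 1) * pw (theta - 2) j = C1 * pw (theta - 1) j * ((theta + 1) * j.+1%:R^-1).
  have -> : pw (theta - 2) j = pw (theta - 1) j * j.+1%:R^-1.
    by rewrite -(pwN1 j) -pwD -addrA -opprD.
  by ring.
apply: ler_pM; rewrite ?mulr_ge0 ?normc_ge0 ?invr_ge0 //.
  exact: le_trans (normc_rising _ al1) (rho_le _).
by rewrite ler_wpM2r ?invr_ge0.
Qed.

Let rising_shift (al : R[i]) n k : normc al = 1 -> (2 * k <= n)%N ->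
  normc (rising (al * theta%:C) (n - k) - rising (al * theta%:C) n) <= k%:R * (C2 * pw (theta - 2) n).
Proof.
move=> al1; elim: k => [|k ih] kn; first by rewrite subn0 subrr normc0E mul0r.
have e : (n - k)%N = (n - k.+1).+1 by lia.
have {}ih := ih (leq_trans (leq_mul (leqnn 2) (leqnSn k)) kn).
set z := al * _ in ih *.
have -> : rising z (n - k.+1) - rising z n =
    (rising z (n - k) - rising z n) - (rising z (n - k.+1).+1 - rising z (n - k.+1)).
  by rewrite e; ring.
apply: le_trans (ler_normcB _ _) _; rewrite -natr1 mulrDl mul1r lerD //.
apply: le_trans (rising_step _ al1) _.
have h1 : (n.+1 <= 2 * (n - k.+1).+1)%N by lia.
apply: le_trans (ler_wpM2l _ (pw_half (theta - 2) h1 (leq_subr _ _))) _.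
  by rewrite mulr_ge0 ?expR_ge0 // addr_ge0 // ltW.
by rewrite /C2 !mulrA.
Qed.

Let E0 : 0 <= E. Proof. exact: expR_ge0. Qed.
Let C20 : 0 <= C2.
Proof. by rewrite !mulr_ge0 ?expR_ge0 // addr_ge0 // ltW. Qed.

Let EC0 : 0 <= E * C2. Proof. exact: mulr_ge0. Qed.

Let term_le (al : R[i]) n k : normc al = 1 -> (k <= n)%N ->
  normc (fps_exp (fun j => al * c j) k *
    (rising (al * theta%:C) (n - k) - rising (al * theta%:C) n)) <=
  E * C2 * pw (theta - 2) n * pw (- g) k + E * expR 2 * pw (- 1 - g) n * (rho (n - k) + rho n).
Proof.
move=> al1 kn; rewrite normcM.
have p0 x m : 0 <= pw x m :> R by exact: pw_ge0.
have r0 : 0 <= rho (n - k) + rho n by rewrite addr_ge0.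
have [k2|k2] := leqP (2 * k)%N n.
  apply: (@le_trans _ _ (E * C2 * pw (theta - 2) n * pw (- g) k)); last first.
    by rewrite lerDl mulr_ge0 // mulr_ge0 // mulr_ge0 // expR_ge0.
  apply: (le_trans (ler_pM (normc_ge0 _) (normc_ge0 _) (fps_exp_le k al1) (rising_shift al1 k2))).
  have -> : E * pw (-1 - g) k * (k%:R * (C2 * pw (theta - 2) n)) =
    E * C2 * pw (theta - 2) n * (pw (- 1 - g) k * k%:R) by ring.
  rewrite ler_wpM2l //; first by rewrite mulr_ge0.
  have -> : pw (- g) k = pw (- 1 - g) k * k.+1%:R.
    by rewrite -[in LHS]pw_mulS addrC.
  by rewrite ler_wpM2l // ler_nat.
apply: (@le_trans _ _ (E * expR 2 * pw (- 1 - g) n * (rho (n - k) + rho n))); last first.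
  by rewrite lerDr mulr_ge0 // mulr_ge0.
apply: ler_pM; rewrite ?normc_ge0 //.
  apply: le_trans (fps_exp_le k al1) _; rewrite -mulrA ler_wpM2l //.
  have h1 : (n.+1 <= 2 * k.+1)%N by lia.
  apply: le_trans (pw_half _ h1 kn) _; rewrite ler_wpM2r // ler_expR.
  by have /andP[k3 k4] := g01; rewrite ler0_norm; lra.
by apply: le_trans (ler_normcB _ _) _; rewrite lerD // normc_rising.
Qed.

Let sum_rho n : \sum_(k < n.+1) rho (n - k) <= (1 + theta^-1) * n.+1%:R * rho n.
Proof.
have -> : \sum_(k < n.+1) rho (n - k) = \sum_(k < n.+1) rho k.
  by rewrite (reindex_inj rev_ord_inj) /=; apply: eq_bigr => i _; rewrite subSS subKn ?leq_ord.
have -> : \sum_(k < n.+1) rho k = (1 + theta^-1 * n%:R) * rho n.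
  have t0 : theta != 0 by rewrite gt_eqF.
  apply: (mulfI t0); rewrite rising_sum.
  rewrite [RHS](_ : _ = (theta + theta * theta^-1 * n%:R) * rho n); last by ring.
  by rewrite mulfV // mul1r.
rewrite ler_wpM2r // -natr1.
have : 0 <= theta^-1 by rewrite invr_ge0 ltW.
have : 0 <= n%:R :> R by [].
move: (theta^-1) (n%:R) => x y; nra.
Qed.

Lemma rising_perturbation : exists2 C : R, 0 <= C & forall (al : R[i]) n, normc al = 1 ->
  normc (fps_mul (fps_exp (fun k => al * c k)) (rising (al * theta%:C)) n -
         cexp (al * K) * rising (al * theta%:C) n) <=
  C * (pw (theta - 1 - g) n * (1 + ln n.+1%:R)).
Proof.
have ti : 0 <= theta^-1 by rewrite invr_ge0 ltW.
have gi : 0 <= g^-1 by rewrite invr_ge0 ltW.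
have C10 : 0 <= C1 by exact: expR_ge0.
have H0 : 0 <= E * expR 2 by apply: mulr_ge0 => //; exact: expR_ge0.
have H1 : 0 <= E * expR 2 * (2 + theta^-1) * C1.
  by apply: mulr_ge0 => //; apply: mulr_ge0 => //; apply: addr_ge0.
have H2 : 0 <= E * g^-1 * C1 by apply: mulr_ge0 => //; apply: mulr_ge0.
exists (E * C2 + E * expR 2 * (2 + theta^-1) * C1 + E * g^-1 * C1).
  by apply: addr_ge0 => //; apply: addr_ge0.
move=> al n al1.
set e := fps_exp _; set a := rising _; set P := pw (theta - 1 - g) n; set L := 1 + _.
have P0 : 0 <= P by exact: pw_ge0.
have L1 : 1 <= L by rewrite lerDl ln_ge0 // ler1n.
have -> : fps_mul e a n - cexp (al * K) * a n =
    \sum_(k < n.+1) e k * (a (n - k)%N - a n) - (cexp (al * K) - \sum_(k < n.+1) e k) * a n.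
  have -> : \sum_(k < n.+1) e k * (a (n - k)%N - a n) = fps_mul e a n - (\sum_(k < n.+1) e k) * a n.
    by rewrite /fps_mul mulr_suml -sumrB; apply: eq_bigr => k _; rewrite mulrBr.
  by ring.
apply: le_trans (ler_normcB _ _) _; rewrite [leRHS]mulrDl lerD //.
  apply: le_trans (ler_normc_sum _ _ _) _.
  apply: (le_trans (ler_sum _ (fun (k : 'I_n.+1) _ => term_le al1 (leq_ord k)))).
  rewrite big_split /= -!mulr_sumr mulrDl lerD //.
    apply: (le_trans (ler_wpM2l _ (pw_sum_gamma n g01))).
      by rewrite mulr_ge0 // pw_ge0.
    have eP : theta - 1 - g = (theta - 2) + (1 - g) by ring.
    rewrite /P eP (pwD (theta - 2) (1 - g)).
    by rewrite !mulrA.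
  have s1 : \sum_(k < n.+1) (rho (n - k) + rho n) <= (2 + theta^-1) * n.+1%:R * rho n.
    rewrite big_split /= sumr_const card_ord -mulr_natl.
    apply: le_trans (lerD (sum_rho n) (lexx _)) _.
    by rewrite le_eqVlt; apply/orP; left; apply/eqP; ring.
  have s2 : (2 + theta^-1) * n.+1%:R * rho n <= (2 + theta^-1) * n.+1%:R * (C1 * pw (theta - 1) n).
    by rewrite ler_wpM2l // mulr_ge0 // addr_ge0.
  apply: (le_trans (ler_wpM2l _ (le_trans s1 s2))).
    by rewrite mulr_ge0 // pw_ge0.
  have -> : E * expR 2 * pw (-1 - g) n * ((2 + theta^-1) * n.+1%:R * (C1 * pw (theta - 1) n)) =
      E * expR 2 * (2 + theta^-1) * C1 * P.
    have -> : P = pw (- 1 - g) n * n.+1%:R * pw (theta - 1) n.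
      by rewrite [-1 - g]addrC pw_mulS /P addrC -(pwD (- g)).
    by ring.
  by rewrite ler_wpM2l ?ler_peMr.
rewrite normcM.
have aK : csum e (cexp (al * K)).
  apply: (@csum_fps_exp _ _ (A * (1 + g^-1))); last exact: csumZ.
    by rewrite c0 mulr0.
  move=> N; apply: (@le_trans _ _ (\sum_(k < N) A * pw (- 1 - g) k)).
    by apply: ler_sum => k _; rewrite normcM al1 mul1r.
  by rewrite -mulr_sumr ler_wpM2l // pw_sum.
have t1 : normc (cexp (al * K) - \sum_(k < n.+1) e k) <= E * (g^-1 * pw (- g) n).
  apply: csum_tail_le => // N; apply: (@le_trans _ _ (\sum_(k < N) E * pw (- 1 - g) (n.+1 + k))).
    by apply: ler_sum => k _; apply: fps_exp_le.
  by rewrite -mulr_sumr ler_wpM2l // pw_tail.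
apply: (le_trans (ler_pM (normc_ge0 _) (normc_ge0 _) t1 (le_trans (normc_rising n al1) (rho_le n)))).
have -> : E * (g^-1 * pw (- g) n) * (C1 * pw (theta - 1) n) = E * g^-1 * C1 * P.
  have -> : P = pw (- g) n * pw (theta - 1) n by rewrite /P addrC -(pwD (- g)).
  by ring.
by rewrite ler_wpM2l ?ler_peMr.
Qed.

End RisingPerturbation.

(** * The two classes *)

Section Classes.
Context {R : realType}.
Implicit Types (a c : nat -> R[i]) (g : R[i] -> R[i]) (r theta gamma : R) (K : R[i]).

Lemma powR_succ_le (x : R) n : (0 < n)%N -> n%:R `^ x <= expR `|x| * pw x n.
Proof.
case: n => // n _; rewrite /powR gt_eqF ?ltr0n //.
by apply: (@pw_half _ x n n.+1) => //; lia.
Qed.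

Lemma eventually_le_pw a (M x : R) :
  (\forall n \near \oo, normc (a n) <= M * n%:R `^ x) ->
  exists2 A : R, 0 <= A & forall n, normc (a n) <= A * pw x n.
Proof.
move=> [N _ hN]; pose B : R := \sum_(k < N.+1) normc (a k) / pw x k.
have t0 k : 0 <= normc (a k) / pw x k by rewrite divr_ge0 ?normc_ge0 ?pw_ge0.
have B0 : 0 <= B by apply: sumr_ge0.
have M0 : 0 <= `|M| * expR `|x| by rewrite mulr_ge0 ?expR_ge0.
exists (`|M| * expR `|x| + B); first exact: addr_ge0.
move=> n; rewrite mulrDl; have [nN|Nn] := leqP n N.
  apply: ler_wpDl; first by rewrite mulr_ge0 // pw_ge0.
  rewrite -ler_pdivrMr ?pw_gt0 // /B (bigD1 (Ordinal (nN : n < N.+1)%N)) //=.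
  by rewrite lerDl sumr_ge0.
apply: ler_wpDr; first by rewrite mulr_ge0 // pw_ge0.
apply: le_trans (hN n (ltnW Nn)) _; rewrite -mulrA.
apply: (@le_trans _ _ (`|M| * n%:R `^ x)).
  by rewrite ler_wpM2r ?powR_ge0 ?ler_norm.
by rewrite ler_wpM2l ?powR_succ_le // (leq_ltn_trans (leq0n N) Nn).
Qed.

Lemma is_sum_near0_log_sing r theta :
  is_sum_near0 (fun k => theta%:C * ((if k is 0 then 0 else k%:R^-1) * (r%:C^-1) ^+ k))
    (log_sing r theta).
Proof. exact: is_sum_near0Z (is_sum_near0_dilate _ is_sum_near0_log). Qed.

Lemma class_eF_transfer a g r theta gamma K : 0 < theta -> a 0%N = 0 -> is_sum_near0 a g ->
  class_eF r theta gamma K g -> exists2 C : R, 0 <= C & forall (al : R[i]) n, normc al = 1 ->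
  normc (fps_exp (fun k => al * a k) n * r%:C ^+ n -
         cexp (al * K) * rising (al * theta%:C) n) <=
  C * (pw (theta - 1 - gamma) n * (1 + ln n.+1%:R)).
Proof.
move=> theta0 a0 a_sum [r0 _ g01 [g0 [c [_ gE c_sum [M cM] cK]]]].
have rC0 : r%:C != 0 by rewrite -normc_eq0 normc_real gtr0_norm // gt_eqF.
have aE : (fun k => theta%:C * ((if k is 0 then 0 else k%:R^-1) * (r%:C^-1) ^+ k) + c k) =1 a.
  apply: is_sum_near0_unique a_sum.
  apply: (eq_is_sum_near0 (fun=> erefl) r0 _ (is_sum_near0D (is_sum_near0_log_sing r theta) c_sum)).
  by move=> t /gE ->.
have c0 : c 0%N = 0 by have := aE 0%N; rewrite a0 mul0r mulr0 add0r.
have [A A0 cA] : exists2 A : R, 0 <= A &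
    forall n, normc (c n * r%:C ^+ n) <= A * pw (- 1 - gamma) n.
  apply: (@eventually_le_pw _ M); case: cM => N _ hN; exists N => // n /= /hN h.
  rewrite normcM normcX normc_real gtr0_norm //.
  apply: le_trans (ler_wpM2r (exprn_ge0 n (ltW r0)) h) _.
  rewrite [leLHS](_ : _ = M * n%:R `^ (- 1 - gamma) * (r ^- n * r ^+ n)); last by ring.
  by rewrite mulVf ?mulr1 // expf_neq0 // gt_eqF.
have [C C0 hC] := @rising_perturbation _ gamma theta A (fun n => c n * r%:C ^+ n) K
  g01 theta0 A0 (etrans (congr1 (fun x => x * _) c0) (mul0r _)) cA (proj2 (csumP _ _) cK).
exists C => // al n al1; have := hC al n al1; congr (normc (_ - _) <= _).
rewrite -fps_exp_scale.
pose b k : R[i] := if k is 0 then 0 else al * theta%:C / k%:R.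
have -> : fps_mul (fps_exp (fun k => al * (c k * r%:C ^+ k))) (rising (al * theta%:C)) n =
    fps_mul (fps_exp (fun k => al * (c k * r%:C ^+ k))) (fps_exp b) n.
  by rewrite /fps_mul; apply: eq_bigr => k _; rewrite rising_fps_exp.
rewrite fps_exp_add ?c0 ?mul0r ?mulr0 //; congr (fps_exp _ n); apply/funext => k.
rewrite -aE /b; case: k => [|k]; first by rewrite c0; ring.
rewrite mulrDr mulrDl addrC; congr (_ + _); last by rewrite mulrA.
rewrite exprVn; have rk : r%:C ^+ k.+1 != 0 by rewrite expf_neq0.
have -> : al * (theta%:C * (k.+1%:R^-1 * (r%:C ^+ k.+1)^-1)) * r%:C ^+ k.+1 =
  al * theta%:C * k.+1%:R^-1 * ((r%:C ^+ k.+1)^-1 * r%:C ^+ k.+1) by ring.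
by rewrite mulVf ?mulr1.
Qed.

Lemma class_F_transfer a g r theta K : a 0%N = 0 -> is_sum_near0 a g -> class_F r theta K g ->
  exists (C : R) (N : nat), 0 <= C /\ forall n s, (N <= n)%N ->
  normc (fps_exp (fun k => cis s * a k) n * r%:C ^+ n -
         cexp (cis s * K) * rising (cis s * theta%:C) n) <=
  C * expR ((theta * cos s - 2) * ln (n%:R : R)).
Proof.
move=> a0 a_sum [r0 theta0 [rho [phi [r_rho hphi g_hol [M /near_normcP [eta eta0 hM]]]]]].
apply: (@singularity_transfer _ a g K r theta rho phi `|M| eta) => //.
- by move=> z /g_hol; exact: derivable_cdiff.
- move=> z /hM h /h; move/le_trans; apply; rewrite ler_wpM2r ?normc_ge0 ?ler_norm //.
Qed.

End Classes.

(** * Asymptotics of quotients *)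

Section QuotientAsymptotics.
Context {R : realType}.
Implicit Types (s theta gamma : R) (K : R[i]).

Lemma quotient_perturbation (G H d d0 : R[i]) (Z M : R) : H != 0 ->
  normc G <= M -> normc d <= Z -> normc d0 <= Z -> Z <= normc H / 2 ->
  H + d0 != 0 /\
  normc ((G + d) / (H + d0) - G / H) <= 2 * (normc H + M) / normc H ^+ 2 * Z.
Proof.
move=> H0 GM dZ d0Z ZH; have h0 : 0 < normc H by rewrite normc_gt0.
have hd : normc H / 2 <= normc (H + d0).
  have := ler_normcD (H + d0) (- d0); rewrite addrK normcNE; lra.
have hd0 : 0 < normc (H + d0) by apply: lt_le_trans hd; lra.
have Hd : H + d0 != 0 by rewrite -normc_gt0.
split=> //.
have -> : (G + d) / (H + d0) - G / H = (d * H - G * d0) * ((H + d0)^-1 * H^-1).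
  by field; rewrite H0 Hd.
rewrite !normcM !normcV.
have Z0 : 0 <= Z by exact: le_trans (normc_ge0 _) dZ.
have n1 : normc (d * H - G * d0) <= (normc H + M) * Z.
  apply: le_trans (ler_normcB _ _) _; rewrite !normcM mulrDl lerD //.
    by rewrite mulrC ler_wpM2l // normc_ge0.
  by rewrite ler_pM ?normc_ge0.
have n2 : (normc (H + d0))^-1 <= 2 * (normc H)^-1.
  by rewrite -[2]invrK -invfM lef_pV2 ?posrE // ?mulr_gt0 ?invr_gt0 // mulrC.
apply: (@le_trans _ _ ((normc H + M) * Z * (2 * (normc H)^-1 * (normc H)^-1))).
  apply: ler_pM; rewrite ?normc_ge0 ?mulr_ge0 ?invr_ge0 ?normc_ge0 //.
  by rewrite ler_wpM2r ?invr_ge0 ?normc_ge0.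
rewrite le_eqVlt; apply/orP; left; apply/eqP; field.
by rewrite gt_eqF.
Qed.

Lemma ln_unbounded (L : R) : exists2 N : nat, (0 < N)%N &
  forall n, (N <= n)%N -> L <= ln (n%:R : R).
Proof.
exists (Num.truncn (expR L)).+1 => // n Nn.
have h : expR L < n%:R by apply: lt_le_trans (truncnS_gt _) _; rewrite ler_nat.
by rewrite -ler_expR lnK ?ltW // posrE (lt_trans (expR_gt0 L)).
Qed.

Lemma ln_over_powR_small gamma (e : R) : 0 < gamma -> 0 < e -> exists N : nat,
  forall n, (N <= n)%N -> ln (n%:R : R) * expR (- gamma * ln n%:R) <= e.
Proof.
move=> g0 e0; have [N _ hN] := ln_unbounded (4 / (gamma ^+ 2 * e) + 1).
have c0 : 0 < 4 / (gamma ^+ 2 * e) by rewrite divr_gt0 // mulr_gt0 // exprn_gt0.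
exists N => n /hN; move: (ln _) => t ht.
have t0 : 0 < t by lra.
have k : (gamma * t / 2) ^+ 2 <= expR (gamma * t).
  have -> : expR (gamma * t) = expR (gamma * t / 2) ^+ 2.
    by rewrite expr2 -expRD; congr expR; field.
  have x0 : 0 <= gamma * t / 2 by rewrite divr_ge0 // mulr_ge0 // ltW.
  rewrite lerXn2r ?nnegrE ?expR_ge0 //.
  by apply: le_trans (expR_ge1Dx _); rewrite lerDr.
rewrite mulNr expRN ler_pdivrMr ?expR_gt0 //.
apply: le_trans (ler_wpM2l (ltW e0) k).
have : 4 / (gamma ^+ 2 * e) <= t by lra.
rewrite ler_pdivrMr ?mulr_gt0 ?exprn_gt0 // => h.
have h2 : 4 * t <= t * (gamma ^+ 2 * e) * t by rewrite ler_wpM2r // ltW.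
have -> : e * (gamma * t / 2) ^+ 2 = t * (gamma ^+ 2 * e) * t / 4 by field.
by rewrite ler_pdivlMr // mulrC.
Qed.

Let X theta s n : R[i] := natcpow n (cis s * theta%:C - 1).

Let normcX theta s n : normc (X theta s n) = expR ((theta * cos s - 1) * ln n%:R).
Proof.
rewrite normc_natcpow cisE ReD ReM ReN /= mulr0 subr0.
by rewrite [cos s * _]mulrC.
Qed.

Let cis0 : cis 0 = 1 :> R[i].
Proof. by rewrite cisE cos0 sin0. Qed.

Let Xquotient theta s n : X theta s n = X theta 0 n * natcpow n (theta%:C * (cis s - 1)).
Proof. by rewrite /X -natcpowD cis0; congr natcpow; ring. Qed.

Let cexp_quotient K s : cexp (cis s * K) = cexp K * cexp (K * (cis s - 1)).
Proof. by rewrite -cexpD; congr cexp; ring. Qed.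

Let normc_cexpN K s : normc (cexp (cis s * K))^-1 <= expR (normc K).
Proof. by rewrite -cexpN -mulrN; apply: le_trans (normc_cexp_cis_le _ _) _; rewrite normcNE. Qed.

Variables (F : nat -> R -> R[i]) (theta : R) (K : R[i]).
Hypothesis theta0 : 0 < theta.

Let bounded_arg s : normc (cis s * theta%:C) <= theta.
Proof. by rewrite normcM normc_cis mul1r normc_real gtr0_norm. Qed.

Let H : R[i] := rGamma theta%:C.
Let H0 : H != 0. Proof. exact: rGamma_gt0_neq0. Qed.

Lemma quotient_asymptotics_inv (C : R) (N : nat) : 0 <= C ->
  (forall n s, (N <= n)%N -> normc (F n s - cexp (cis s * K) * rising (cis s * theta%:C) n) <=
     C * expR ((theta * cos s - 2) * ln (n%:R : R))) ->
  exists (M : R) (N' : nat), forall n s, (N' <= n)%N -> F n 0 != 0 /\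
  exists2 eps : R[i], normc eps <= M / n%:R &
    F n s / F n 0 = natcpow n (theta%:C * (cis s - 1)) * cexp (K * (cis s - 1)) *
      (rGamma (theta%:C * cis s) / rGamma theta%:C + eps).
Proof.
move=> C0 hF.
have [M M0 hM] := rGamma_bounded (ltW theta0).
have [D [N1 [D0 hD]]] := rising_asymptotic (ltW theta0).
pose D' := C * expR (normc K) + D.
have D'0 : 0 <= D' by rewrite addr_ge0 // mulr_ge0 // expR_ge0.
have h0 : 0 < normc H by rewrite normc_gt0.
pose d n s : R[i] := F n s / (cexp (cis s * K) * X theta s n) - rGamma (cis s * theta%:C).
have Fd n s : F n s = cexp (cis s * K) * X theta s n * (rGamma (cis s * theta%:C) + d n s).
  rewrite /d addrC subrK mulrC divfK // mulf_neq0 ?cexp_neq0 ?natcpow_neq0 //.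
have hd n s : (0 < n)%N -> (N <= n)%N -> (N1 <= n)%N -> normc (d n s) <= D' * n%:R^-1.
  move=> n0 Nn N1n.
  have -> : d n s = (cexp (cis s * K))^-1 * (X theta s n)^-1 *
     (F n s - cexp (cis s * K) * rising (cis s * theta%:C) n) +
     (X theta s n)^-1 * (rising (cis s * theta%:C) n - X theta s n * rGamma (cis s * theta%:C)).
    have e0 := cexp_neq0 (cis s * K); have x0 := natcpow_neq0 n (cis s * theta%:C - 1).
    by rewrite /d /X; move: (cexp _) (natcpow _ _) e0 x0 => e x e0 x0; field; rewrite e0 x0.
  apply: le_trans (ler_normcD _ _) _; rewrite mulrDl; apply: lerD.
    rewrite normcM normcM.
    have x0 : 0 < expR ((theta * cos s - 1) * ln (n%:R : R)) by exact: expR_gt0.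
    have e1 : expR ((theta * cos s - 2) * ln (n%:R : R)) =
        expR ((theta * cos s - 1) * ln (n%:R : R)) * n%:R^-1.
      rewrite -[in n%:R^-1](@lnK _ n%:R) ?posrE ?ltr0n // -expRN -expRD; congr expR; ring.
    have e2 : normc (X theta s n)^-1 = (expR ((theta * cos s - 1) * ln (n%:R : R)))^-1.
      by rewrite normcV normcX.
    have := hF n s Nn; rewrite e1 e2.
    move: (expR ((theta * cos s - 1) * _)) x0 => x x0 h.
    have := ler_wpM2l (ltW (expR_gt0 (normc K))) (ler_wpM2l (_ : 0 <= x^-1) h).
    rewrite invr_ge0 ltW // => /(_ isT) h'.
    have b0 : 0 <= x^-1 * normc (F n s - cexp (cis s * K) * rising (cis s * theta%:C) n).
      by rewrite mulr_ge0 ?normc_ge0 // invr_ge0 ltW.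
    rewrite -mulrA; apply: le_trans (ler_wpM2r b0 (normc_cexpN K s)) _.
    apply: le_trans h' _.
    rewrite le_eqVlt; apply/orP; left; apply/eqP.
    rewrite [LHS](_ : _ = C * expR (normc K) * n%:R^-1 * (x^-1 * x)); last by ring.
    by rewrite mulVf ?mulr1 // gt_eqF.
  rewrite normcM normcV.
  have xp : 0 < normc (X theta s n) by rewrite normc_gt0 natcpow_neq0.
  by rewrite [leLHS]mulrC ler_pdivrMr // [leRHS]mulrC; apply: hD.
have [N2 N20 hN2] : exists2 N2 : nat, (0 < N2)%N & forall n, (N2 <= n)%N -> D' * n%:R^-1 <= normc H / 2.
  exists (Num.truncn (D' / (normc H / 2))).+1 => // n Nn.
  have h : D' / (normc H / 2) < n%:R by apply: lt_le_trans (truncnS_gt _) _; rewrite ler_nat.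
  have n0 : 0 < n%:R :> R by apply: le_lt_trans h; rewrite !divr_ge0 // ltW.
  rewrite ler_pdivrMr //; move: h; rewrite ltr_pdivrMr ?divr_gt0 // => /ltW; by rewrite mulrC.
exists (2 * (normc H + M) / normc H ^+ 2 * D'), (maxn N (maxn N1 N2)) => n s.
rewrite !geq_max => /and3P[Nn N1n N2n].
have n0 : (0 < n)%N by exact: leq_trans N20 N2n.
have hH : rGamma (cis 0 * theta%:C) = H by rewrite cis0 mul1r.
have [q1 q2] := quotient_perturbation H0 (hM _ (bounded_arg s)) (hd n s n0 Nn N1n)
  (hd n 0 n0 Nn N1n) (hN2 n N2n).
have F0 : F n 0 = cexp K * X theta 0 n * (H + d n 0).
  by rewrite Fd hH cis0 mul1r.
split.
  rewrite F0; apply: mulf_neq0 => //.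
  by apply: mulf_neq0; [exact: cexp_neq0|exact: natcpow_neq0].
exists ((rGamma (cis s * theta%:C) + d n s) / (H + d n 0) - rGamma (cis s * theta%:C) / H).
  by move: q2; rewrite mulrA.
rewrite [theta%:C * cis s]mulrC [_ / H + _]addrC subrK F0 Fd Xquotient cexp_quotient.
have e0 := cexp_neq0 K; have x0 : X theta 0 n != 0 by exact: natcpow_neq0.
move: (cexp K) (X theta 0 n) (H + d n 0) (cexp _) (natcpow _ _) (_ + _) e0 x0 q1 => e x h u v w e1 x1 q1.
by field; rewrite e1 x1 q1.
Qed.

Lemma quotient_asymptotics_ln (gamma C : R) : 0 < gamma <= 1 -> 0 <= C ->
  (forall n s, normc (F n s - cexp (cis s * K) * rising (cis s * theta%:C) n) <=
     C * (pw (theta - 1 - gamma) n * (1 + ln n.+1%:R))) ->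
  exists (M : R) (N' : nat), forall n s, (N' <= n)%N -> F n 0 != 0 /\
  normc (F n s / F n 0 - natcpow n (theta%:C * (cis s - 1)) * cexp (K * (cis s - 1)) *
      (rGamma (theta%:C * cis s) / rGamma theta%:C)) <=
  M * (ln n%:R * expR (- gamma * ln n%:R)).
Proof.
move=> /andP[g0 g1] C0 hF.
have [M M0 hM] := rGamma_bounded (ltW theta0).
have [D [N1 [D0 hD]]] := rising_asymptotic (ltW theta0).
have [N2 N20 hN2] := ln_unbounded 1.
pose q n : R := ln n%:R * expR (- gamma * ln n%:R).
pose A := expR (normc K).
have A1 : 1 <= A by rewrite -expR0 ler_expR normc_ge0.
have A0 : 0 <= A by exact: expR_ge0.
have h0 : 0 < normc H by rewrite normc_gt0.
pose B := expR `|theta - 1 - gamma|.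
have B0 : 0 <= B by exact: expR_ge0.
pose D' := 3 * (A * C * B) + A * A * D.
have D'0 : 0 <= D' by rewrite addr_ge0 // !mulr_ge0.
pose P n s := natcpow n (theta%:C * (cis s - 1)) * cexp (K * (cis s - 1)).
have normcP n s : (0 < n)%N -> normc (P n s) <= A * A.
  move=> n0; rewrite normcM normc_natcpow -[leRHS]mul1r; apply: ler_pM; rewrite ?expR_ge0 ?normc_ge0 //.
    rewrite -[leRHS]expR0 ler_expR mulr_le0_ge0 ?ln_ge0 ?ler1n //.
    rewrite cisE ReM ReD ReN /= mul0r subr0 mulr_ge0_le0 ?(ltW theta0) //.
  apply: le_trans (normc_cexp_le _) _; rewrite /A -expRD ler_expR normcM.
  rewrite -mulr2n -[leRHS]mulr_natr ler_wpM2l ?normc_ge0 //.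
  by apply: le_trans (ler_normcB _ _) _; rewrite normc_cis normc1E.
pose G s : R[i] := rGamma (cis s * theta%:C).
pose d n s : R[i] := F n s / (cexp K * X theta 0 n) - P n s * G s.
have Fd n s : F n s = cexp K * X theta 0 n * (P n s * G s + d n s).
  rewrite /d addrC subrK mulrC divfK //.
  by apply: mulf_neq0; [exact: cexp_neq0|exact: natcpow_neq0].
have X0 n : normc (X theta 0 n) = expR ((theta - 1) * ln n%:R) by rewrite normcX cos0 mulr1.
have lnS n : (0 < n)%N -> ln (n.+1%:R : R) <= ln n%:R + 1.
  move=> n0; have /andP[_] := @ln_succ_bounds R n n0; rewrite lerBlDl => /le_trans; apply.
  by rewrite lerD2l invf_le1 ?ltr0n ?ler1n.
have pwB n : (0 < n)%N -> pw (theta - 1 - gamma) n <=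
    B * (expR (- gamma * ln n%:R) * normc (X theta 0 n)).
  move=> n0; rewrite X0 -!expRD ler_expR.
  have l1 := lnS n n0; set x := theta - 1 - gamma.
  have l2 : ln (n%:R : R) <= ln n.+1%:R by rewrite ler_ln ?posrE ?ltr0n // ler_nat.
  have -> : - gamma * ln n%:R + (theta - 1) * ln n%:R = x * ln n%:R by rewrite /x; ring.
  rewrite -lerBlDr -mulrBr; apply: le_trans (ler_norm _) _; rewrite normrM.
  by rewrite ler_piMr // ger0_norm ?subr_ge0 // lerBlDl.
have hd n s : (N1 <= n)%N -> (N2 <= n)%N -> normc (d n s) <= D' * q n.
  move=> N1n N2n; have n0 : (0 < n)%N by exact: leq_trans N20 N2n.
  have l1 := hN2 n N2n; have e0 := cexp_neq0 K.
  have x0 : X theta 0 n != 0 by exact: natcpow_neq0.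
  have xp : 0 < normc (X theta 0 n) by rewrite normc_gt0.
  have -> : d n s = (cexp K)^-1 * (X theta 0 n)^-1 *
     (F n s - cexp (cis s * K) * rising (cis s * theta%:C) n) +
     (cexp K)^-1 * cexp (cis s * K) * (X theta 0 n)^-1 *
       (rising (cis s * theta%:C) n - X theta s n * rGamma (cis s * theta%:C)).
    rewrite /d /P /G (Xquotient theta s) (cexp_quotient K s).
    move: (cexp K) (X theta 0 n) e0 x0 => e x e0 x0.
    by field; rewrite e0 x0.
  have nK : normc (cexp K)^-1 <= A.
    by rewrite -cexpN; apply: le_trans (normc_cexp_le _) _; rewrite normcNE.
  apply: le_trans (ler_normcD _ _) _; rewrite [leRHS]mulrDl; apply: lerD.
    rewrite normcM normcM -mulrA.
    have b : normc (F n s - cexp (cis s * K) * rising (cis s * theta%:C) n) <=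
       normc (X theta 0 n) * (3 * (C * B) * q n).
      rewrite [leRHS](_ : _ = C * (B * (expR (- gamma * ln n%:R) * normc (X theta 0 n)) * (3 * ln n%:R))).
        apply: le_trans (hF n s) _; rewrite ler_wpM2l //.
        have l2 : 0 <= ln (n.+1%:R : R) by rewrite ln_ge0 ?ler1n.
        have l3 := lnS n n0.
        apply: ler_pM; rewrite ?pw_ge0 ?pwB ?addr_ge0 //; lra.
      by rewrite /q; ring.
    rewrite [leRHS](_ : _ = A * (3 * (C * B) * q n)); last by ring.
    apply: ler_pM => //; rewrite ?mulr_ge0 ?normc_ge0 //.
    by rewrite normcV mulrC ler_pdivrMr // [leRHS]mulrC.
  rewrite normcM normcM normcM normcV -mulrA -[_ * A * D * _]mulrA.
  apply: ler_pM; rewrite ?mulr_ge0 ?normc_ge0 ?invr_ge0 ?normc_ge0 //.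
    apply: ler_pM; rewrite ?mulr_ge0 ?normc_ge0 ?invr_ge0 ?normc_ge0 //.
      by rewrite -normcV.
    exact: normc_cexp_cis_le.
  rewrite [leLHS]mulrC normcV ler_pdivrMr //.
  apply: le_trans (hD _ _ N1n (bounded_arg s)) _; rewrite mulrC.
  have xs : normc (X theta s n) <= normc (X theta 0 n).
    rewrite X0 normcX ler_expR ler_wpM2r ?ln_ge0 ?ler1n // lerD2r.
    by rewrite ler_piMr ?(ltW theta0) // cos_le1.
  apply: ler_pM; rewrite ?normc_ge0 ?mulr_ge0 ?invr_ge0 // ler_wpM2l //.
  have -> : n%:R^-1 = 1 * expR (- ln (n%:R : R)) by rewrite mul1r expRN lnK // posrE ltr0n.
  apply: ler_pM; rewrite ?expR_ge0 // ler_expR mulNr lerN2 ler_piMl //.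
  by rewrite ln_ge0 ?ler1n.
have [N3 hN3] : exists N3 : nat, forall n, (N3 <= n)%N -> D' * q n <= normc H / 2.
  have e0 : 0 < normc H / 2 / (D' + 1) by rewrite !divr_gt0 // ltr_wpDl.
  have [N3 hN3] := ln_over_powR_small g0 e0; exists N3 => n /hN3 h.
  apply: le_trans (ler_wpM2l D'0 h) _; rewrite mulrCA ler_piMr ?divr_ge0 ?(ltW h0) //.
  by rewrite ler_pdivrMr ?ltr_wpDl // mul1r lerDl.
exists (2 * (normc H + A * A * M) / normc H ^+ 2 * D'), (maxn N1 (maxn N2 N3)) => n s.
rewrite !geq_max => /and3P[N1n N2n N3n].
have n0 : (0 < n)%N by exact: leq_trans N20 N2n.
have P0 : P n 0 = 1 by rewrite /P cis0 subrr !mulr0 /natcpow mul0r cexp0 mulr1.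
have hH : P n 0 * G 0 = H by rewrite P0 mul1r /G cis0 mul1r.
have hG : normc (P n s * G s) <= A * A * M.
  by rewrite normcM; apply: ler_pM; rewrite ?normc_ge0 ?normcP // hM.
have [q1 q2] := quotient_perturbation H0 hG (hd n s N1n N2n) (hd n 0 N1n N2n) (hN3 n N3n).
have F0 : F n 0 = cexp K * X theta 0 n * (H + d n 0) by rewrite Fd hH.
split.
  rewrite F0; apply: mulf_neq0 => //.
  by apply: mulf_neq0; [exact: cexp_neq0|exact: natcpow_neq0].
rewrite -[_ * D' * _]mulrA; apply: le_trans q2.
rewrite [theta%:C * cis s]mulrC -/(P n s) -/(G s) -/H mulrA F0 Fd.
rewrite -mulf_div mulfV ?mul1r //.
by apply: mulf_neq0; [exact: cexp_neq0|exact: natcpow_neq0].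
Qed.

End QuotientAsymptotics.

Section Expectations.
Context {R : realType}.
Variable Theta : nat -> R.
Hypothesis Theta_ge0 : forall m : nat, (0 < m)%N -> 0 <= Theta m.

Lemma Gamma_quotient (z w : R[i]) : Gamma z / Gamma w = rGamma w / rGamma z.
Proof. by rewrite /Gamma invrK mulrC. Qed.

Lemma ETheta_quotient (r : R) n s : let F s :=
    fps_exp (fun k => cis s * gTheta Theta k) n * r%:C ^+ n in
  F 0 != 0 ->
  ETheta Theta (fun sigma : 'S_n => cexp ((0 +i* s) * (K0 sigma)%:R)) = F s / F 0.
Proof.
move=> F; have F0 : F 0 = (h Theta n)%:C * r%:C ^+ n.
  rewrite /F h_fps_exp //; congr (fps_exp _ n * _).
  by apply/funext => k; rewrite cisE cos0 sin0 mul1r.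
rewrite F0 mulf_eq0 => /norP[h0 r0].
rewrite /F /cis -h_ETheta_cexp // -mulf_div mulfV // mulr1.
by rewrite mulrAC mulfV // mul1r.
Qed.

End Expectations.

Unset Implicit Arguments.
Theorem lemma4p1 (R : realType) (Theta : nat -> R)
    (Theta_ge0 : forall m : nat, (0 < m)%N -> 0 <= Theta m) :
  (forall w : R[i],
     (fun n : nat => (h Theta n)%:C *
        ETheta Theta (fun sigma : 'S_n => cexp (w * (K0 sigma)%:R)))
     = (fun n : nat => (h Theta n)%:C *
        ETheta Theta (fun sigma : 'S_n =>
          cexp (w * \sum_(1 <= m < n.+1) (ncycles m sigma)%:R)))
     /\
     (fun n : nat => (h Theta n)%:C *
        ETheta Theta (fun sigma : 'S_n =>
          cexp (w * \sum_(1 <= m < n.+1) (ncycles m sigma)%:R)))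
     = fps_exp (fun k : nat => cexp w * gTheta Theta k))
  /\
  (forall (r theta : R) (K : R[i]),
     0 < theta -> gTheta_class Theta (class_F r theta K) ->
     forall B : R, exists M : R, \forall n \near \oo,
       forall s : R, `|s| <= B ->
       exists2 eps : R[i], normc eps <= M / n%:R &
         ETheta Theta (fun sigma : 'S_n => cexp ((0 +i* s) * (K0 sigma)%:R))
         = natcpow n (theta%:C * (cexp (0 +i* s) - 1))
           * cexp (K * (cexp (0 +i* s) - 1))
           * (Gamma theta%:C / Gamma (theta%:C * cexp (0 +i* s)) + eps))
  /\
  (forall (r theta gamma : R) (K : R[i]),
     0 < theta -> gTheta_class Theta (class_eF r theta gamma K) ->
     forall B : R, exists M : R, \forall n \near \oo,
       forall s : R, `|s| <= B ->
       normc (ETheta Theta (fun sigma : 'S_n =>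
                cexp ((0 +i* s) * (K0 sigma)%:R))
              - natcpow n (theta%:C * (cexp (0 +i* s) - 1))
                * cexp (K * (cexp (0 +i* s) - 1))
                * (Gamma theta%:C / Gamma (theta%:C * cexp (0 +i* s))))
       <= M * (ln n%:R / n%:R `^ gamma)).
Proof.
split; last split.
- move=> w; split; apply/funext => n.
    congr (_ * ETheta Theta _); apply/funext => sigma.
    by rewrite /K0 natr_sum.
  rewrite -h_ETheta_cexp //; congr (_ * ETheta Theta _); apply/funext => sigma.
  by rewrite /K0 natr_sum.
- move=> r theta K theta0 [g [g_sum gF]] B.
  have [C [N [C0 hC]]] := class_F_transfer erefl g_sum gF.
  have [M [N' hN']] := quotient_asymptotics_inv
    (F := fun n s => fps_exp (fun k => cis s * gTheta Theta k) n * r%:C ^+ n) theta0 C0 hC.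
  exists M; exists N' => // n /= Nn s _; have [F0 [eps e1 e2]] := hN' n s Nn.
  exists eps => //; rewrite Gamma_quotient -/(cis s) -e2; exact: ETheta_quotient.
- move=> r theta gamma K theta0 [g [g_sum gF]] B.
  have [_ _ g01 _] := gF.
  have [C C0 hC] := class_eF_transfer theta0 erefl g_sum gF.
  have [M [N' hN']] := quotient_asymptotics_ln
    (F := fun n s => fps_exp (fun k => cis s * gTheta Theta k) n * r%:C ^+ n) theta0 g01 C0
    (fun n s => hC (cis s) n (normc_cis s)).
  exists M; exists (maxn N' 1) => // n /=; rewrite geq_max => /andP[Nn n0] s _.
  have [F0 e1] := hN' n s Nn.
  rewrite (ETheta_quotient Theta_ge0 s F0) Gamma_quotient -/(cis s).
  rewrite /powR pnatr_eq0 gtn_eqF // -expRN -[- (gamma * _)]mulNr; exact: e1.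
Qed.
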